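(* For every $\sigma_x>0$ there exist constants $b,c>0$ depending only on $\sigma_x$ such that the following holds for every instance of the setting described in the context. Suppose that all entries of $X$ are independent, and that $\theta^*$ is random, independent of $X$, obtained from a fixed vector $\bar\theta\in\mathbb R^p$ by flipping the sign of each coordinate independently with probability $1/2$. Take $k=\min\{\kappa:\rho_\kappa(0)>b\}$ and suppose that $k<n/c$. Then the value of $\lambda$ that minimizes $\mathbb E_{\theta^*}B(\lambda)+v_\varepsilon^2V(\lambda)$ is negative with probability (over $X$) at least $1-ce^{-n/c}$ if the following conditions are satisfied: (small noise) $$v_\varepsilon^2\le\frac{\|\bar\theta_{0:k}\|_{\Sigma_{0:k}^{-1}}^2}{c}\min\left(\frac{\left(\sum_{i>k}\lambda_i\right)^2}{nk},\ \frac{\left(\sum_{i>k}\lambda_i\right)^4}{n^3\sum_{i>k}\lambda_i^2}\right);$$ (jump in effective rank) $$\rho_k(0)>c;$$ (small signal in the tail) $$\|\bar\theta_{k:\infty}\|_{\Sigma_{k:\infty}}^2\le\frac1c\|\bar\theta_{0:k}\|_{\Sigma_{0:k}^{-1}}^2\left(\frac{\sum_{i>k}\lambda_i}{n}\right)^2.$$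
   Context: Setting. $n<p$ are positive integers. $x$ is a random vector in $\mathbb R^p$ with mean zero and covariance $\Sigma=\mathbb E[xx^\top]=\mathrm{diag}(\lambda_1,\dots,\lambda_p)$, $\lambda_1\ge\dots\ge\lambda_p>0$. $X\in\mathbb R^{n\times p}$ is a random matrix with i.i.d. rows distributed as $x^\top$, and $Z=X\Sigma^{-1/2}$. The rows of $Z$ are sub-Gaussian with sub-Gaussian norm at most $\sigma_x$, where for a random variable $\|z\|_{\psi_2}=\inf\{t>0:\mathbb E\exp(z^2/t^2)\le2\}$ and for a random vector $\|z\|_{\psi_2}=\sup_{s\ne0}\|\langle s,z\rangle/\|s\|\|_{\psi_2}$. Notation. $\sum_{i>k}$ means $\sum_{i=k+1}^p$. $\mu_n(XX^\top)$ is the smallest eigenvalue of $XX^\top$. $\|v\|_M=\sqrt{v^\top Mv}$ for $M$ positive semidefinite. For $0\le k\le p$, $\theta_{0:k}$ and $\theta_{k:\infty}$ are the vectors of the first $k$ and of the last $p-k$ coordinates of $\theta$; $\Sigma_{0:k}=\mathrm{diag}(\lambda_1,\dots,\lambda_k)$, $\Sigma_{k:\infty}=\mathrm{diag}(\lambda_{k+1},\dots,\lambda_p)$; when $k=0$ all terms involving the index $0:k$ are zero. For $0\le k\le p-1$, $\rho_k(0)=\frac{1}{n\lambda_{k+1}}\sum_{i>k}\lambda_i$. For a ridge parameter $\lambda>-\mu_n(XX^\top)$ (the range on which the ridge solution is defined, and over which the minimization is taken) let $A=\lambda I_n+XX^\top$ (positive definite), and define the bias and variance of ridge regression $B(\lambda)=\|(I_p-X^\top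 A^{-1}X)\theta^*\|_\Sigma^2$, $V(\lambda)=\mathrm{tr}(A^{-1}X\Sigma X^\top A^{-1})$. The response is $y=X\theta^*+\varepsilon$, where the components of $\varepsilon$ are i.i.d., centered, with variance $v_\varepsilon^2$ ($v_\varepsilon\ge0$), so $B+v_\varepsilon^2V$ is the excess risk averaged over the noise. $\mathbb E_{\theta^*}$ is expectation over the draw of $\theta^*$ only. *)

(* Defs.v *)
From HB Require Import structures.
From mathcomp Require Import all_boot all_order all_algebra.
From mathcomp Require Import all_classical all_reals all_analysis.

Set Implicit Arguments.
Unset Strict Implicit.
Unset Printing Implicit Defensive.

Import Order.TTheory GRing.Theory Num.Theory.
Import numFieldNormedType.Exports.

Local Open Scope classical_set_scope.
Local Open Scope ring_scope.

(* Coordinates are numbered from 0, so [lam 0 i] is the eigenvalue usually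
   written lambda_(i+1), and "i > k" in the usual 1-based numbering becomes
   [k <= i]. *)

Section Independence.
Context d (T : measurableType d) (R : realType) (P : probability T R).

(* The product rule over the whole (finite) family covers every subfamily:
   take [B i] to be the full set for the other indices. *)
Definition mutually_independent d' (S : measurableType d') (I : finType)
    (Y : I -> T -> S) : Prop :=
  forall B : I -> set S, (forall i, measurable (B i)) ->
    P (\bigcap_(i in [set: I]) (Y i @^-1` B i)) =
    (\prod_(i : I) P (Y i @^-1` B i))%E.

Definition independent2 d1 (S1 : measurableType d1) d2 (S2 : measurableType d2)
    (Y1 : T -> S1) (Y2 : T -> S2) : Prop :=
  forall B1 B2, measurable B1 -> measurable B2 ->
    P (Y1 @^-1` B1 `&` Y2 @^-1` B2) = (P (Y1 @^-1` B1) * P (Y2 @^-1` B2))%E.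

End Independence.

Definition same_law (R : realType) d (T : measurableType d)
    (P : probability T R) d0 (T0 : measurableType d0) (P0 : probability T0 R)
    d' (S : measurableType d') (Y : T -> S) (Y0 : T0 -> S) : Prop :=
  forall B, measurable B -> P (Y @^-1` B) = P0 (Y0 @^-1` B).

Section SubGaussian.
Context d (T : measurableType d) (R : realType) (P : probability T R).

Definition psi2_norm (z : T -> R) : \bar R :=
  ereal_inf [set t%:E | t in
    [set t : R | 0 < t /\ ('E_P[fun w => expR (z w ^+ 2 / t ^+ 2)] <= 2%:E)%E]].

Definition l2norm p (s : 'cV[R]_p) : R := Num.sqrt (\sum_(j < p) s j 0 ^+ 2).

Definition psi2_norm_vec p (z : T -> 'rV[R]_p) : \bar R :=
  ereal_sup [set psi2_norm (fun w => (z w *m s) 0 0 / l2norm s)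
            | s in [set s : 'cV[R]_p | s != 0]].

End SubGaussian.

Section Ridge.
Context (R : realType).

Definition col_of_tuple p (t : p.-tuple R) : 'cV[R]_p := \col_j tnth t j.

Definition mx_of_rows n p (t : n.-tuple (p.-tuple R)) : 'M[R]_(n, p) :=
  \matrix_(i, j) tnth (tnth t i) j.

Definition Sigma p (lam : 'rV[R]_p) : 'M[R]_p := diag_mx lam.

Definition Sigma_inv_sqrt p (lam : 'rV[R]_p) : 'M[R]_p :=
  diag_mx (\row_j (Num.sqrt (lam 0 j))^-1).

Definition wnorm p (M : 'M[R]_p) (v : 'cV[R]_p) : R :=
  Num.sqrt ((v^T *m M *m v) 0 0).

(* The set of real eigenvalues of a symmetric matrix of positive size is
   finite and nonempty, so this infimum is a minimum. *)
Definition smallest_eigenvalue n (M : 'M[R]_n) : R :=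
  inf [set a : R | eigenvalue M a].

Definition ridge_range n p (X : 'M[R]_(n, p)) : set R :=
  [set l | - smallest_eigenvalue (X *m X^T) < l].

Definition ridge_mx n p (X : 'M[R]_(n, p)) (l : R) : 'M[R]_n :=
  l%:M + X *m X^T.

Definition bias n p (lam : 'rV[R]_p) (X : 'M[R]_(n, p)) (theta : 'cV[R]_p)
    (l : R) : R :=
  wnorm (Sigma lam)
    ((1%:M - X^T *m invmx (ridge_mx X l) *m X) *m theta) ^+ 2.

Definition var n p (lam : 'rV[R]_p) (X : 'M[R]_(n, p)) (l : R) : R :=
  let Ainv := invmx (ridge_mx X l) in
  \tr (Ainv *m X *m Sigma lam *m X^T *m Ainv).

(* Positions, in 'I_p, of the first k and of the last p - k coordinates. *)
Definition head_ord p (k : 'I_p) (i : 'I_k) : 'I_p :=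
  cast_ord (subnKC (ltnW (ltn_ord k))) (lshift (p - k) i).

Definition tail_ord p (k : 'I_p) (i : 'I_(p - k)) : 'I_p :=
  cast_ord (subnKC (ltnW (ltn_ord k))) (rshift k i).

Definition head_vec p (k : 'I_p) (v : 'cV[R]_p) : 'cV[R]_k :=
  rowsub (@head_ord p k) v.

Definition tail_vec p (k : 'I_p) (v : 'cV[R]_p) : 'cV[R]_(p - k) :=
  rowsub (@tail_ord p k) v.

Definition head_mx p (k : 'I_p) (M : 'M[R]_p) : 'M[R]_k :=
  mxsub (@head_ord p k) (@head_ord p k) M.

Definition tail_mx p (k : 'I_p) (M : 'M[R]_p) : 'M[R]_(p - k) :=
  mxsub (@tail_ord p k) (@tail_ord p k) M.

Definition tail_sum p (lam : 'rV[R]_p) (k : 'I_p) : R :=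
  \sum_(i < p | (k <= i)%N) lam 0 i.

Definition tail_sum_sq p (lam : 'rV[R]_p) (k : 'I_p) : R :=
  \sum_(i < p | (k <= i)%N) lam 0 i ^+ 2.

Definition rho (n p : nat) (lam : 'rV[R]_p) (k : 'I_p) : R :=
  tail_sum lam k / (n%:R * lam 0 k).

(* Minimizers over a range D that need not be closed: l is a limit of points
   of D along which F tends to its infimum over D.  When l belongs to D and F
   is continuous on D, this says exactly that F l <= F m for all m in D.  A
   boundary point can occur only if F does not tend to +oo there.  The left
   end - mu_n of the ridge range can therefore occur only when the infimum is
   not attained on a discrete exceptional event: the noise variance is 0 and
   every column of X carrying signal is orthogonal to the bottom eigenspace of
   X X^T (or mu_n = 0, in which case this end is not negative anyway). *)
Definition minimizer (D : set R) (F : R -> R) (l : R) : Prop :=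
  forall (m e : R), D m -> 0 < e ->
    closure [set l' : R | D l' /\ F l' < F m + e] l.

End Ridge.

Section Setting.
Context d (T : measurableType d) (R : realType) (P : probability T R).
Context n p (X : {RV P >-> n.-tuple (p.-tuple R)}).

Definition row_rv (i : 'I_n) : T -> p.-tuple R := fun w => tnth (X w) i.

Definition iid_rows d0 (T0 : measurableType d0) (P0 : probability T0 R)
    (x : {RV P0 >-> p.-tuple R}) : Prop :=
  mutually_independent P row_rv /\ forall i, same_law P P0 (row_rv i) x.

Definition independent_entries : Prop :=
  mutually_independent P
    (fun (ij : 'I_n * 'I_p) (w : T) => tnth (tnth (X w) ij.1) ij.2).

Definition whitened (lam : 'rV[R]_p) (w : T) : 'M[R]_(n, p) :=
  mx_of_rows (X w) *m Sigma_inv_sqrt lam.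

(* The expectation is over the draw [w'] of theta only, X being frozen. *)
Definition mean_risk (lam : 'rV[R]_p) (veps : R)
    (theta : {RV P >-> p.-tuple R}) (w : T) (l : R) : R :=
  fine 'E_P[fun w' => bias lam (mx_of_rows (X w)) (col_of_tuple (theta w')) l]
  + veps ^+ 2 * var lam (mx_of_rows (X w)) l.

(* When thetabar = 0, the noise condition also forces veps = 0 and the
   objective vanishes identically, so that every admissible l is a minimizer;
   in all other cases no minimizer may be nonnegative. *)
Definition negative_optimum (lam : 'rV[R]_p) (veps : R) (thetabar : 'cV[R]_p)
    (theta : {RV P >-> p.-tuple R}) (w : T) : Prop :=
  let is_min :=
    minimizer (ridge_range (mx_of_rows (X w))) (mean_risk lam veps theta w) in
  (exists2 l, is_min l & l < 0) /\
  (thetabar != 0 -> forall l, is_min l -> l < 0).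

End Setting.

Section RandomVectors.
Context d (T : measurableType d) (R : realType) (P : probability T R).
Context p (x : {RV P >-> p.-tuple R}).

Definition mean_zero : Prop :=
  forall j : 'I_p, ('E_P[fun w => tnth (x w) j] = 0)%E.

Definition has_covariance (C : 'M[R]_p) : Prop :=
  forall i j : 'I_p,
    ('E_P[fun w => (tnth (x w) i * tnth (x w) j)%R] = (C i j)%:E)%E.

Definition random_sign_flip (thetabar : 'cV[R]_p) : Prop :=
  exists flip : {RV P >-> p.-tuple bool},
    [/\ mutually_independent P (fun (j : 'I_p) w => tnth (flip w) j),
        forall j : 'I_p, P [set w | tnth (flip w) j] = (2^-1)%:E
      & forall w (j : 'I_p),
          tnth (x w) j = (-1) ^+ tnth (flip w) j * thetabar j 0].

End RandomVectors.

(* Main.v *)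
Require Import Defs.
From HB Require Import structures.
From mathcomp Require Import all_boot all_order all_algebra.
From mathcomp Require Import all_classical all_reals all_analysis.
From mathcomp Require Import measurable_realfun ring lra.

Set Implicit Arguments.
Unset Strict Implicit.
Unset Printing Implicit Defensive.

Import Order.TTheory GRing.Theory Num.Theory.
Import numFieldNormedType.Exports.

Local Open Scope classical_set_scope.
Local Open Scope ring_scope.

(** Let S be the sum of the tail eigenvalues lam_i, k <= i, let the head be the
    indices below k, and let H be the sum of the thetabar_i^2 / lam_i over the
    head.  Since the effective rank S / lam_k is much larger than n, the tail
    part of X X^T is close to S times the identity: it acts as a ridge of size S
    that is already present in the problem.  The explicit ridge l only changes
    the effective ridge into S + l.  As long as l >= - S / 2 the effective ridge
    is of order S and biases the head, whose eigenvalues are at least S / n, by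
    an amount of order G = H (S / n)^2.  For l0 = - (1 - eps) S the effective
    ridge is eps S and the head bias drops to eps^2 G, while the tail bias and
    the variance are bounded by G / c, up to constants depending on eps, under
    the conditions on the signal and on the noise.  Hence for eps small, then c
    large, the risk at l0 is at most half of its infimum over l >= - S / 2, and,
    if thetabar is not 0, all minimizers are at most - S / 2
    ([all_minimizers_negative]).

    The random signs of theta make the expected bias a sum over the coordinates
    of thetabar_j^2 times the bias of the j-th basis vector
    ([mean_risk_formula]).  The latter is expressed by the residual
    e_j - X^T A^-1 x_j, where x_j is the j-th column of X.  The residual is
    bounded from above and below by testing the equation A y = x_j against
    suitable vectors ([head_solution], [tail_solution],
    [residual_lower_bound]).

    It remains to show that the tail of X X^T is close to S, that the head of X
    is well conditioned, and that column norms have the expected size, with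
    probability exponentially close to 1.  The first two are instances of one
    statement, [uniform_deviation]: for independent standardized sub-Gaussian
    entries, the quadratic form of a weighted sum of g_i g_i^T over independent
    vectors g_i is uniformly close to its mean, as soon as the ratio of the sum
    of the weights to the largest weight exceeds a multiple of the dimension.
    It is applied to the columns of the tail in dimension n and to the rows of
    the head in dimension k < n / c.  Its proof is a Chernoff bound for each
    vector ([group_deviation_tail]) and a union bound over a net of integer
    vectors ([card_net], [net_to_space]). *)

(** * Independence of blocks of random variables *)

Section IndependenceTheory.
Context d (T : measurableType d) (R : realType) (P : probability T R).

Lemma bigcap_finD1 (I : finType) (A : I -> set T) (i0 : I) :
  \bigcap_(i in [set: I]) A i =
  A i0 `&` \bigcap_(i in [set i | i != i0]) A i.
Proof.
apply/seteqP; split => [w Aw|w [Aw0 Aw] i _].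
  by split; [exact: Aw|move=> i _; exact: Aw].
by have [->//|ii0] := eqVneq i i0; exact: Aw.
Qed.

(** Dynkin's argument, one index at a time: with the sets at the other indices
    fixed, both sides are finite measures of the remaining set, and they agree
    on a pi-system that contains the full set. *)
Lemma generated_independent (I : finType) (G : I -> set (set T)) :
  (forall i, G i `<=` measurable) -> (forall i, setI_closed (G i)) ->
  (forall i, G i setT) ->
  (forall A : I -> set T, (forall i, G i (A i)) ->
     P (\bigcap_(i in [set: I]) A i) = (\prod_(i : I) P (A i))%E) ->
  forall A : I -> set T, (forall i, <<s G i >> (A i)) ->
     P (\bigcap_(i in [set: I]) A i) = (\prod_(i : I) P (A i))%E.
Proof.
move=> Gm GI GT GP.
have sGm i : <<s G i >> `<=` measurable by apply: smallest_sub => //; exact: sigma_algebra_measurable.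
suff H (s : seq I) (A : I -> set T) : (forall i, i \in s -> <<s G i >> (A i)) ->
    (forall i, i \notin s -> G i (A i)) ->
    P (\bigcap_(i in [set: I]) A i) = (\prod_(i : I) P (A i))%E.
  move=> A sA; apply: (H (enum I)) => i; first by move=> _; exact: sA.
  by rewrite mem_enum.
elim: s A => [|i0 s IH] A As Ans; first by apply: GP => i; exact: Ans.
have mA i : measurable (A i).
  have [/As/sGm//|/Ans/Gm//] := boolP (i \in i0 :: s).
pose C := \bigcap_(i in [set i | i != i0]) A i.
have mC : measurable C by apply: fin_bigcap_measurable => //; exact: finite_finset.
pose p := (\prod_(i | i != i0) P (A i))%E.
have p0 : (0 <= p)%E by apply: prode_ge0 => i _; exact: measure_ge0.
have pfin : p \is a fin_num.
  by apply: prode_fin_num => i _; exact: fin_num_measure.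
pose r := NngNum (fine_ge0 p0).
have H B : <<s G i0 >> B -> P (B `&` C) = (P B * p)%E.
  move=> sB.
  pose m1 : {measure set T -> \bar R} := mrestr P mC.
  pose m2 : {measure set T -> \bar R} := mscale r P.
  have -> : P (B `&` C) = m1 B by [].
  have -> : (P B * p)%E = m2 B by rewrite /m2/= /mscale/= fineK// muleC.
  apply: (g_sigma_algebra_measure_unique (G i0) (Gm i0) (fun=> setT)) => //.
  - by rewrite bigcup_const.
  - move=> D GD; rewrite /m1 /m2/= /mrestr /mscale/= fineK// muleC.
    pose A' i := if i == i0 then D else A i.
    have A'i0 : A' i0 = D by rewrite /A' eqxx.
    have A'E i : i != i0 -> A' i = A i by rewrite /A' => /negbTE ->.
    have := IH A'; rewrite (bigcap_finD1 A' i0) (bigD1 i0)//= A'i0.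
    have -> : \bigcap_(i in [set i | i != i0]) A' i = C.
      by apply: eq_bigcapr => i /= /A'E.
    have -> : (\prod_(i | i != i0) P (A' i) = p)%E.
      by apply: eq_bigr => i /A'E ->.
    apply => i.
      have [->|ii0] := eqVneq i i0; first by rewrite A'i0 => _; exact: sub_sigma_algebra.
      by rewrite A'E// => si; apply: As; rewrite in_cons si orbT.
    have [->|ii0] := eqVneq i i0; first by rewrite A'i0.
    by move=> si; rewrite A'E//; apply: Ans; rewrite in_cons negb_or ii0.
  - move=> _; rewrite /m1/= /mrestr setTI; rewrite (le_lt_trans (probability_le1 _ _))// ltry //.
rewrite (bigcap_finD1 A i0) (bigD1 i0)//= H//.
by apply: As; rewrite mem_head.
Qed.

Section Blocks.
Context d' (S : measurableType d') (I G : finType) (W : I -> T -> S).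
Hypothesis mW : forall i, measurable_fun setT (W i).
Hypothesis indW : mutually_independent P W.

(** The pi-system of cylinders over the variables of group [g]; it generates
    the sigma-algebra of that group of variables. *)
Definition block (pi : I -> G) (g : G) : set (set T) :=
  [set A | exists2 B : I -> set S, (forall i, measurable (B i)) &
           A = \bigcap_(i in [set i | pi i = g]) W i @^-1` B i].

(** The subfamily [D] is obtained by letting the other sets be full. *)
Lemma mutually_independent_part (D : pred I) (B : I -> set S) :
  (forall i, measurable (B i)) ->
  P (\bigcap_(i in [set i | D i]) W i @^-1` B i) =
  (\prod_(i | D i) P (W i @^-1` B i))%E.
Proof.
move=> mB; pose B' i := if D i then B i else setT.
have := indW (B := B'); rewrite (bigID D)/=.
have -> : (\prod_(i | ~~ D i) P (W i @^-1` B' i) = 1)%E.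
  apply: big1 => i /negbTE Di.
  by rewrite /B' Di preimage_setT probability_setT.
rewrite mule1.
have -> : (\prod_(i | D i) P (W i @^-1` B' i) =
           \prod_(i | D i) P (W i @^-1` B i))%E.
  by apply: eq_bigr => i Di; rewrite /B' Di.
have -> : \bigcap_(i in [set: I]) W i @^-1` B' i =
          \bigcap_(i in [set i | D i]) W i @^-1` B i.
  apply/seteqP; split => w Hw i /=.
    by move=> Di; have := Hw i Logic.I; rewrite /= /B' Di.
  by move=> _; rewrite /B'; case: ifPn => // Di; exact: Hw.
by apply; rewrite /B' => i; case: ifPn.
Qed.

(** Functions of disjoint groups of independent variables are independent:
    cylinders over the groups multiply, and [generated_independent] passes to
    the sigma-algebras that they generate. *)
Lemma blocks_independent (pi : I -> G) d'' (S' : measurableType d'') (V : G -> T -> S') :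
  (forall g, measurable_fun setT (V g : g_sigma_algebraType (block pi g) -> S')) ->
  mutually_independent P V.
Proof.
move=> mV B mB; apply: (@generated_independent _ (block pi)).
- move=> g _ [B' mB' ->]; apply: fin_bigcap_measurable; first exact: finite_finset.
  by move=> i _; rewrite -[X in measurable X]setTI; exact: mW.
- move=> g _ _ [B1 mB1 ->] [B2 mB2 ->].
  exists (fun i => B1 i `&` B2 i); first by move=> i; exact: measurableI.
  by apply/seteqP; split => [w [H1 H2] i ig|w H]; [split; [exact: H1|exact: H2]|
    split=> i ig; have [] := H i ig].
- by move=> g; exists (fun=> setT) => //; apply/seteqP; split.
- move=> A GA; have {GA} := fun g => cid2 (GA g).
  move=> /all_sig2[B' mB' AE].
  have -> : \bigcap_(i in [set: G]) A i =
      \bigcap_(i in [set i | xpredT i]) W i @^-1` B' (pi i) i.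
    apply/seteqP; split => w Hw i /= _.
      by have := Hw (pi i) Logic.I; rewrite AE; apply.
    by rewrite AE => j /= ji; have := Hw j; rewrite ji; apply.
  rewrite (mutually_independent_part xpredT (B := fun i => B' (pi i) i))//.
  rewrite (partition_big pi xpredT)//=; apply: eq_bigr => g _.
  rewrite AE.
  have -> : [set i | pi i = g] = [set i | pi i == g].
    by apply/seteqP; split => i /= /eqP.
  rewrite (mutually_independent_part (fun i => pi i == g) (B := B' g))//.
  by apply: eq_bigr => i /eqP ->.
- by move=> g; have := mV g measurableT _ (mB g); rewrite setTI.
Qed.

Lemma block_measurable (pi : I -> G) (g : G) (i : I) :
  pi i = g -> measurable_fun setT (W i : g_sigma_algebraType (block pi g) -> S).
Proof.
move=> ig _ B mB; rewrite setTI; apply: sub_sigma_algebra.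
exists (fun j => if j == i then B else setT); first by move=> j; case: ifP.
apply/seteqP; split => [w Bw j _ /=|w Hw]; last by have := Hw i ig; rewrite /= eqxx.
by case: eqP => // ->.
Qed.

End Blocks.

End IndependenceTheory.

(** * Expectations of products of independent variables *)

Section ExpectationOfProducts.
Context d (T : measurableType d) (R : realType) (P : probability T R).

Lemma mutually_independent_inj d' (S : measurableType d') (I J : finType)
    (W : I -> T -> S) (f : J -> I) :
  mutually_independent P W -> injective f ->
  mutually_independent P (fun j => W (f j)).
Proof.
move=> indW finj B mB.
pose B' i := if [pick j | f j == i] is Some j then B j else setT.
have B'f j : B' (f j) = B j.
  rewrite /B'; case: pickP => [j' /eqP/finj ->//|/(_ j)]; by rewrite eqxx.
have B'n i : i \notin codom f -> B' i = setT.
  rewrite /B'; case: pickP => // j /eqP <-; by rewrite codom_f.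
have -> : \bigcap_(j in [set: J]) W (f j) @^-1` B j =
          \bigcap_(i in [set: I]) W i @^-1` B' i.
  apply/seteqP; split => w Hw i _ /=.
    have [/codomP[j ->]|/B'n ->//] := boolP (i \in codom f).
    by rewrite B'f; exact: Hw.
  by have := Hw (f i) Logic.I; rewrite /= B'f.
rewrite indW; last by move=> i; rewrite /B'; case: pickP.
rewrite (bigID (mem (codom f)))/= [X in (_ * X)%E]big1 ?mule1; last first.
  by move=> i /B'n ->; rewrite preimage_setT probability_setT.
transitivity (\prod_(j : J) (fun i => P (W i @^-1` B' i)) (f j))%E; last first.
  by apply: eq_bigr => j _; rewrite B'f.
rewrite -big_filter -[RHS](big_map f xpredT (fun i => P (W i @^-1` B' i))).
apply: perm_big; apply: uniq_perm.
- by rewrite filter_uniq// index_enum_uniq.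
- by rewrite map_inj_uniq ?index_enum_uniq.
- move=> i; rewrite mem_filter mem_index_enum andbT; apply/codomP/mapP.
    by move=> [j ->]; exists j => //; rewrite mem_index_enum.
  by move=> [j _ ->]; exists j.
Qed.

(** The joint law of independent variables is the product of their laws, so
    Tonelli applies. *)
Lemma ge0_expectation_indep2 (U V : T -> R) :
  measurable_fun setT U -> measurable_fun setT V ->
  (forall w, 0 <= U w) -> (forall w, 0 <= V w) ->
  (forall A B, measurable A -> measurable B ->
     P (U @^-1` A `&` V @^-1` B) = (P (U @^-1` A) * P (V @^-1` B))%E) ->
  (\int[P]_w (U w * V w)%:E = (\int[P]_w (U w)%:E) * \int[P]_w (V w)%:E)%E.
Proof.
move=> mU mV U0 V0 UV.
pose U' : {RV P >-> R} := HB.pack U (isMeasurableFun.Build _ _ _ _ _ mU).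
pose V' : {RV P >-> R} := HB.pack V (isMeasurableFun.Build _ _ _ _ _ mV).
have mW : measurable_fun setT (fun w => (U w, V w)) by exact: measurable_fun_pair.
pose W : {RV P >-> (R * R)%type} :=
  HB.pack (fun w => (U w, V w)) (isMeasurableFun.Build _ _ _ _ _ mW).
pose f (x : R * R) : \bar R := `|(x.1 * x.2)%:E|%E.
have mf : measurable_fun [set: R * R] f.
  apply: measurableT_comp => //; apply/measurable_EFinP.
  by apply: measurable_funM; [exact: measurable_fst|exact: measurable_snd].
have f0 x : (0 <= f x)%E by exact: abse_ge0.
have -> : (\int[P]_w (U w * V w)%:E = \int[P]_w (f \o W) w)%E.
  by apply: eq_integral => w _; rewrite /f/= ger0_norm// mulr_ge0.
rewrite -ge0_integral_distribution//.
transitivity (\int[distribution P U' \x distribution P V']_z f z)%E.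
  apply: eq_measure_integral => A mA _; apply/esym.
  by apply: product_measure_unique.
rewrite fubini_tonelli1//= /fubini_F/=.
have H (Y : {RV P >-> R}) : (forall w, 0 <= Y w) ->
    (\int[distribution P Y]_y `|y%:E| = \int[P]_w (Y w)%:E)%E.
  move=> Y0; rewrite ge0_integral_distribution//=.
    by apply: eq_integral => w _ /=; rewrite ger0_norm.
  by apply: measurableT_comp => //; exact/measurable_EFinP.
transitivity (\int[distribution P U']_x (`|x%:E| * \int[P]_w (V w)%:E))%E.
  apply: eq_integral => x _.
  rewrite -(H V')// -ge0_integralZl//.
    by apply: eq_integral => y _; rewrite /f/= normrM EFinM.
  by apply: measurableT_comp => //; exact/measurable_EFinP.
rewrite ge0_integralZr//.
- by rewrite (H U').
- by apply: measurableT_comp => //; exact/measurable_EFinP.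
- by apply: integral_ge0 => w _; rewrite lee_fin.
Qed.

(** The first factor is independent of the product of the others, because these
    are functions of two disjoint blocks. *)
Lemma ge0_expectation_prod (I : finType) (W : I -> T -> R) (s : seq I) :
  (forall i, measurable_fun setT (W i)) -> (forall i w, 0 <= W i w) ->
  mutually_independent P W -> uniq s ->
  (\int[P]_w (\prod_(i <- s) W i w)%:E = \prod_(i <- s) \int[P]_w (W i w)%:E)%E.
Proof.
move=> mW W0 indW; elim: s => [_|i0 s IH /= /andP[i0s us]].
  rewrite big_nil; under eq_integral do rewrite big_nil.
  by rewrite integral_cst//= probability_setT mule1.
rewrite big_cons -IH//.
rewrite -ge0_expectation_indep2//.
- by apply: eq_integral => w _; rewrite big_cons.
- exact: measurable_prod.
- by move=> w; apply: prodr_ge0.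
- move=> A B mA mB.
  pose V (b : bool) w : R := if b then \prod_(i <- s) W i w else W i0 w.
  have indV : mutually_independent P V.
    apply: (blocks_independent mW indW (pi := fun i => i \in s)) => -[].
      rewrite /V; apply: measurable_prod => i is_; exact: block_measurable.
    by rewrite /V; apply: block_measurable; exact/negbTE.
  rewrite muleC setIC.
  have := indV (fun b => if b then B else A); rewrite big_bool/= => H.
  rewrite -[RHS]H; last by case.
  congr (P _); apply/seteqP; split => [w [HB HA] []//|w Hw].
  by split; [exact: (Hw true)|exact: (Hw false)].
Qed.

Lemma ge0_expectation_prod_comp (I : finType) d' (S : measurableType d')
    (W : I -> T -> S) (h : I -> S -> R) :
  (forall i, measurable_fun setT (W i)) ->
  (forall i, measurable_fun setT (h i)) -> (forall i x, 0 <= h i x) ->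
  mutually_independent P W ->
  (\int[P]_w (\prod_(i : I) h i (W i w))%:E =
   \prod_(i : I) \int[P]_w (h i (W i w))%:E)%E.
Proof.
move=> mW mh h0 indW.
apply: (ge0_expectation_prod (W := fun i w => h i (W i w))) => //.
- by move=> i; exact: measurableT_comp.
- move=> B mB; have := indW (fun i => h i @^-1` B i); apply => i.
  by rewrite -[X in measurable X]setTI; exact: mh.
- exact: index_enum_uniq.
Qed.

End ExpectationOfProducts.

(** * Elementary inequalities for the exponential *)

(* The view [measurable_EFinP] is guarded by a match on the goal: unguarded, it
   would apply in both directions for ever. *)
Ltac measurability :=
  repeat first
    [ assumption
    | exact: measurable_cst
    | exact: measurable_id
    | match goal with |- measurable_fun _ (fun _ => EFin _) => apply/measurable_EFinP end
    | match goal with |- measurable_fun _ (EFin \o _) => apply/measurable_EFinP end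
    | apply: (measurableT_comp (@measurable_expR _))
    | apply: (measurableT_comp (@oppr_measurable _ setT))
    | apply: (measurableT_comp (@normr_measurable _ setT))
    | apply: measurable_sum => ?
    | apply: measurable_funX
    | apply: measurable_funM
    | apply: measurable_funB
    | apply: measurable_funD
    | match goal with H : forall _, measurable_fun _ _ |- _ => exact: H end ].

Section RealInequalities.
Context (R : realType).
Implicit Types x y : R.

(** The constant and linear terms are exact; after integration a centered
    variable therefore contributes to second order only. *)
Lemma expR_le_taylor2 x : expR x <= 1 + x + x ^+ 2 * expR `|x|.
Proof.
have [x0|x0] := leP 0 x.
  rewrite ger0_norm//.
  have h : expR x <= 1 + x * expR x.
    have := expR_ge1Dx (- x); rewrite expRN => h1.
    have e0 := expR_gt0 x.
    have : (1 - x) * expR x <= (expR x)^-1 * expR x by rewrite ler_pM2r.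
    rewrite mulVf ?gt_eqF//; lra.
  have : x * expR x <= x * (1 + x * expR x) by rewrite ler_wpM2l.
  nra.
have [y xy] : exists y, x = - y by exists (- x); rewrite opprK.
have y0 : 0 < y by rewrite -oppr_lt0 -xy.
rewrite ltr0_norm// xy opprK sqrrN.
have h1 := expR_ge1Dx y.
have h2 : expR (- y) <= (1 + y)^-1.
  by rewrite expRN lef_pV2// ?posrE ?expR_gt0 ?addr_gt0.
have h3 : (1 + y)^-1 <= 1 - y + y ^+ 2.
  rewrite -[leLHS]mul1r ler_pdivrMr ?addr_gt0//.
  have -> : (1 - y + y ^+ 2) * (1 + y) = 1 + y ^+ 3 by ring.
  by rewrite lerDl exprn_ge0 ?ltW.
have : y ^+ 2 <= y ^+ 2 * expR y.
  by apply: ler_peMr; [exact: sqr_ge0|apply: le_trans h1; rewrite lerDl ltW].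
lra.
Qed.

Lemma ler_expR_id x : x <= expR x.
Proof. by have := expR_ge1Dx x; lra. Qed.

Lemma sqr_le_expR x : 0 <= x -> x ^+ 2 <= 4 * expR x.
Proof.
move=> x0; have h := expR_ge1Dx (x / 2).
have -> : expR x = expR (x / 2) ^+ 2.
  by rewrite -expRM_natl; congr expR; field.
have : (1 + x / 2) ^+ 2 <= expR (x / 2) ^+ 2 by rewrite ler_pXn2r// nnegrE; lra.
nra.
Qed.

Lemma expR_half_le2 : expR (2^-1) <= 2 :> R.
Proof.
have := expR_ge1Dx (- 2^-1 : R); rewrite expRN => h.
have e0 := expR_gt0 (2^-1 : R).
rewrite -[leLHS]invrK -[leRHS]invrK lef_pV2 ?posrE ?invr_gt0//; lra.
Qed.

Lemma expR_ge2 x : 1 <= x -> 2 <= expR x.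
Proof. by have := expR_ge1Dx x; lra. Qed.

Lemma expRN_le_half_pow (n : nat) : expR (- n%:R) <= (2 ^ n)%:R^-1 :> R.
Proof.
rewrite expRN lef_pV2 ?posrE ?expR_gt0 ?ltr0n ?expn_gt0//.
have -> : expR n%:R = expR 1 ^+ n :> R by rewrite -expRM_natl mulr1.
by rewrite natrX; apply: lerXn2r; rewrite ?nnegrE ?expR_ge0//; exact: expR_ge2.
Qed.

Lemma lee_prod (I : Type) (s : seq I) (f g : I -> \bar R) :
  (forall i, (0 <= f i)%E) -> (forall i, (f i <= g i)%E) ->
  (\prod_(i <- s) f i <= \prod_(i <- s) g i)%E.
Proof.
move=> f0 fg; elim: s => [|i s IH]; first by rewrite !big_nil.
by rewrite !big_cons lee_pmul// prode_ge0.
Qed.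

Lemma EFin_prod (I : Type) (s : seq I) (f : I -> R) :
  (\prod_(i <- s) (f i)%:E)%E = (\prod_(i <- s) f i)%:E.
Proof. by elim: s => [|i s IH]; rewrite ?big_nil// !big_cons IH EFinM. Qed.

End RealInequalities.

(** * Sub-Gaussian variables *)

Section SubGaussianVariables.
Context d (T : measurableType d) (R : realType) (P : probability T R).
Implicit Types (W L : T -> R) (K : R).

Lemma ge0_integralZlr (c : R) (f : T -> R) :
  0 <= c -> (forall w, 0 <= f w) -> measurable_fun setT f ->
  (\int[P]_w (c * f w)%:E = c%:E * \int[P]_w (f w)%:E)%E.
Proof.
move=> c0 f0 mf; rewrite -ge0_integralZl_EFin//.
- by move=> w _; rewrite lee_fin.
- exact/measurable_EFinP.
Qed.

Lemma ge0_le_integralr (f g : T -> R) :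
  measurable_fun setT f -> measurable_fun setT g -> (forall w, 0 <= f w) ->
  (forall w, f w <= g w) -> (\int[P]_w (f w)%:E <= \int[P]_w (g w)%:E)%E.
Proof.
move=> mf mg f0 fg; apply: ge0_le_integral => //.
- by move=> w _; rewrite lee_fin.
- exact/measurable_EFinP.
- exact/measurable_EFinP.
- by move=> w _; rewrite lee_fin.
Qed.

(** Integrated form of [expR_le_taylor2]: [g] is the linear term and [h] the
    remainder. *)
Lemma le_integral_centered (f g h : T -> R) :
  measurable_fun setT f -> measurable_fun setT h ->
  P.-integrable setT (EFin \o g) -> (\int[P]_w (g w)%:E = 0)%E ->
  (forall w, 0 <= f w) -> (forall w, 0 <= h w) ->
  (forall w, f w <= 1 + g w + h w) ->
  (\int[P]_w (f w)%:E <= 1 + \int[P]_w (h w)%:E)%E.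
Proof.
move=> mf mh ig g0 f0 h0 fgh.
have mg : measurable_fun setT g by apply/measurable_EFinP; exact: (measurable_int P).
have h0' : (0 <= \int[P]_w (h w)%:E)%E by apply: integral_ge0 => w _; rewrite lee_fin.
have [hoo|hoo] := eqVneq (\int[P]_w (h w)%:E)%E +oo%E.
  by rewrite hoo addey// leey.
have ih : P.-integrable setT (EFin \o h).
  apply/integrableP; split; first exact/measurable_EFinP.
  under eq_integral do rewrite /= ger0_norm//.
  by rewrite ltey.
have i1 : P.-integrable setT (EFin \o cst (1 : R)).
  exact: finite_measure_integrable_cst.
apply: (@le_trans _ _ (\int[P]_w (1 + g w + h w)%:E)%E).
  apply: ge0_le_integralr => //; measurability.
under eq_integral do rewrite EFinD.
rewrite integralD//=.
- under eq_integral do rewrite EFinD.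
  rewrite integralD//= g0 adde0 leeD2r// integral_cst//= probability_setT mule1//.
- by under eq_fun do rewrite EFinD; exact: integrableD.
Qed.

Lemma integrable_le W (g : T -> R) :
  measurable_fun setT W -> measurable_fun setT g -> (forall w, `|W w| <= g w) ->
  (\int[P]_w (g w)%:E < +oo)%E -> P.-integrable setT (EFin \o W).
Proof.
move=> mW mg Wg goo; have g0 w : 0 <= g w by exact: le_trans (Wg w).
apply/integrableP; split; first exact/measurable_EFinP.
apply: le_lt_trans goo; apply: ge0_le_integralr => //; measurability.
Qed.

(** For [0 < K] the last field bounds the psi_2 norm by [K], without the
    infimum that defines this norm. *)
Record std_subgaussian K W : Prop := StdSubgaussian {
  sg_measurable : measurable_fun setT W;
  sg_mean : (\int[P]_w (W w)%:E = 0)%E;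
  sg_var : (\int[P]_w (W w ^+ 2)%:E = 1)%E;
  sg_psi2 : (\int[P]_w (expR (W w ^+ 2 / K ^+ 2))%:E <= 2%:E)%E }.

Lemma sqr_integrable1 W : measurable_fun setT W ->
  (\int[P]_w (W w ^+ 2)%:E < +oo)%E -> P.-integrable setT (EFin \o W).
Proof.
move=> mW Woo; apply: (@integrable_le W (fun w => 1 + W w ^+ 2)) => //.
- by measurability.
- move=> w; rewrite ler_norml; apply/andP; split; nra.
- under eq_integral do rewrite EFinD.
  rewrite ge0_integralD//=; last 2 first.
  + by move=> w _; rewrite lee_fin sqr_ge0.
  + by measurability.
  by rewrite integral_cst//= probability_setT mule1 lte_add_pinfty// ltry.
Qed.

(** For |tau| K <= 1 the variable is centered and [expR_le_taylor2] leaves a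
    multiple of tau^2; for |tau| K >= 1 the inequality
    tau W <= tau^2 K^2 / 2 + W^2 / (2 K^2) suffices. *)
Lemma std_subgaussian_mgf K W (tau : R) : 0 < K -> std_subgaussian K W ->
  (\int[P]_w (expR (tau * W w))%:E <= (expR (8 * K ^+ 2 * tau ^+ 2))%:E)%E.
Proof.
move=> K0 [mW EW VW psiW].
have iW : P.-integrable setT (EFin \o W) by apply: sqr_integrable1 => //; rewrite VW ltry.
have K20 : 0 < K ^+ 2 by rewrite exprn_gt0.
set k2 := K ^+ 2 in psiW K20 *.
have amgm w : `|tau * W w| <= (tau ^+ 2 * k2 + W w ^+ 2 / k2) / 2.
  have -> : W w ^+ 2 / k2 = (W w / K) ^+ 2 by rewrite expr_div_n.
  have -> : tau * W w = (tau * K) * (W w / K) by field; rewrite gt_eqF.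
  rewrite /k2 -exprMn; move: (tau * K) (W w / K) => a b.
  have h1 := sqr_ge0 (a + b); have h2 := sqr_ge0 (a - b).
  rewrite ler_norml; apply/andP; split; nra.
clearbody k2.
have c0 : 0 <= 4 * tau ^+ 2 * k2.
  by apply: mulr_ge0; [apply: mulr_ge0 => //; exact: sqr_ge0|exact: ltW].
have [small|big] := leP (tau ^+ 2 * k2) 1.
  pose h w := 4 * tau ^+ 2 * k2 * expR (W w ^+ 2 / k2).
  apply: (@le_trans _ _ (1 + \int[P]_w (h w)%:E)%E).
    apply: (@le_integral_centered _ (fun w => tau * W w)).
    - by measurability.
    - by rewrite /h; measurability.
    - exact: (integrableZl measurableT tau iW).
    - under eq_integral do rewrite EFinM.
      by rewrite (integralZl measurableT iW) EW mule0.
    - by move=> w; exact: expR_ge0.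
    - by move=> w; apply: mulr_ge0 => //; exact: expR_ge0.
    - move=> w; apply: le_trans (expR_le_taylor2 _) _.
      rewrite lerD2l /h; set u := W w ^+ 2 / k2.
      have u0 : 0 <= u by rewrite divr_ge0 ?sqr_ge0// ltW.
      have Wu : W w ^+ 2 = u * k2 by rewrite /u divfK// gt_eqF.
      have e1 : expR `|tau * W w| <= 2 * expR (u / 2).
        apply: (@le_trans _ _ (expR (2^-1 + u / 2))).
          rewrite ler_expR (le_trans (amgm w))// -/u; lra.
        by rewrite expRD ler_pM2r ?expR_gt0// expR_half_le2.
      have e2 : u <= 2 * expR (u / 2) by have := ler_expR_id (u / 2); lra.
      rewrite exprMn Wu.
      have -> : expR u = expR (u / 2) * expR (u / 2).
        by rewrite -expRD; congr expR; field.
      have -> : 4 * tau ^+ 2 * k2 * (expR (u / 2) * expR (u / 2)) =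
         (tau ^+ 2 * ((2 * expR (u / 2)) * k2)) * (2 * expR (u / 2)) by ring.
      rewrite ler_pM ?expR_ge0//.
        by apply: mulr_ge0; [exact: sqr_ge0|apply: mulr_ge0 => //; exact: ltW].
      by rewrite ler_wpM2l ?sqr_ge0// ler_pM2r.
  rewrite ge0_integralZlr//; last by measurability.
  apply: (@le_trans _ _ (1 + (4 * tau ^+ 2 * k2)%:E * 2%:E)%E).
    by rewrite leeD2l// lee_wpmul2l// lee_fin.
  rewrite -EFinM -EFinD lee_fin; apply: le_trans (expR_ge1Dx _).
  by rewrite lerD2l le_eqVlt; apply/orP; left; apply/eqP; ring.
apply: (@le_trans _ _ (\int[P]_w (expR (tau ^+ 2 * k2 / 2) * expR (W w ^+ 2 / k2))%:E)%E).
  apply: ge0_le_integralr => //; [by measurability|by measurability|] => w.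
  rewrite -expRD ler_expR (le_trans (ler_norm _))// (le_trans (amgm w))//.
  have : 0 <= W w ^+ 2 / k2 by rewrite divr_ge0 ?sqr_ge0// ltW.
  lra.
rewrite ge0_integralZlr//; last by measurability.
apply: (@le_trans _ _ ((expR (tau ^+ 2 * k2 / 2))%:E * 2%:E)%E).
  by rewrite lee_wpmul2l// lee_fin expR_ge0.
rewrite -EFinM lee_fin (@le_trans _ _ (expR (tau ^+ 2 * k2 / 2) * expR (tau ^+ 2 * k2)))//.
  by rewrite ler_wpM2l ?expR_ge0// expR_ge2// ltW.
by rewrite -expRD ler_expR; nra.
Qed.

(** A discrete form of the Gaussian linearization of a square: up to a factor
    exp D, exp (L^2 / 4 D) is dominated by the sum over the integers m of
    exp (m L - D m^2).  The expectation of each term is at most exp (- m^2),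
    since D exceeds the constant C of the moment generating function by 1. *)
Lemma sqr_exp_moment L (C D : R) : measurable_fun setT L -> 0 <= C -> D = C + 1 ->
  (forall tau, (\int[P]_w (expR (tau * L w))%:E <= (expR (C * tau ^+ 2))%:E)%E) ->
  (\int[P]_w (expR (L w ^+ 2 / (4 * D)))%:E <= (4 * expR D)%:E)%E.
Proof.
move=> mL C0 DC mgf; have D0 : 0 < D by lra.
pose t (m : nat) w := expR (- D * m%:R ^+ 2) *
   (expR (m%:R * L w) + expR (- m%:R * L w)).
have t0 m w : 0 <= t m w by rewrite mulr_ge0 ?addr_ge0 ?expR_ge0.
have mt m : measurable_fun setT (t m) by rewrite /t; measurability.
have key w : ((expR (L w ^+ 2 / (4 * D)))%:E <=
    (expR D)%:E * \sum_(0 <= m <oo) (t m w)%:E)%E.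
  (* The exponent m |L| - D m^2 is maximal at a = |L| / 2 D, where it equals
     L^2 / 4 D; rounding a down costs less than D. *)
  pose a := `|L w| / (2 * D).
  have a0 : 0 <= a by rewrite divr_ge0 ?normr_ge0//; lra.
  have /andP[ma aM] := truncn_itv a0; set m := Num.trunc a in ma aM.
  apply: (@le_trans _ _ ((expR D)%:E * (t m w)%:E)%E); last first.
    rewrite lee_wpmul2l ?lee_fin ?expR_ge0//.
    apply: le_trans (nneseries_lim_ge m.+1 _); last by move=> *; rewrite lee_fin.
    rewrite big_nat_recr//= leeDr// sume_ge0// => i _; by rewrite lee_fin.
  rewrite -EFinM lee_fin /t.
  apply: (@le_trans _ _ (expR D * (expR (- D * m%:R ^+ 2) * expR (m%:R * `|L w|)))).
    rewrite -!expRD ler_expR -(real_normK (num_real (L w))).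
    have -> : `|L w| = a * (2 * D) by rewrite /a divfK//; apply: lt0r_neq0; lra.
    have -> : (a * (2 * D)) ^+ 2 / (4 * D) = D * a ^+ 2 by field; lra.
    have : 0 <= D * (1 - (a - m%:R) ^+ 2).
      rewrite mulr_ge0 ?ltW//; rewrite -natr1 in aM; nra.
    nra.
  rewrite ler_wpM2l ?expR_ge0// ler_wpM2l ?expR_ge0//.
  have [L0|L0] := leP 0 (L w).
    by rewrite ger0_norm// lerDl expR_ge0.
  by rewrite ltr0_norm// mulrN mulNr lerDr expR_ge0.
apply: (@le_trans _ _ (\int[P]_w ((expR D)%:E * \sum_(0 <= m <oo) (t m w)%:E))%E).
  apply: ge0_le_integral => //.
  - by measurability.
  - apply: emeasurable_funM => //; apply: ge0_emeasurable_sum => //.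
    + by move=> m w _ _; rewrite lee_fin.
    + by move=> m _; apply/measurable_EFinP.
rewrite ge0_integralZl_EFin ?expR_ge0//; last 2 first.
- by move=> w _; apply: nneseries_ge0 => *; rewrite lee_fin.
- apply: ge0_emeasurable_sum => //.
  + by move=> m w _ _; rewrite lee_fin.
  + by move=> m _; apply/measurable_EFinP.
rewrite mulrC EFinM lee_wpmul2l ?lee_fin ?expR_ge0//.
rewrite integral_nneseries//; last 2 first.
- by move=> m; apply/measurable_EFinP.
- by move=> m w _; rewrite lee_fin.
(* The series of the 4 / 2^(m+1) sums to 4. *)
apply: le_trans (@epsilon_trick0 R 4 xpredT _) => //.
apply: lee_nneseries => [m _ _|m _]; first by apply: integral_ge0 => w _; rewrite lee_fin.
rewrite ge0_integralZlr ?expR_ge0//; last by measurability.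
under eq_integral do rewrite EFinD.
rewrite ge0_integralD//; try by measurability.
apply: (@le_trans _ _ ((expR (- D * m%:R ^+ 2))%:E *
    ((expR (C * m%:R ^+ 2))%:E + (expR (C * m%:R ^+ 2))%:E))%E).
  rewrite lee_wpmul2l ?lee_fin ?expR_ge0// leeD//.
  by have := mgf (- m%:R); rewrite sqrrN.
rewrite -EFinD -EFinM lee_fin.
have -> : 4 / (2 ^ m.+1)%:R = 2 * (2 ^ m)%:R^-1 :> R.
  by rewrite expnS natrM; field; rewrite pnatr_eq0 expn_eq0.
apply: (@le_trans _ _ (2 * expR (- m%:R))).
  rewrite [leLHS](_ : _ = 2 * (expR (- D * m%:R ^+ 2) * expR (C * m%:R ^+ 2))); last by ring.
  rewrite ler_wpM2l// -expRD ler_expR DC.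
  have : (m%:R : R) <= m%:R ^+ 2 by rewrite -natrX ler_nat; case: (m) => // k; rewrite leq_pmulr.
  lra.
by rewrite ler_wpM2l// expRN_le_half_pow.
Qed.

End SubGaussianVariables.

(** * Linear forms in independent sub-Gaussian variables *)

Section LinearForms.
Context d (T : measurableType d) (R : realType) (P : probability T R).

Lemma integrable_mul (U V : T -> R) :
  measurable_fun setT U -> measurable_fun setT V ->
  (\int[P]_w (U w ^+ 2)%:E < +oo)%E -> (\int[P]_w (V w ^+ 2)%:E < +oo)%E ->
  P.-integrable setT (fun w => (U w * V w)%:E).
Proof.
move=> mU mV U2 V2.
apply: (@integrable_le _ _ _ P (fun w => U w * V w) (fun w => U w ^+ 2 + V w ^+ 2)).
- by measurability.
- by measurability.
- move=> w; have h1 := sqr_ge0 (U w + V w); have h2 := sqr_ge0 (U w - V w).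
  have h3 := sqr_ge0 (U w); have h4 := sqr_ge0 (V w).
  rewrite ler_norml; apply/andP; split; nra.
- under eq_integral do rewrite EFinD.
  rewrite ge0_integralD//; try by measurability.
  + exact: lte_add_pinfty.
  + by move=> w _; rewrite lee_fin sqr_ge0.
  + by move=> w _; rewrite lee_fin sqr_ge0.
Qed.

(** Positive and negative parts reduce signed factors to nonnegative ones. *)
Lemma expectation_mul_indep2 (U V : T -> R) :
  measurable_fun setT U -> measurable_fun setT V ->
  (\int[P]_w (U w ^+ 2)%:E < +oo)%E -> (\int[P]_w (V w ^+ 2)%:E < +oo)%E ->
  (forall A B, measurable A -> measurable B ->
     P (U @^-1` A `&` V @^-1` B) = (P (U @^-1` A) * P (V @^-1` B))%E) ->
  (\int[P]_w (U w)%:E = 0)%E -> (\int[P]_w (U w * V w)%:E = 0)%E.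
Proof.
move=> mU mV U2 V2 UV U0.
have iU := sqr_integrable1 mU U2; have iV := sqr_integrable1 mV V2.
pose p (x : R) := Num.max x 0; pose n (x : R) := Num.max (- x) 0.
have pE x : x = p x - n x.
  rewrite /p /n; case: (leP 0 x) => x0.
    by rewrite max_r ?oppr_le0// subr0.
  by rewrite max_l ?oppr_ge0 ?ltW//; lra.
have p0 x : 0 <= p x by rewrite le_max lexx orbT.
have n0 x : 0 <= n x by rewrite le_max lexx orbT.
have px x : `|p x| <= `|x|.
  by rewrite ger0_norm// ge_max ler_norm normr_ge0.
have nx x : `|n x| <= `|x|.
  by rewrite ger0_norm// ge_max -normrN ler_norm normr_ge0.
have mp : measurable_fun setT p by apply: measurable_maxr; measurability.
have mn : measurable_fun setT n.
  by apply: measurable_maxr; measurability; exact: oppr_measurable.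
have mpU := measurableT_comp mp mU; have mnU := measurableT_comp mn mU.
have mpV := measurableT_comp mp mV; have mnV := measurableT_comp mn mV.
have ip (Y : T -> R) : measurable_fun setT Y -> P.-integrable setT (EFin \o Y) ->
    P.-integrable setT (EFin \o (p \o Y)).
  move=> mY; apply: le_integrable => //.
  + by apply/measurable_EFinP; exact: measurableT_comp.
  + by move=> w _; rewrite /= lee_fin.
have iN (Y : T -> R) : measurable_fun setT Y -> P.-integrable setT (EFin \o Y) ->
    P.-integrable setT (EFin \o (n \o Y)).
  move=> mY; apply: le_integrable => //.
  + by apply/measurable_EFinP; exact: measurableT_comp.
  + by move=> w _; rewrite /= lee_fin.
have prodE (f g : R -> R) : measurable_fun setT f -> measurable_fun setT g ->
    (forall x, 0 <= f x) -> (forall x, 0 <= g x) ->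
    (\int[P]_w (f (U w) * g (V w))%:E =
     (\int[P]_w (f (U w))%:E) * \int[P]_w (g (V w))%:E)%E.
  move=> mf mg f0 g0.
  apply: (@ge0_expectation_indep2 _ _ _ P (f \o U) (g \o V)) => //.
  - exact: measurableT_comp.
  - exact: measurableT_comp.
  - by move=> w; exact: f0.
  - by move=> w; exact: g0.
  - move=> A B mA mB; apply: (UV (f @^-1` A) (g @^-1` B)).
      by rewrite -[X in measurable X]setTI; exact: mf.
    by rewrite -[X in measurable X]setTI; exact: mg.
(* U is centered, so its two parts have the same expectation. *)
have pnU : (\int[P]_w (p (U w))%:E = \int[P]_w (n (U w))%:E)%E.
  have : (\int[P]_w ((p (U w))%:E - (n (U w))%:E) = 0)%E.
    by rewrite -U0; apply: eq_integral => w _; rewrite -EFinB -pE.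
  rewrite integralB//; [|exact: ip|exact: iN].
  move/eqP; rewrite sube_eq ?add0e; first by move/eqP.
    by apply: (integrable_fin_num measurableT); exact: ip.
  rewrite fin_num_adde_defl//.
  by apply: (integrable_fin_num measurableT); exact: iN.
have sq_p (Y : T -> R) (f : R -> R) : measurable_fun setT Y -> measurable_fun setT f ->
    (forall x, `|f x| <= `|x|) -> (\int[P]_w (Y w ^+ 2)%:E < +oo)%E ->
    (\int[P]_w ((f \o Y) w ^+ 2)%:E < +oo)%E.
  move=> mY mf fx; apply: le_lt_trans; apply: ge0_le_integralr.
  - by apply: measurable_funX; exact: measurableT_comp.
  - by measurability.
  - by move=> w; exact: sqr_ge0.
  - move=> w; rewrite -(real_normK (num_real (Y w))) -(real_normK (num_real ((f \o Y) w))).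
    by apply: lerXn2r; rewrite ?nnegrE ?normr_ge0//; exact: fx.
have iprod (f g : R -> R) : measurable_fun setT f -> measurable_fun setT g ->
    (forall x, `|f x| <= `|x|) -> (forall x, `|g x| <= `|x|) ->
    P.-integrable setT (fun w => (f (U w) * g (V w))%:E).
  move=> mf mg fx gx; apply: (@integrable_mul (f \o U) (g \o V)).
  - exact: measurableT_comp.
  - exact: measurableT_comp.
  - exact: sq_p.
  - exact: sq_p.
transitivity (\int[P]_w (((p (U w) * p (V w))%:E + (n (U w) * n (V w))%:E) -
    ((p (U w) * n (V w))%:E + (n (U w) * p (V w))%:E)))%E.
  apply: eq_integral => w _; rewrite -!EFinD ?EFinN -?EFinB; congr EFin.
  by rewrite [in LHS](pE (U w)) [in LHS](pE (V w)); ring.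
rewrite integralB//; last 2 first.
- by apply: integrableD => //; exact: iprod.
- by apply: integrableD => //; exact: iprod.
rewrite !integralD//; try exact: iprod.
rewrite !prodE// pnU [X in (X - _)%E]addeC subee//.
rewrite fin_numD -(prodE n n)// -(prodE n p)//.
by apply/andP; split; apply: (integrable_fin_num measurableT); exact: iprod.
Qed.

Section Family.
Context (A : finType) (W : A -> T -> R) (K : R).
Hypothesis K0 : 0 < K.
Hypothesis sgW : forall a, std_subgaussian P K (W a).
Hypothesis indW : mutually_independent P W.

Let mW a : measurable_fun setT (W a). Proof. exact: sg_measurable (sgW a). Qed.

Definition linear_form (v : A -> R) (w : T) : R := \sum_(a : A) v a * W a w.

Lemma measurable_linear_form v : measurable_fun setT (linear_form v).
Proof. by rewrite /linear_form; measurability. Qed.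

Lemma linear_form_mgf v tau :
  (\int[P]_w (expR (tau * linear_form v w))%:E <=
   (expR (8 * K ^+ 2 * (\sum_a v a ^+ 2) * tau ^+ 2))%:E)%E.
Proof.
have -> : (\int[P]_w (expR (tau * linear_form v w))%:E =
    \int[P]_w (\prod_(a : A) expR (tau * v a * W a w))%:E)%E.
  apply: eq_integral => w _; rewrite -expR_sum mulr_sumr; congr (expR _)%:E.
  by apply: eq_bigr => a _; rewrite mulrA.
rewrite (ge0_expectation_prod_comp (h := fun a x => expR (tau * v a * x)))//; last first.
  by move=> a; measurability.
rewrite [X in (_ <= (expR X)%:E)%E](_ : _ = \sum_a 8 * K ^+ 2 * (tau * v a) ^+ 2).
  rewrite expR_sum -EFin_prod; apply: lee_prod => a; last exact: std_subgaussian_mgf.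
  by apply: integral_ge0 => w _; rewrite lee_fin expR_ge0.
rewrite mulr_sumr mulr_suml; apply: eq_bigr => a _; ring.
Qed.

Lemma expectation_mul_W a b :
  (\int[P]_w (W a w * W b w)%:E = (a == b)%:R%:E)%E.
Proof.
have [<-|ab] := eqVneq a b.
  by rewrite -(sg_var (sgW a)); apply: eq_integral => w _; rewrite expr2.
have W2 c : (\int[P]_w (W c w ^+ 2)%:E < +oo)%E by rewrite (sg_var (sgW c)) ltry.
apply: expectation_mul_indep2 => //; last exact: sg_mean (sgW a).
move=> B C mB mC.
have injab : injective (fun c : bool => if c then a else b).
  by move=> [] [] // /eqP; rewrite ?(negbTE ab)// eq_sym (negbTE ab).
have := mutually_independent_inj indW injab (B := fun c => if c then B else C).
rewrite big_bool/= => H; rewrite -[RHS]H; last by case.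
congr (P _); apply/seteqP; split => [w [HB HA] []//|w Hw].
by split; [exact: (Hw true)|exact: (Hw false)].
Qed.

Lemma linear_form_sqr v w :
  linear_form v w ^+ 2 = \sum_(ab : A * A) v ab.1 * v ab.2 * (W ab.1 w * W ab.2 w).
Proof.
rewrite expr2 mulr_suml -(pair_bigA _ (fun a b => v a * v b * (W a w * W b w)))/=.
apply: eq_bigr => a _; rewrite mulr_sumr; apply: eq_bigr => b _; ring.
Qed.

Let integrable_W a b : P.-integrable setT (fun w => (W a w * W b w)%:E).
Proof. by apply: integrable_mul => //; rewrite (sg_var (sgW _)) ltry. Qed.

Lemma linear_form_sqr_integrable v :
  P.-integrable setT (fun w => (linear_form v w ^+ 2)%:E).
Proof.
under eq_fun do rewrite linear_form_sqr -sumEFin.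
apply: integrable_sum => // ab _.
by under eq_fun do rewrite EFinM; exact: integrableZl.
Qed.

Lemma linear_form_var v :
  (\int[P]_w (linear_form v w ^+ 2)%:E = (\sum_a v a ^+ 2)%:E)%E.
Proof.
under eq_integral do rewrite linear_form_sqr -sumEFin.
rewrite integral_sum//; last first.
  by move=> ab; under eq_fun do rewrite EFinM; exact: integrableZl.
rewrite (eq_bigr (fun ab => (v ab.1 * v ab.2 * (ab.1 == ab.2)%:R)%:E)); last first.
  move=> ab _; under eq_integral do rewrite EFinM.
  by rewrite integralZl// expectation_mul_W -EFinM.
rewrite sumEFin; congr EFin.
rewrite -(pair_bigA _ (fun a b => v a * v b * (a == b)%:R))/=.
apply: eq_bigr => a _; rewrite (bigD1 a)//= eqxx mulr1 big1 ?addr0 ?expr2// => b ba.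
by rewrite eq_sym (negbTE ba) mulr0.
Qed.

End Family.

End LinearForms.

(** * Deviation of a weighted sum of squared linear forms *)

Section QuadraticDeviation.
Context (R : realType).

(** [mgf_D] is the constant D of [sqr_exp_moment] for the moment generating
    function of [linear_form_mgf]; the radius 1 / 8 D is such that
    exp (2 radius L^2) = exp (L^2 / 4 D) has a bounded expectation;
    [mgf_const] bounds the second order remainder of [expR_le_taylor2] on this
    radius; [chernoff_rate] stays within the radius and is small enough for
    the linear gain of the Chernoff bound to be at least twice its quadratic
    loss. *)
Definition mgf_D (K : R) := 8 * K ^+ 2 + 1.
Definition mgf_radius (K : R) := (8 * mgf_D K)^-1.
Definition mgf_const (K : R) :=
  16 * expR (2 * mgf_radius K + mgf_D K) / mgf_radius K ^+ 2.
Definition chernoff_rate (K : R) := Num.min (mgf_radius K) (2 * mgf_const K)^-1.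

Lemma mgf_D_gt0 K : 0 < mgf_D K.
Proof. by rewrite /mgf_D; have := sqr_ge0 K; lra. Qed.

Lemma mgf_radius_gt0 K : 0 < mgf_radius K.
Proof. by rewrite invr_gt0 mulr_gt0// mgf_D_gt0. Qed.

Lemma mgf_const_gt0 K : 0 < mgf_const K.
Proof.
apply: divr_gt0; last by apply: exprn_gt0; exact: mgf_radius_gt0.
by apply: mulr_gt0 => //; exact: expR_gt0.
Qed.

Lemma chernoff_rate_gt0 K : 0 < chernoff_rate K.
Proof. by rewrite lt_min mgf_radius_gt0 invr_gt0 mulr_gt0// mgf_const_gt0. Qed.

Context d (T : measurableType d) (P : probability T R).

(** L^2 minus its mean is sub-exponential.  In [expR_le_taylor2] the linear
    term is centered, and the remainder is a multiple of s^2 times an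
    exponential moment of L^2. *)
Lemma centered_square_mgf (A : finType) (W : A -> T -> R) K (v : A -> R) (s : R) :
  0 < K -> (forall a, std_subgaussian P K (W a)) -> mutually_independent P W ->
  \sum_a v a ^+ 2 <= 1 -> `|s| <= mgf_radius K ->
  (\int[P]_w (expR (s * (linear_form W v w ^+ 2 - \sum_a v a ^+ 2)))%:E <=
   (expR (mgf_const K * s ^+ 2))%:E)%E.
Proof.
move=> K0 sgW indW v1 sk; set q := \sum_a v a ^+ 2 in v1 *.
have q0 : 0 <= q by apply: sumr_ge0 => a _; exact: sqr_ge0.
set L := linear_form W v; pose kap := mgf_radius K; pose D := mgf_D K.
have kap0 : 0 < kap by exact: mgf_radius_gt0.
have D0 : 0 < D by exact: mgf_D_gt0.
have mW a : measurable_fun setT (W a) by exact: sg_measurable (sgW a).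
have mL : measurable_fun setT L by exact: measurable_linear_form.
have expL : (\int[P]_w (expR (L w ^+ 2 / (4 * D)))%:E <= (4 * expR D)%:E)%E.
  apply: (@sqr_exp_moment _ _ _ P L (8 * K ^+ 2)) => //.
    by rewrite mulr_ge0// sqr_ge0.
  move=> tau; apply: le_trans (linear_form_mgf K0 sgW indW v tau) _.
  rewrite lee_fin ler_expR; apply: ler_wpM2r; first exact: sqr_ge0.
  by rewrite ler_piMr// mulr_ge0// sqr_ge0.
have D4 : (4 * D)^-1 = 2 * kap by rewrite /kap /mgf_radius -/D; field; rewrite gt_eqF.
pose c := 4 * s ^+ 2 / kap ^+ 2 * expR (2 * kap).
have c0 : 0 <= c.
  rewrite /c mulr_ge0 ?expR_ge0// divr_ge0 ?sqr_ge0// mulr_ge0// sqr_ge0 //.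
pose h w := c * expR (L w ^+ 2 / (4 * D)).
have iL : P.-integrable setT (fun w => (L w ^+ 2)%:E).
  exact: linear_form_sqr_integrable.
have i1 : P.-integrable setT (EFin \o cst q) by exact: finite_measure_integrable_cst.
have iLq : P.-integrable setT (fun w => ((L w ^+ 2)%:E - q%:E)%E) by exact: integrableB.
apply: (@le_trans _ _ (1 + \int[P]_w (h w)%:E)%E).
  apply: (@le_integral_centered _ _ _ _ _ (fun w => s * (L w ^+ 2 - q))).
  - by measurability.
  - by rewrite /h; measurability.
  - exact: (integrableZl measurableT s iLq).
  - under eq_integral do rewrite EFinM.
    rewrite (integralZl measurableT iLq).
    rewrite integralB// (linear_form_var sgW indW v) -/q.
    by rewrite integral_cst//= probability_setT mule1 subee// mule0.
  - by move=> w; exact: expR_ge0.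
  - by move=> w; rewrite /h mulr_ge0// expR_ge0.
  - move=> w; apply: le_trans (expR_le_taylor2 _) _.
    rewrite lerD2l /h; set l := L w ^+ 2.
    have l0 : 0 <= l by exact: sqr_ge0.
    have lq : `|l - q| <= l + 1 by rewrite ler_norml; apply/andP; split; lra.
    pose u := kap * (l + 1).
    have u0 : 0 <= u by rewrite mulr_ge0 ?ltW//; lra.
    have e1 : expR `|s * (l - q)| <= expR u.
      by rewrite ler_expR normrM ler_pM.
    have e2 : (s * (l - q)) ^+ 2 <= s ^+ 2 * (4 * expR u / kap ^+ 2).
      rewrite exprMn; apply: ler_wpM2l; first exact: sqr_ge0.
      rewrite ler_pdivlMr ?exprn_gt0//; apply: le_trans (sqr_le_expR u0).
      rewrite /u [leRHS]exprMn mulrC; apply: ler_wpM2l; first exact: sqr_ge0.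
      rewrite -(real_normK (num_real (l - q))).
      by apply: lerXn2r => //; rewrite nnegrE; lra.
    apply: (@le_trans _ _ (s ^+ 2 * (4 * expR u / kap ^+ 2) * expR u)).
      by apply: ler_pM => //; rewrite ?sqr_ge0 ?expR_ge0.
    have -> : c * expR (l / (4 * D)) = 4 * s ^+ 2 / kap ^+ 2 * (expR u * expR u).
      rewrite /c -mulrA -!expRD; congr (_ * expR _).
      by rewrite D4 /u; ring.
    by rewrite le_eqVlt; apply/orP; left; apply/eqP; field; rewrite gt_eqF.
rewrite ge0_integralZlr//; last by measurability.
apply: (@le_trans _ _ (1 + c%:E * (4 * expR D)%:E)%E).
  by rewrite leeD2l// lee_wpmul2l.
rewrite -EFinM -EFinD lee_fin; apply: le_trans (expR_ge1Dx _).
rewrite lerD2l /c /mgf_const -/kap -/D (expRD (2 * kap) D).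
by rewrite le_eqVlt; apply/orP; left; apply/eqP; field; rewrite gt_eqF.
Qed.

Section Groups.
Context (G A : finType) (W : G * A -> T -> R) (K : R).
Hypothesis K0 : 0 < K.
Hypothesis sgW : forall ga, std_subgaussian P K (W ga).
Hypothesis indW : mutually_independent P W.
Context (v : A -> R).
Hypothesis v1 : \sum_a v a ^+ 2 <= 1.

Let L g := linear_form (fun a => W (g, a)) v.
Let mW ga : measurable_fun setT (W ga). Proof. exact: sg_measurable (sgW ga). Qed.
Let mL g : measurable_fun setT (L g).
Proof. exact: measurable_linear_form. Qed.

Lemma linear_forms_independent : mutually_independent P L.
Proof.
apply: (blocks_independent mW indW (pi := fst)) => g.
rewrite /L /linear_form; apply: measurable_sum => a; apply: measurable_funM.
  exact: measurable_cst.
exact: block_measurable.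
Qed.

Context (mu : G -> R) (B : R).
Hypothesis muB : forall g, 0 <= mu g <= B.
Hypothesis B0 : 0 < B.

Definition group_deviation (w : T) : R :=
  \sum_g mu g * (L g w ^+ 2 - \sum_a v a ^+ 2).

Lemma measurable_group_deviation : measurable_fun setT group_deviation.
Proof. by rewrite /group_deviation; measurability. Qed.

Lemma group_deviation_mgf s : `|s| * B <= mgf_radius K ->
  (\int[P]_w (expR (s * group_deviation w))%:E <=
   (expR (mgf_const K * s ^+ 2 * (B * \sum_g mu g)))%:E)%E.
Proof.
move=> sB.
pose f g x := expR (s * mu g * (x ^+ 2 - \sum_a v a ^+ 2)).
have -> : (\int[P]_w (expR (s * group_deviation w))%:E =
    \int[P]_w (\prod_g f g (L g w))%:E)%E.
  apply: eq_integral => w _; rewrite -expR_sum mulr_sumr; congr (expR _)%:E.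
  by apply: eq_bigr => g _; rewrite mulrA.
rewrite (ge0_expectation_prod_comp (h := f))//; last 3 first.
- by move=> g; rewrite /f; measurability.
- by move=> g x; exact: expR_ge0.
- exact: linear_forms_independent.
have mu0 g : 0 <= mu g by case/andP: (muB g).
have muB' g : mu g <= B by case/andP: (muB g).
apply: (@le_trans _ _ (\prod_g (expR (mgf_const K * (s * mu g) ^+ 2))%:E)%E).
  apply: lee_prod => g.
    by apply: integral_ge0 => w _; rewrite lee_fin expR_ge0.
  apply: (@centered_square_mgf _ (fun a => W (g, a))) => //.
    by apply: mutually_independent_inj => // a b [].
  by rewrite normrM (ger0_norm (mu0 g)) (le_trans _ sB)// ler_wpM2l.
rewrite EFin_prod -expR_sum lee_fin ler_expR.
rewrite -mulr_sumr -[leRHS]mulrA; apply: ler_wpM2l; first exact/ltW/mgf_const_gt0.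
have -> : \sum_g (s * mu g) ^+ 2 = s ^+ 2 * \sum_g mu g ^+ 2.
  by rewrite mulr_sumr; apply: eq_bigr => g _; rewrite exprMn.
apply: ler_wpM2l; first exact: sqr_ge0.
rewrite mulr_sumr; apply: ler_sum => g _; rewrite expr2.
by apply: ler_wpM2r.
Qed.

(** Chernoff's bound for both signs, with the exponent s = rate t / B. *)
Lemma group_deviation_tail (t : R) : 0 < t <= 1 ->
  (P [set w | (t * \sum_g mu g < `|group_deviation w|)%R] <=
   (2 * expR (- (chernoff_rate K / 2 * t ^+ 2 * ((\sum_g mu g) / B))))%:E)%E.
Proof.
move=> /andP[t0 t1]; set S := \sum_g mu g.
have S0 : 0 <= S by apply: sumr_ge0 => g _; case/andP: (muB g).
pose th := chernoff_rate K; have th0 : 0 < th by exact: chernoff_rate_gt0.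
pose s := th * t / B; have s0 : 0 < s by rewrite divr_gt0// mulr_gt0.
have thk : th <= mgf_radius K by rewrite ge_min lexx.
have thC : mgf_const K * th <= 2^-1.
  have C0 := mgf_const_gt0 K.
  have : th <= (2 * mgf_const K)^-1 by rewrite ge_min lexx orbT.
  rewrite invfM ler_pdivlMr// mulrC //.
have one (e : R) (Y : {RV P >-> R}) : `|e| = 1 -> (forall w, Y w = e * group_deviation w) ->
    (P [set w | (t * S <= Y w)%R] <= (expR (- (th / 2 * t ^+ 2 * (S / B))))%:E)%E.
  move=> e1 YE; apply: le_trans (chernoff Y (t * S) s0) _.
  have : ('M_P Y s <= (expR (mgf_const K * s ^+ 2 * (B * S)))%:E)%E.
    rewrite /mmt_gen_fun unlock.
    have -> : (\int[P]_w ((expR \o s \o* Y) w)%:E =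
       \int[P]_w (expR ((e * s) * group_deviation w))%:E)%E.
      by apply: eq_integral => w _ /=; rewrite YE; congr (expR _)%:E; ring.
    have -> : s ^+ 2 = (e * s) ^+ 2.
      by rewrite [RHS]exprMn -(real_normK (num_real e)) e1 expr1n mul1r.
    apply: group_deviation_mgf; rewrite normrM e1 mul1r gtr0_norm//.
    rewrite /s divfK ?gt_eqF//; apply: le_trans thk.
    by rewrite ler_piMr// ltW.
  move=> H; apply: (@le_trans _ _ ((expR (mgf_const K * s ^+ 2 * (B * S)))%:E * (expR (- (s * (t * S))))%:E)%E).
    by apply: lee_wpmul2r => //; rewrite lee_fin expR_ge0.
  rewrite -EFinM -expRD lee_fin ler_expR.
  have -> : mgf_const K * s ^+ 2 * (B * S) = (mgf_const K * th) * (th * t ^+ 2 * (S / B)).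
    by rewrite /s; field; rewrite gt_eqF.
  have -> : s * (t * S) = th * t ^+ 2 * (S / B) by rewrite /s; field; rewrite gt_eqF.
  have -> : th / 2 * t ^+ 2 * (S / B) = th * t ^+ 2 * (S / B) - 2^-1 * (th * t ^+ 2 * (S / B)) by field; rewrite gt_eqF.
  rewrite opprB lerD2r; apply: ler_wpM2r => //.
  apply: mulr_ge0; last by rewrite divr_ge0// ltW.
  by apply: mulr_ge0; [exact: ltW|exact: sqr_ge0].
have mN : measurable_fun setT (fun w => - group_deviation w).
  by apply: (measurableT_comp (@oppr_measurable _ setT)); exact: measurable_group_deviation.
pose Y1 : {RV P >-> R} := HB.pack group_deviation
  (isMeasurableFun.Build _ _ _ _ _ measurable_group_deviation).
pose Y2 : {RV P >-> R} := HB.pack (fun w => - group_deviation w)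
  (isMeasurableFun.Build _ _ _ _ _ mN).
have mle (Y : {RV P >-> R}) : measurable [set w | (t * S <= Y w)%R].
  rewrite (_ : mkset _ = Y @^-1` `[t * S, +oo[%classic); last first.
    by apply/seteqP; split => w /=; rewrite in_itv/= andbT.
  by rewrite -[X in measurable X]setTI; apply: (@measurable_funPT _ _ _ _ Y).
apply: (@le_trans _ _ (P ([set w | (t * S <= Y1 w)%R] `|` [set w | (t * S <= Y2 w)%R]))).
  apply: le_measure; rewrite ?inE.
  - rewrite (_ : mkset _ = (fun w => `|group_deviation w|) @^-1` `]t * S, +oo[%classic); last first.
      by apply/seteqP; split => w /=; rewrite in_itv/= andbT.
    rewrite -[X in measurable X]setTI.
    by apply: (measurableT_comp (@normr_measurable _ setT) measurable_group_deviation).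
  - exact: measurableU.
  - move=> w /=; rewrite lter_normr => /orP[/ltW|/ltW]; [by left|by right].
apply: le_trans (measureU2 _ _ _) _ => //.
rewrite mulrDl mul1r EFinD; apply: leeD.
  by apply: (one 1 Y1); [rewrite normr1|move=> w; rewrite mul1r].
by apply: (one (- 1) Y2); [rewrite normrN normr1|move=> w; rewrite mulN1r].
Qed.

End Groups.

End QuadraticDeviation.

(** * An integer net of the ball *)

Section Net.
Context (R : realType) (m : nat).
Implicit Types u v : 'I_m -> R.

Definition sqnorm v : R := \sum_a v a ^+ 2.

Lemma sqnorm_ge0 v : 0 <= sqnorm v.
Proof. by apply: sumr_ge0 => a _; exact: sqr_ge0. Qed.

Lemma sqnormZ c v : sqnorm (fun a => c * v a) = c ^+ 2 * sqnorm v.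
Proof. by rewrite /sqnorm mulr_sumr; apply: eq_bigr => a _; rewrite exprMn. Qed.

Notation netN := (16 * m)%N.

(** The net consists of the integer vectors of squared length at most 16 m
    ([in_net]); their coordinates are at most 16 m in absolute value, and are
    stored as a sign and a natural number.  Integrality makes the count
    elementary. *)
Definition signed_vec := {ffun 'I_m -> bool * 'I_netN.+1}.

Definition real_of (f : signed_vec) (a : 'I_m) : R :=
  (-1) ^+ (f a).1 * (val (f a).2)%:R.

Definition in_net (f : signed_vec) : bool :=
  (\sum_(a < m) val (f a).2 ^ 2 <= netN)%N.

Lemma sqnorm_real_of f : sqnorm (real_of f) = (\sum_(a < m) val (f a).2 ^ 2)%:R.
Proof.
rewrite /sqnorm natr_sum; apply: eq_bigr => a _.
by rewrite /real_of exprMn -exprM mulnC exprM sqrrN !expr1n mul1r natrX.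
Qed.

Lemma sum_half_pow n : \sum_(i < n) (2^-1) ^+ i <= 2 :> R.
Proof.
suff -> : \sum_(i < n) (2^-1) ^+ i = 2 - 2 * (2^-1) ^+ n :> R.
  by rewrite lerBlDr lerDl mulr_ge0.
elim: n => [|n IH]; first by rewrite big_ord0 expr0; ring.
by rewrite big_ord_recr/= IH exprS; field.
Qed.

(** On the net the sum of the |f_a| is at most that of the f_a^2, hence at most
    16 m.  So every net vector has weight at least 1 for the product weight
    2^(16 m) times the product of the 2^(-|f_a|), whose total mass is at most
    2^(16 m) 4^m. *)
Lemma card_net : #|in_net|%:R <= 2 ^+ (18 * m) :> R.
Proof.
pose wt (x : bool * 'I_netN.+1) : R := (2^-1) ^+ x.2.
have wt0 x : 0 <= wt x by rewrite exprn_ge0.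
have H : \prod_(a < m) \sum_(x : bool * 'I_netN.+1) wt x <= 4 ^+ m.
  rewrite -[in leRHS](card_ord m) -prodr_const; apply: ler_prod => a _.
  rewrite sumr_ge0//=.
  rewrite -(pair_bigA _ (fun (b : bool) (i : 'I_netN.+1) => (2^-1) ^+ i : R))/= big_bool/=.
  by have := sum_half_pow netN.+1; lra.
rewrite bigA_distr_bigA/= in H.
have -> : (18 * m = 16 * m + 2 * m)%N by rewrite -mulnDl.
rewrite exprD -[X in _ * X](_ : 4 ^+ m = _); last first.
  by rewrite exprM; congr (_ ^+ _); rewrite -natrX.
apply: le_trans (ler_wpM2l _ H); last by rewrite exprn_ge0.
rewrite mulr_sumr -sum1_card natr_sum big_mkcond/=.
apply: ler_sum => f _; rewrite unfold_in; case: ifPn => [fin|_]; last first.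
  by rewrite mulr_ge0 ?exprn_ge0// prodr_ge0.
have le1 : (\sum_(a < m) val (f a).2 <= netN)%N.
  apply: leq_trans fin; apply: leq_sum => a _.
  by case: (val (f a).2) => // k; rewrite expnS expn1 leq_pmulr.
rewrite /wt prodrXr exprVn -[leLHS]mul1r ler_pdivlMr ?exprn_gt0//.
by rewrite mulr1 mul1r; apply: ler_weXn2l => //; rewrite ler1n.
Qed.

(** Rounding the coordinates towards 0 does not lengthen the vector, and moves
    each coordinate by less than 1. *)
Lemma net_approximation v : sqnorm v <= netN%:R ->
  exists2 f, in_net f & sqnorm (fun a => v a - real_of f a) <= m%:R.
Proof.
move=> vN.
have va a : v a ^+ 2 <= netN%:R.
  apply: le_trans vN; rewrite /sqnorm (bigD1 a)//= lerDl.
  by apply: sumr_ge0 => b _; exact: sqr_ge0.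
pose k a := Num.trunc `|v a|.
have kP a : ((k a)%:R <= `|v a|) * (`|v a| < (k a)%:R + 1).
  have /andP[h1 h2] := truncn_itv (normr_ge0 (v a)).
  by split => //; rewrite natr1.
have k2 a : (k a)%:R ^+ 2 <= v a ^+ 2.
  rewrite -(real_normK (num_real (v a))); apply: lerXn2r; rewrite ?nnegrE//.
  exact: (kP a).1.
have kN a : (k a < netN.+1)%N.
  rewrite ltnS -(ler_nat R); apply: le_trans (va a); apply: le_trans (k2 a).
  by rewrite -natrX ler_nat; case: (k a) => // j; rewrite expnS expn1 leq_pmulr.
pose f : signed_vec := [ffun a => (v a < 0, Ordinal (kN a))].
have fE a : real_of f a = (-1) ^+ (v a < 0)%R * (k a)%:R by rewrite /real_of ffunE.
exists f.
  rewrite /in_net -(ler_nat R) -sqnorm_real_of; apply: le_trans vN.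
  apply: ler_sum => a _; rewrite fE exprMn -exprM mulnC exprM sqrrN !expr1n mul1r.
  exact: k2.
rewrite -[m in m%:R](card_ord m) -sum1_card natr_sum; apply: ler_sum => a _.
have [h1 h2] := kP a.
have -> : v a = (-1) ^+ (v a < 0)%R * `|v a| by rewrite -realEsign ?num_real.
rewrite fE -mulrBr exprMn -exprM mulnC exprM sqrrN !expr1n mul1r.
nra.
Qed.

(** Let M be any constant with |q u| <= M |u|^2.  Scale u to squared length
    16 m and write it as f + r with f in the net and |r|^2 <= m.  The polar form
    [b] is bounded by M as well, so |q (f + r)| <= 16 m tau + 8 M m + M m, that is
    |q u| <= (tau + 9 M / 16) |u|^2.  The best constant is hence at most
    16 tau / 7. *)
Lemma net_to_space (q : ('I_m -> R) -> R) (b : ('I_m -> R) -> ('I_m -> R) -> R)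
    (M0 tau : R) :
  (forall c u v, q (fun a => c * u a + v a) = c ^+ 2 * q u + 2 * c * b u v + q v) ->
  (forall c u, q (fun a => c * u a) = c ^+ 2 * q u) ->
  (forall u, `|q u| <= M0 * sqnorm u) -> 0 <= M0 -> 0 <= tau ->
  (forall f, in_net f -> `|q (real_of f)| <= tau * netN%:R) ->
  forall v, `|q v| <= 3 * tau * sqnorm v.
Proof.
move=> qb qZ qM M00 tau0 qnet.
pose valid M := 0 <= M /\ forall u, `|q u| <= M * sqnorm u.
have step M : valid M -> valid (tau + 9 / 16 * M).
  move=> [M_ge0 HM]; split; first by rewrite addr_ge0// mulr_ge0.
  move=> u; have [u0|u0] := eqVneq (sqnorm u) 0.
    by have := HM u; rewrite u0 !mulr0.
  have {}u0 : 0 < sqnorm u by rewrite lt0r u0 sqnorm_ge0.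
  have m0 : (0 < m)%N.
    rewrite lt0n; apply/negP => /eqP m0; move: u0; rewrite /sqnorm big1 ?ltxx// => a _.
    by have := leq_trans (ltn_ord a) (eq_leq m0).
  pose s : R := Num.sqrt (netN%:R / sqnorm u).
  have s2 : s ^+ 2 = netN%:R / sqnorm u by rewrite sqr_sqrtr// divr_ge0// ltW.
  have s0 : 0 < s ^+ 2 by rewrite s2 divr_gt0// ltr0n muln_gt0.
  pose v a := s * u a.
  have vN : sqnorm v = netN%:R by rewrite sqnormZ s2 divfK// gt_eqF.
  suff : `|q v| <= netN%:R * (tau + 9 / 16 * M).
    rewrite /v qZ normrM (ger0_norm (ltW s0)) s2 mulrAC ler_pdivrMr//.
    by rewrite -[leRHS]mulrA ler_pM2l ?ltr0n ?muln_gt0.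
  have [f fnet fr] : exists2 f, in_net f & sqnorm (fun a => v a - real_of f a) <= m%:R.
    by apply: net_approximation; rewrite vN.
  pose a := real_of f; pose r i := v i - a i.
  have vE : v = (fun i => 1 * a i + r i) by apply/funext => i; rewrite /r; ring.
  have a16 : sqnorm a <= netN%:R.
    by rewrite sqnorm_real_of ler_nat.
  have nE : netN%:R = 16 * m%:R :> R by rewrite natrM.
  (* 4 times the polar form at (a / 4, r) is q (a / 4 + r) - q (- a / 4 + r);
     the weight 1 / 4 balances |a|^2 <= 16 m with |r|^2 <= m. *)
  have bB : `|b a r| <= 4 * M * m%:R.
    have h1 := qb 4^-1 a r; have h2 := qb (- 4^-1) a r.
    have := HM (fun i => 4^-1 * a i + r i); have := HM (fun i => - 4^-1 * a i + r i).
    rewrite h1 h2 sqrrN => n2 n1.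
    have par : sqnorm (fun i => 4^-1 * a i + r i) + sqnorm (fun i => - 4^-1 * a i + r i)
        <= 4 * m%:R.
      have -> : sqnorm (fun i => 4^-1 * a i + r i) + sqnorm (fun i => - 4^-1 * a i + r i)
          = 8^-1 * sqnorm a + 2 * sqnorm r.
        rewrite /sqnorm -big_split/= !mulr_sumr -big_split/=.
        by apply: eq_bigr => i _; field.
      lra.
    have : M * (sqnorm (fun i => 4^-1 * a i + r i) + sqnorm (fun i => - 4^-1 * a i + r i))
        <= M * (4 * m%:R) by rewrite ler_wpM2l.
    move: n1 n2; rewrite !ler_norml => /andP[? ?] /andP[? ?] ?.
    apply/andP; split; lra.
  have qr : `|q r| <= M * m%:R by apply: le_trans (HM r) _; rewrite ler_wpM2l.
  have qa := qnet f fnet.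
  have qv : q v = q a + 2 * b a r + q r by rewrite vE qb; ring.
  rewrite qv nE in qa *.
  move: qa bB qr; rewrite -/a !ler_norml => /andP[? ?] /andP[? ?] /andP[? ?].
  apply/andP; split; lra.
move=> v; apply: contrapT => /negP; rewrite -ltNge => bad.
have v0 : 0 < sqnorm v.
  rewrite lt0r sqnorm_ge0 andbT; apply/eqP => v0.
  by have := qM v; rewrite v0 mulr0 leNgt; move: bad; rewrite v0 mulr0 => ->.
pose V := [set M | valid M].
have V0 : V !=set0 by exists M0.
have Vlb : lbound V (`|q v| / sqnorm v).
  by move=> M [_ HM]; rewrite ler_pdivrMr.
have infV : `|q v| / sqnorm v <= inf V by apply: lb_le_inf.
have big : 3 * tau < inf V by apply: lt_le_trans infV; rewrite ltr_pdivlMr.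
have hinf : has_inf V by split => //; exists (`|q v| / sqnorm v).
have e0 : 0 < inf V / 9 by rewrite divr_gt0//; apply: le_lt_trans big; rewrite mulr_ge0.
have [M VM Mlt] := inf_adherent e0 hinf.
have : inf V <= tau + 9 / 16 * M by apply: ge_inf; [exact: hinf.2|exact: step].
lra.
Qed.

End Net.

(** * Uniform deviation of a sample covariance form *)

Lemma sum_cauchy_schwarz (R : realType) (I : finType) (u v : I -> R) :
  (\sum_i u i * v i) ^+ 2 <= (\sum_i u i ^+ 2) * (\sum_i v i ^+ 2).
Proof.
set C := \sum_i u i * v i; set A := \sum_i u i ^+ 2; set B := \sum_i v i ^+ 2.
have A0 : 0 <= A by apply: sumr_ge0 => i _; exact: sqr_ge0.
have B0 : 0 <= B by apply: sumr_ge0 => i _; exact: sqr_ge0.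
have H : 0 <= B * (B * A - C ^+ 2).
  have -> : B * (B * A - C ^+ 2) = \sum_i (B * u i - C * v i) ^+ 2.
    have -> : \sum_i (B * u i - C * v i) ^+ 2 =
        \sum_i (B ^+ 2 * u i ^+ 2 + (- 2 * B * C) * (u i * v i) + C ^+ 2 * v i ^+ 2).
      by apply: eq_bigr => i _; ring.
    by rewrite !big_split/= -!mulr_sumr -/A -/B -/C; ring.
  by apply: sumr_ge0 => i _; exact: sqr_ge0.
have [B0'|B0'] := eqVneq B 0.
  have v0 i : v i = 0.
    apply/eqP; rewrite -sqrf_eq0 eq_le sqr_ge0 andbT -B0' /B (bigD1 i)//= lerDl.
    by apply: sumr_ge0 => j _; exact: sqr_ge0.
  by rewrite /C big1 ?expr0n ?mulr_ge0// => i _; rewrite v0 mulr0.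
have {}B0 : 0 < B by rewrite lt0r B0'.
by rewrite pmulr_rge0// in H; rewrite mulrC -subr_ge0.
Qed.

Section UniformDeviation.
Context (R : realType) d (T : measurableType d) (P : probability T R).

Lemma measure_bigsetU_le (I : Type) (s : seq I) (A : I -> set T) :
  (forall i, measurable (A i)) ->
  (P (\big[setU/set0]_(i <- s) A i) <= \sum_(i <- s) P (A i))%E.
Proof.
move=> mA; elim: s => [|i s IH]; first by rewrite !big_nil measure0.
rewrite !big_cons; apply: le_trans (measureU2 _ _ _) _ => //.
  exact: bigsetU_measurable.
by rewrite leeD2l.
Qed.

Lemma union_bound (I : Type) (s : seq I) (A : I -> set T) (c : R) :
  (forall i, measurable (A i)) -> (forall i, (P (A i) <= c%:E)%E) ->
  (P (\big[setU/set0]_(i <- s) A i) <= ((size s)%:R * c)%:E)%E.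
Proof.
move=> mA Ac; apply: le_trans (measure_bigsetU_le s mA) _.
elim: s => [|i s IH]; first by rewrite big_nil mul0r.
by rewrite big_cons/= -natr1 mulrDl mul1r addrC EFinD leeD.
Qed.

Lemma linear_form_comb (A : finType) (x : A -> T -> R) c u v w :
  linear_form x (fun a => c * u a + v a) w = c * linear_form x u w + linear_form x v w.
Proof.
rewrite /linear_form mulr_sumr -big_split/=; apply: eq_bigr => a _; ring.
Qed.

Lemma linear_formZ (A : finType) (x : A -> T -> R) c u w :
  linear_form x (fun a => c * u a) w = c * linear_form x u w.
Proof. by rewrite /linear_form mulr_sumr; apply: eq_bigr => a _; ring. Qed.

Lemma group_deviationZ (G A : finType) (W : G * A -> T -> R) mu c u w :
  group_deviation W (fun a => c * u a) mu w = c ^+ 2 * group_deviation W u mu w.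
Proof.
rewrite /group_deviation mulr_sumr; apply: eq_bigr => g _.
rewrite linear_formZ (_ : \sum_a (c * u a) ^+ 2 = c ^+ 2 * \sum_a u a ^+ 2); first by ring.
by rewrite mulr_sumr; apply: eq_bigr => a _; rewrite exprMn.
Qed.

(** [Q] may fail only on a measurable set of probability at most [a]; [Q] itself
    may be a statement about uncountably many vectors, whose truth set need not
    be known to be measurable. *)
Definition likely (Q : T -> Prop) (a : R) : Prop :=
  exists E : set T,
    [/\ measurable E, forall w, E w -> Q w & (P (~` E) <= a%:E)%E].

Lemma likely_and (Q1 Q2 : T -> Prop) a1 a2 :
  likely Q1 a1 -> likely Q2 a2 -> likely (fun w => Q1 w /\ Q2 w) (a1 + a2).
Proof.
move=> [E1 [mE1 H1 P1]] [E2 [mE2 H2 P2]]; exists (E1 `&` E2); split.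
- exact: measurableI.
- by move=> w [/H1 h1 /H2 h2].
- rewrite setCI EFinD; apply: le_trans (measureU2 _ _ _) _.
  + exact: measurableC.
  + exact: measurableC.
  + exact: leeD.
Qed.

Lemma likely_sub (Q1 Q2 : T -> Prop) a1 a2 :
  likely Q1 a1 -> (forall w, Q1 w -> Q2 w) -> a1 <= a2 -> likely Q2 a2.
Proof.
move=> [E [mE H PE]] Q12 a12; exists E; split => //.
  by move=> w /H /Q12.
by apply: le_trans PE _; rewrite lee_fin.
Qed.

Lemma likely_ler (f : T -> R) (b a : R) : measurable_fun setT f ->
  (P [set w | (b < f w)%R] <= a%:E)%E -> likely (fun w => f w <= b) a.
Proof.
move=> mf Pf; exists (~` [set w | (b < f w)%R]); split.
- apply: measurableC; rewrite (_ : mkset _ = f @^-1` `]b, +oo[%classic).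
    by rewrite -[X in measurable X]setTI; exact: mf.
  by apply/seteqP; split => w /=; rewrite in_itv/= andbT.
- by move=> w /= /negP; rewrite -leNgt.
- by rewrite setCK.
Qed.

Lemma likely_forall (I : finType) (Q : I -> T -> Prop) (a : R) :
  (forall i, likely (Q i) a) -> likely (fun w => forall i, Q i w) (#|I|%:R * a).
Proof.
move=> /choice[E EP]; exists (~` \big[setU/set0]_(i <- enum I) (~` E i)).
have mE i : measurable (~` E i) by apply: measurableC; case: (EP i).
split.
- by apply: measurableC; exact: bigsetU_measurable.
- move=> w Ew i; case: (EP i) => _ H _; apply: H; apply: contrapT => nE.
  by apply: Ew; rewrite -bigcup_seq/=; exists i => //=; rewrite mem_enum.
- rewrite setCK cardE; apply: union_bound => // i; by case: (EP i).
Qed.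

(** Union bound of [group_deviation_tail] over the net, scaled to the unit
    ball, then [net_to_space]. *)
Lemma uniform_deviation (G : finType) (m : nat) (W : G * 'I_m -> T -> R) (K : R)
    (mu : G -> R) (B t : R) :
  0 < K -> (forall ga, std_subgaussian P K (W ga)) -> mutually_independent P W ->
  (forall g, 0 <= mu g <= B) -> 0 < B -> 0 < t <= 1 ->
  likely (fun w => forall v,
      `|group_deviation W v mu w| <= 3 * (t * \sum_g mu g) * sqnorm v)
    (2 ^+ (18 * m) *
      (2 * expR (- (chernoff_rate K / 2 * t ^+ 2 * ((\sum_g mu g) / B))))).
Proof.
move=> K0 sgW indW muB B0 t01; set S := \sum_g mu g.
have /andP[t0 t1] := t01.
have S0 : 0 <= S by apply: sumr_ge0 => g _; case/andP: (muB g).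
have mW ga : measurable_fun setT (W ga) by exact: sg_measurable (sgW ga).
pose sc : R := (4 * Num.sqrt m%:R)^-1.
have sc2 : sc ^+ 2 = (16 * m)%:R^-1.
  by rewrite exprVn exprMn sqr_sqrtr// natrM; congr (_ * _)^-1; rewrite -natrX.
pose unit_net (f : signed_vec m) a := sc * real_of R f a.
pose bad (f : signed_vec m) : set T :=
  if in_net f then [set w | (t * S < `|group_deviation W (unit_net f) mu w|)%R] else set0.
have mbad f : measurable (bad f).
  rewrite /bad; case: ifPn => // _.
  rewrite (_ : mkset _ = (fun w => `|group_deviation W (unit_net f) mu w|) @^-1`
    `]t * S, +oo[%classic); last first.
    by apply/seteqP; split => w /=; rewrite in_itv/= andbT.
  rewrite -[X in measurable X]setTI.
  by apply: (measurableT_comp (@normr_measurable _ setT) _) => //; exact: measurable_group_deviation.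
have Pbad f : (P (bad f) <=
    (2 * expR (- (chernoff_rate K / 2 * t ^+ 2 * (S / B))))%:E)%E.
  rewrite /bad; case: ifPn => [fnet|_]; last first.
    by rewrite measure0 lee_fin mulr_ge0// expR_ge0.
  apply: group_deviation_tail => //.
  rewrite -/(sqnorm _) sqnormZ sc2 sqnorm_real_of mulrC.
  have [m0|m0] := posnP m.
    by rewrite [X in _ / X](_ : _ = 0) ?invr0 ?mulr0// m0 muln0.
  by rewrite ler_pdivrMr ?ltr0n ?muln_gt0// mul1r ler_nat.
exists (~` \big[setU/set0]_(f <- enum (@in_net m)) bad f); split.
- by apply: measurableC; exact: bigsetU_measurable.
- move=> w Ew v.
  pose b u v := \sum_g mu g * (linear_form (fun a => W (g, a)) u w *
     linear_form (fun a => W (g, a)) v w - \sum_a u a * v a).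
  pose M0 := \sum_g mu g * (\sum_a W (g, a) w ^+ 2 + 1).
  apply: (@net_to_space R m (fun v => group_deviation W v mu w) b M0 (t * S)).
  + move=> c x y; rewrite /group_deviation /b !mulr_sumr -!big_split/=.
    apply: eq_bigr => g _; rewrite linear_form_comb.
    have -> : \sum_a (c * x a + y a) ^+ 2 =
        c ^+ 2 * (\sum_a x a ^+ 2) + 2 * c * (\sum_a x a * y a) + \sum_a y a ^+ 2.
      by rewrite !mulr_sumr -!big_split/=; apply: eq_bigr => a _; ring.
    ring.
  + by move=> c u; rewrite group_deviationZ.
  + move=> u; rewrite /group_deviation /M0 mulr_suml.
    apply: le_trans (ler_norm_sum _ _ _) _; apply: ler_sum => g _.
    have mug : 0 <= mu g by case/andP: (muB g).
    rewrite normrM ger0_norm// -mulrA; apply: ler_wpM2l => //.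
    have := sum_cauchy_schwarz u (fun a => W (g, a) w).
    rewrite -/(linear_form (fun a => W (g, a)) u w) -/(sqnorm u) => cs.
    have l0 := sqr_ge0 (linear_form (fun a => W (g, a)) u w).
    have n0 := sqnorm_ge0 u.
    have x0 : 0 <= \sum_a W (g, a) w ^+ 2 by apply: sumr_ge0 => a _; exact: sqr_ge0.
    rewrite ler_norml; apply/andP; split; nra.
  + apply: sumr_ge0 => g _; apply: mulr_ge0; first by case/andP: (muB g).
    by rewrite addr_ge0// sumr_ge0// => a _; exact: sqr_ge0.
  + by rewrite mulr_ge0// ltW.
  + move=> f fnet.
    have : ~ bad f w.
      move=> bw; apply: Ew; rewrite -bigcup_seq/=; exists f => //=.
      by rewrite mem_enum.
    rewrite /bad fnet /= => /negP; rewrite -leNgt group_deviationZ sc2.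
    rewrite normrM ger0_norm ?invr_ge0//.
    have [m0|m0] := posnP m.
      have no (a : 'I_m) : False by have := leq_trans (ltn_ord a) (eq_leq m0).
      have -> : group_deviation W (real_of R f) mu w = 0.
        rewrite /group_deviation big1// => g _; rewrite /linear_form.
        by rewrite !big1 ?expr0n ?subr0 ?mulr0// => a; case: (no a).
      rewrite normr0 mulr0 => _; apply: mulr_ge0 => //.
      by apply: mulr_ge0 => //; exact: ltW.
    by rewrite ler_pdivrMl ?ltr0n ?muln_gt0// mulrC.
- rewrite setCK; apply: le_trans (union_bound _ mbad Pbad) _.
  rewrite lee_fin; apply: ler_wpM2r; first by rewrite mulr_ge0// expR_ge0.
  by rewrite -cardE; exact: card_net.
Qed.

End UniformDeviation.

(** * Weighted sums of column norms *)

Section WeightedNorms.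
Context (R : realType) d (T : measurableType d) (P : probability T R).

(** Each exp (x_j) lies above the tangent of the exponential at the mean. *)
Lemma expR_jensen (J : finType) (b x : J -> R) :
  (forall j, 0 <= b j) -> \sum_j b j = 1 ->
  expR (\sum_j b j * x j) <= \sum_j b j * expR (x j).
Proof.
move=> b0 b1; set y := \sum_j b j * x j.
have -> : expR y = \sum_j b j * (expR y * (1 + (x j - y))).
  transitivity (expR y * (\sum_j b j + (\sum_j b j * x j - y * \sum_j b j))).
    by rewrite b1 mulr1 -/y subrr addr0 mulr1.
  rewrite mulrDr mulrBr !mulr_sumr -sumrB -big_split/=.
  by apply: eq_bigr => j _; ring.
apply: ler_sum => j _; apply: ler_wpM2l => //.
have -> : expR (x j) = expR y * expR (x j - y) by rewrite -expRD; congr expR; ring.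
by apply: ler_wpM2l; [exact: expR_ge0|exact: expR_ge1Dx].
Qed.

(** By convexity, the exponential moment of a weighted average of column norms
    is at most the bound 2^#|A| valid for one column, whatever the number of
    columns. *)
Lemma weighted_norm_tail (A J : finType) (W : A * J -> T -> R) (K : R) (al : J -> R) :
  0 < K -> (forall aj, std_subgaussian P K (W aj)) -> mutually_independent P W ->
  (forall j, 0 <= al j) ->
  (P [set w | (2 * K ^+ 2 * #|A|%:R * \sum_j al j <
               \sum_j al j * \sum_a W (a, j) w ^+ 2)%R] <=
   (expR (- #|A|%:R))%:E)%E.
Proof.
move=> K0 sgW indW al0; set S := \sum_j al j; set n : R := #|A|%:R.
have mW aj : measurable_fun setT (W aj) by exact: sg_measurable (sgW aj).
have K20 : 0 < K ^+ 2 by rewrite exprn_gt0.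
have S0 : 0 <= S by apply: sumr_ge0.
have [Sz|Sn] := eqVneq S 0.
  have alz j : al j = 0.
    apply/eqP; rewrite eq_le al0 andbT -Sz /S (bigD1 j)//= lerDl.
    exact: sumr_ge0.
  rewrite (_ : mkset _ = set0) ?measure0 ?lee_fin ?expR_ge0//.
  apply/seteqP; split => // w /=; rewrite Sz mulr0 big1 ?ltxx// => j _.
  by rewrite alz mul0r.
have {Sn}S0 : 0 < S by rewrite lt0r Sn.
pose be j := al j / S.
have be0 j : 0 <= be j by rewrite divr_ge0// ltW.
have be1 : \sum_j be j = 1 by rewrite -mulr_suml divff// gt_eqF.
pose N j w := (\sum_a W (a, j) w ^+ 2) / K ^+ 2.
pose Y w := \sum_j be j * N j w.
have mN j : measurable_fun setT (N j) by rewrite /N; measurability.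
have mY : measurable_fun setT Y by rewrite /Y; measurability.
have EN j : (\int[P]_w (expR (N j w))%:E <= (2 ^+ #|A|)%:E)%E.
  have -> : (\int[P]_w (expR (N j w))%:E =
      \int[P]_w (\prod_(a : A) expR (W (a, j) w ^+ 2 / K ^+ 2))%:E)%E.
    apply: eq_integral => w _; rewrite -expR_sum /N mulr_suml //.
  rewrite (ge0_expectation_prod_comp (W := fun a => W (a, j))
    (h := fun a x => expR (x ^+ 2 / K ^+ 2)))//; last 2 first.
  - by move=> a; measurability.
  - by apply: mutually_independent_inj => // a b [].
  rewrite -prodr_const -EFin_prod; apply: lee_prod => a.
    by apply: integral_ge0 => w _; rewrite lee_fin expR_ge0.
  exact: sg_psi2 (sgW (a, j)).
have EY : (\int[P]_w (expR (Y w))%:E <= (2 ^+ #|A|)%:E)%E.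
  apply: (@le_trans _ _ (\int[P]_w (\sum_j be j * expR (N j w))%:E)%E).
    apply: ge0_le_integralr => //; try by measurability.
    by move=> w; exact: expR_jensen.
  under eq_integral do rewrite -sumEFin.
  rewrite ge0_integral_sum//; last 2 first.
  - by move=> j; measurability.
  - by move=> j w _; rewrite lee_fin mulr_ge0// expR_ge0.
  apply: (@le_trans _ _ (\sum_j (be j)%:E * (2 ^+ #|A|)%:E)%E); last first.
    rewrite -ge0_sume_distrl; first by rewrite sumEFin be1 mul1e.
    by move=> j _; rewrite lee_fin.
  apply: lee_sum => j _; rewrite ge0_integralZlr//; last by measurability.
  by apply: lee_wpmul2l; rewrite ?lee_fin.
pose Y' : {RV P >-> R} := HB.pack Y (isMeasurableFun.Build _ _ _ _ _ mY).
apply: (@le_trans _ _ (P [set w | (2 * n <= Y' w)%R])).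
  apply: le_measure; rewrite ?inE.
  - rewrite (_ : mkset _ = (fun w => \sum_j al j * \sum_a W (a, j) w ^+ 2) @^-1`
      `]2 * K ^+ 2 * n * S, +oo[%classic); last first.
      by apply/seteqP; split => w /=; rewrite in_itv/= andbT.
    by rewrite -[X in measurable X]setTI; apply: measurable_sum => // j; measurability.
  - rewrite (_ : mkset _ = Y @^-1` `[2 * n, +oo[%classic); last first.
      by apply/seteqP; split => w /=; rewrite in_itv/= andbT.
    by rewrite -[X in measurable X]setTI; apply: (@measurable_funPT _ _ _ _ Y').
  - move=> w /= H.
    have -> : Y w = (\sum_j al j * \sum_a W (a, j) w ^+ 2) / (S * K ^+ 2).
      rewrite /Y mulr_suml; apply: eq_bigr => j _; rewrite /be /N.
      by field; rewrite !gt_eqF.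
    rewrite ler_pdivlMr ?mulr_gt0//; apply: le_trans (ltW H).
    by rewrite le_eqVlt; apply/orP; left; apply/eqP; ring.
apply: le_trans (chernoff Y' (2 * n) ltr01) _.
rewrite /mmt_gen_fun unlock.
have -> : (\int[P]_w ((expR \o 1 \o* Y') w)%:E = \int[P]_w (expR (Y w))%:E)%E.
  by apply: eq_integral => w _; rewrite /= mulr1.
apply: (@le_trans _ _ ((2 ^+ #|A|)%:E * (expR (- (1 * (2 * n))))%:E)%E).
  by apply: lee_wpmul2r => //; rewrite lee_fin expR_ge0.
rewrite -EFinM lee_fin.
apply: (@le_trans _ _ (expR n * expR (- (1 * (2 * n))))).
  apply: ler_wpM2r; first exact: expR_ge0.
  have -> : expR n = expR 1 ^+ #|A| by rewrite -expRM_natl mulr1.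
  by apply: lerXn2r; rewrite ?nnegrE ?expR_ge0//; exact: expR_ge2.
by rewrite -expRD ler_expR; lra.
Qed.

End WeightedNorms.

(** * Residuals of regularized least squares *)

Section Dot.
Context (R : realType) (n : nat).
Implicit Types u v w : 'cV[R]_n.

Definition dot u v : R := \sum_a u a 0 * v a 0.

Lemma dotC u v : dot u v = dot v u.
Proof. by apply: eq_bigr => a _; rewrite mulrC. Qed.

Lemma dotDl u v w : dot (u + v) w = dot u w + dot v w.
Proof. by rewrite -big_split/=; apply: eq_bigr => a _; rewrite mxE mulrDl. Qed.

Lemma dotZl c u w : dot (c *: u) w = c * dot u w.
Proof. by rewrite mulr_sumr; apply: eq_bigr => a _; rewrite mxE mulrA. Qed.

Lemma dotDr u v w : dot w (u + v) = dot w u + dot w v.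
Proof. by rewrite !(dotC w) dotDl. Qed.

Lemma dotZr c u w : dot w (c *: u) = c * dot w u.
Proof. by rewrite !(dotC w) dotZl. Qed.

Lemma dotNl u w : dot (- u) w = - dot u w.
Proof. by rewrite -scaleN1r dotZl mulN1r. Qed.

Lemma dotNr u w : dot w (- u) = - dot w u.
Proof. by rewrite !(dotC w) dotNl. Qed.

Lemma dot_suml (I : finType) (D : pred I) (F : I -> 'cV[R]_n) w :
  dot (\sum_(i | D i) F i) w = \sum_(i | D i) dot (F i) w.
Proof.
rewrite /dot exchange_big/=; apply: eq_bigr => a _.
by rewrite summxE mulr_suml.
Qed.

Lemma dot_ge0 u : 0 <= dot u u.
Proof. by apply: sumr_ge0 => a _; rewrite -expr2 sqr_ge0. Qed.

Lemma dot_eq0 u : dot u u = 0 -> u = 0.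
Proof.
move=> u0; apply/matrixP => a b; rewrite ord1 mxE; apply/eqP.
rewrite -sqrf_eq0 eq_le sqr_ge0 andbT -u0 /dot (bigD1 a)//= -expr2 lerDl.
by apply: sumr_ge0 => c _; rewrite -expr2 sqr_ge0.
Qed.

Lemma dot_cauchy_schwarz u v : dot u v ^+ 2 <= dot u u * dot v v.
Proof.
have := sum_cauchy_schwarz (fun a => u a 0) (fun a => v a 0).
by rewrite /dot; under [X in _ <= X * _ -> _]eq_bigr do rewrite expr2;
  under [X in _ <= _ * X -> _]eq_bigr do rewrite expr2.
Qed.

Lemma dot_amgm u v (c : R) : 0 < c -> dot u v <= dot u u / (2 * c) + c / 2 * dot v v.
Proof.
move=> c0; have := dot_ge0 (u - c *: v).
rewrite dotDl !dotDr !dotNl !dotNr !dotZl !dotZr (dotC v u) => H.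
have -> : dot u u / (2 * c) + c / 2 * dot v v = (dot u u + c ^+ 2 * dot v v) / (2 * c).
  by field; rewrite gt_eqF.
rewrite ler_pdivlMr ?mulr_gt0//; nra.
Qed.

Section Forms.
Context (p : nat) (x : 'I_p -> 'cV[R]_n).

(** The bilinear form of the matrix l + sum of the x_i x_i^T over [D]. *)
Definition form (l : R) (D : pred 'I_p) u v : R :=
  l * dot u v + \sum_(i | D i) dot (x i) u * dot (x i) v.

Lemma form_comb l D u v c :
  form l D (u - c *: v) (u - c *: v) =
  form l D u u - 2 * c * form l D u v + c ^+ 2 * form l D v v.
Proof.
rewrite /form dotDl !dotDr !dotNl !dotNr !dotZl !dotZr (dotC v u).
rewrite (_ : \sum_(i | D i) _ = \sum_(i | D i) dot (x i) u * dot (x i) u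
  - 2 * c * (\sum_(i | D i) dot (x i) u * dot (x i) v)
  + c ^+ 2 * (\sum_(i | D i) dot (x i) v * dot (x i) v)); first by ring.
rewrite !mulr_sumr -sumrB -big_split/=; apply: eq_bigr => i _.
by rewrite dotDr dotNr dotZr; ring.
Qed.

(** The square of a nonnegative matrix B <= ub is at most ub B; here g = B y.
    Test the positivity of the form at y - g / ub. *)
Lemma form_representer l D ub y g :
  0 < ub -> (forall v, 0 <= form l D v v <= ub * dot v v) ->
  (forall u, form l D y u = dot g u) -> dot g g <= ub * form l D y y.
Proof.
move=> ub0 H yg.
have := (andP (H (y - ub^-1 *: g))).1; rewrite form_comb (yg g) => h1.
have /andP[_ h2] := H g.
have h3 : ub^-1 ^+ 2 * form l D g g <= ub^-1 * dot g g.
  by rewrite expr2 -mulrA ler_pM2l ?invr_gt0// ler_pdivrMl.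
have h4 : ub^-1 * dot g g <= form l D y y by lra.
by rewrite ler_pdivrMl in h4.
Qed.

Context (lam : 'I_p -> R) (head : pred 'I_p).
Hypothesis lam0 : forall i, 0 < lam i.

(** The indices are split into a head and a tail.  On the tail the form behaves
    like a multiple of the identity, between [am] and [ap]; the columns of the
    head are well conditioned with constant [N0]; [y] is the regularized solution
    for column [j]. *)
Section Solution.
Context (l N0 am ap : R) (j : 'I_p) (y : 'cV[R]_n).
Hypothesis ysol : forall u, form l xpredT y u = dot (x j) u.
Notation tail := (fun i => ~~ head i).
Hypothesis am0 : 0 < am.
Hypothesis tailP : forall v, am * dot v v <= form l tail v v <= ap * dot v v.
Hypothesis ap0 : 0 < ap.
Hypothesis N00 : 0 < N0.
Hypothesis headP : forall c : 'I_p -> R,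
  N0 * \sum_(i | head i) lam i * c i ^+ 2 <=
  dot (\sum_(i | head i) c i *: x i) (\sum_(i | head i) c i *: x i).

(** For y = A^-1 x_j, coordinate i of e_j - X^T A^-1 x_j. *)
Definition residual (i : 'I_p) : R := (i == j)%:R - dot (x i) y.

Let tail_psd v : 0 <= form l tail v v <= ap * dot v v.
Proof.
case/andP: (tailP v) => h1 ->; rewrite andbT; apply: le_trans h1.
by rewrite mulr_ge0 ?dot_ge0// ltW.
Qed.

Let form_split u : form l tail y u = dot (x j) u - \sum_(i | head i) dot (x i) y * dot (x i) u.
Proof.
by rewrite -ysol /form [in RHS](bigID head)/=; ring.
Qed.

(** Moving the head to the right-hand side, the tail form of y is represented
    by g, the sum over the head of the r_i x_i, where r is the residual.  Then
    form y y = dot g y = r_j - sum r_i^2 <= r_j, while |g|^2 <= ap * form y y by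
    [form_representer] and |g|^2 >= N0 * sum lam_i r_i^2 by hypothesis. *)
Lemma head_solution : head j ->
  \sum_(i | head i) lam i * residual i ^+ 2 <= (ap / N0) ^+ 2 / lam j /\
  dot y y <= ap / (am * N0 * lam j).
Proof.
move=> hj; set g := \sum_(i | head i) residual i *: x i.
have gP u : form l tail y u = dot g u.
  rewrite form_split dot_suml.
  rewrite [RHS](eq_bigr (fun i => (i == j)%:R * dot (x i) u - dot (x i) y * dot (x i) u)).
    rewrite sumrB; congr (_ - _).
    rewrite (bigD1 j)//= eqxx mul1r big1 ?addr0// => i /andP[_ /negbTE ->].
    by rewrite mul0r.
  by move=> i _; rewrite dotZl mulrBl.
have gg := form_representer ap0 tail_psd gP.
set e := form l tail y y in gg.
have eE : e = residual j - \sum_(i | head i) residual i ^+ 2.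
  rewrite /e gP dot_suml.
  rewrite (eq_bigr (fun i => (i == j)%:R * residual i - residual i ^+ 2)).
    rewrite sumrB; congr (_ - _).
    rewrite (bigD1 j)//= eqxx mul1r big1 ?addr0// => i /andP[_ /negbTE ->].
    by rewrite mul0r.
  by move=> i _; rewrite dotZl /residual; ring.
have e0 : 0 <= e by case/andP: (tail_psd y).
have r0 : 0 <= \sum_(i | head i) residual i ^+ 2 by apply: sumr_ge0 => i _; exact: sqr_ge0.
have ec : e <= residual j by lra.
have Hc := headP residual; rewrite -/g in Hc.
set Hw := \sum_(i | head i) _ in Hc *.
have Hw_j : lam j * residual j ^+ 2 <= Hw.
  rewrite /Hw (bigD1 j)//= lerDl; apply: sumr_ge0 => i _.
  by apply: mulr_ge0; [exact/ltW|exact: sqr_ge0].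
have c0 : 0 <= residual j by exact: le_trans ec.
have h1 : N0 * Hw <= ap * residual j.
  apply: le_trans Hc (le_trans gg _); by rewrite ler_pM2l.
have cj : residual j <= ap / (N0 * lam j).
  rewrite ler_pdivlMr ?mulr_gt0//.
  have [->|cn0] := eqVneq (residual j) 0; first by rewrite mul0r ltW.
  have cp : 0 < residual j by rewrite lt0r cn0.
  have : N0 * (lam j * residual j ^+ 2) <= ap * residual j.
    by apply: le_trans h1; rewrite ler_pM2l.
  rewrite (_ : N0 * _ = (residual j * (N0 * lam j)) * residual j); last by ring.
  by rewrite ler_pM2r.
split.
  have : Hw <= ap * residual j / N0 by rewrite ler_pdivlMr// mulrC.
  move/le_trans; apply.
  rewrite (_ : (ap / N0) ^+ 2 / lam j = ap * (ap / (N0 * lam j)) / N0); last first.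
    by field; rewrite !gt_eqF.
  by rewrite ler_pM2r ?invr_gt0// ler_pM2l.
have := (andP (tailP y)).1; rewrite -/e => h.
rewrite (_ : ap / (am * N0 * lam j) = ap / (N0 * lam j) / am); last first.
  by field; rewrite !gt_eqF.
by rewrite ler_pdivlMr// mulrC (le_trans h)// (le_trans ec).
Qed.

(** As in [head_solution], but now g = x_j + h with h the sum over the head of
    the r_i x_i, and dot h y = - sum r_i^2 <= 0, so that form y y <= dot x_j y. *)
Lemma tail_solution : ~~ head j ->
  N0 * (\sum_(i | head i) lam i * residual i ^+ 2) <= 2 * (ap / am + 1) * dot (x j) (x j) /\
  dot y y <= dot (x j) (x j) / am ^+ 2.
Proof.
move=> hj; set h := \sum_(i | head i) residual i *: x i.
have rE i : head i -> residual i = - dot (x i) y.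
  by move=> hi; rewrite /residual; case: eqP hi hj => [->->//|]; rewrite sub0r.
have gP u : form l tail y u = dot (x j + h) u.
  rewrite form_split dotDl dot_suml; congr (_ + _); rewrite -sumrN.
  by apply: eq_bigr => i hi; rewrite dotZl rE// mulNr.
have gg := form_representer ap0 tail_psd gP.
set e := form l tail y y in gg.
have hy : dot h y <= 0.
  rewrite dot_suml; apply: sumr_le0 => i hi; rewrite dotZl rE// mulNr oppr_le0.
  by rewrite -expr2 sqr_ge0.
have e1 : e <= dot (x j) y by rewrite /e gP dotDl gerDl.
have e2 := (andP (tailP y)).1; rewrite -/e in e2.
have am1 := dot_amgm (x j) y am0.
have y2 : dot y y <= dot (x j) (x j) / am ^+ 2.
  have : am / 2 * dot y y <= dot (x j) (x j) / (2 * am) by lra.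
  rewrite ler_pdivlMr ?mulr_gt0// ler_pdivlMr ?exprn_gt0//.
  by rewrite (_ : _ * (2 * am) = dot y y * am ^+ 2)//; field.
split => //.
have e3 : e <= dot (x j) (x j) / am.
  have : am / 2 * dot y y <= dot (x j) (x j) / (2 * am).
    have -> : dot (x j) (x j) / (2 * am) = am / 2 * (dot (x j) (x j) / am ^+ 2).
      by field; rewrite gt_eqF.
    by rewrite ler_pM2l ?divr_gt0.
  have -> : dot (x j) (x j) / am = dot (x j) (x j) / (2 * am) + dot (x j) (x j) / (2 * am).
    by field; rewrite gt_eqF.
  lra.
apply: le_trans (headP residual) _; rewrite -/h.
have := dot_ge0 (x j + (x j + h)); rewrite dotDl !dotDr !dotDl (dotC (x j) h) => h3.
rewrite dotDl !dotDr (dotC (x j) h) in gg.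
have e4 : ap * e <= ap * (dot (x j) (x j) / am) by rewrite ler_pM2l.
lra.
Qed.

End Solution.

(** Leaving column j out, the residual is 1 / (1 + x_j . A_j^-1 x_j) where the
    matrix A_j is at least [a].  With b the residual, the inequality follows
    from a |y|^2 <= b (1 - b) and (1 - b)^2 <= |x_j|^2 |y|^2. *)
Lemma residual_lower_bound (l a : R) (j : 'I_p) (y : 'cV[R]_n) :
  head j -> 0 < a ->
  (forall v, a * dot v v <= form l (fun i => ~~ head i) v v) ->
  (forall u, form l xpredT y u = dot (x j) u) ->
  a / (a + dot (x j) (x j)) <= residual j y j.
Proof.
move=> hj a0 aP ysol; set b := residual j y j; set N := dot (x j) (x j).
have xy : dot (x j) y = 1 - b by rewrite /b /residual eqxx /=; ring.
have N0 : 0 <= N by exact: dot_ge0.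
have h1 : a * dot y y <= b * (1 - b).
  apply: le_trans (aP y) _.
  have := ysol y; rewrite {1}/form (bigID head)/= (bigD1 j)//= xy => H.
  have : 0 <= \sum_(i | head i && (i != j)) dot (x i) y * dot (x i) y.
    by apply: sumr_ge0 => i _; rewrite -expr2 sqr_ge0.
  rewrite /form; nra.
have h2 := dot_cauchy_schwarz (x j) y; rewrite xy -/N in h2.
have y0 := dot_ge0 y.
have bb : 0 <= b * (1 - b) by apply: le_trans h1; rewrite mulr_ge0// ltW.
have b01 : 0 <= b <= 1 by apply/andP; split; nra.
case/andP: b01 => b0 b1.
rewrite ler_pdivrMr ?ltr_wpDr//.
have [->|bn] := eqVneq b 1; first by rewrite mul1r lerDl.
have b1' : 0 < 1 - b by rewrite subr_gt0 lt_neqAle bn.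
have : a * (1 - b) ^+ 2 <= N * (b * (1 - b)).
  apply: (@le_trans _ _ (a * (N * dot y y))); first by rewrite ler_pM2l.
  by rewrite mulrCA ler_wpM2l.
rewrite (_ : a * _ = (a * (1 - b)) * (1 - b)); last by ring.
rewrite mulrA ler_pM2r//; lra.
Qed.

End Forms.

End Dot.

(** * The smallest eigenvalue of a symmetric matrix *)

Section SmallestEigenvalue.
Context (R : realType) (n : nat).
Implicit Types (M B : 'M[R]_n) (u v : 'cV[R]_n).

Lemma dotE u v : dot u v = (u^T *m v) 0 0.
Proof. by rewrite mxE; apply: eq_bigr => a _; rewrite mxE. Qed.

Lemma dot_mulmx_sym M u v : M^T = M -> dot (M *m u) v = dot u (M *m v).
Proof. by move=> Msym; rewrite !dotE trmx_mul Msym mulmxA. Qed.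

Lemma mulmx_bounded M :
  exists2 c : R, 0 < c & forall v, dot (M *m v) (M *m v) <= c * dot v v.
Proof.
exists (1 + \sum_a \sum_b M a b ^+ 2).
  rewrite ltr_pwDl//; apply: sumr_ge0 => a _; apply: sumr_ge0 => b _; exact: sqr_ge0.
move=> v; rewrite mulrDl mul1r.
have : dot (M *m v) (M *m v) <= (\sum_a \sum_b M a b ^+ 2) * dot v v.
  rewrite mulr_suml; apply: ler_sum => a _; rewrite -expr2 mxE.
  apply: le_trans (sum_cauchy_schwarz (fun b => M a b) (fun b => v b 0)) _.
  by rewrite /dot; under [X in _ <= _ * X]eq_bigr do rewrite -expr2.
by have := dot_ge0 v; lra.
Qed.

Lemma unitmxPn B : B \in unitmx \/ exists2 v : 'rV[R]_n, v != 0 & v *m B = 0.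
Proof.
have [Bu|Bn] := boolP (B \in unitmx); first by left.
right; move: Bn; rewrite -row_free_unit -kermx_eq0 => /rowV0Pn[v /sub_kermxP vB v0].
by exists v.
Qed.

(** The infimum mu of the Rayleigh quotient is an eigenvalue: otherwise M - mu
    is invertible and nonnegative, hence at least a positive multiple of the
    identity, and mu is not the infimum. *)
Lemma symmetric_eigenvalue_exists M m : (0 < n)%N -> M^T = M ->
  (forall v, m * dot v v <= dot v (M *m v)) -> exists a, eigenvalue M a.
Proof.
move=> n0 Msym Mm.
pose V := [set dot v (M *m v) | v in [set v | dot v v = 1]].
have V0 : V !=set0.
  pose e : 'cV[R]_n := delta_mx (Ordinal n0) 0.
  exists (dot e (M *m e)); exists e => //=.
  rewrite /dot (bigD1 (Ordinal n0))//= !mxE !eqxx/= mulr1 big1 ?addr0// => a an.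
  by rewrite !mxE (negbTE an) mul0r.
have Vlb : lbound V m.
  by move=> _ [v v1 <-]; have := Mm v; rewrite v1 mulr1.
have hV : has_inf V by split => //; exists m.
pose mu := inf V; pose B := M - mu%:M.
have Bsym : B^T = B by rewrite /B linearB/= Msym tr_scalar_mx.
have BE v : dot v (B *m v) = dot v (M *m v) - mu * dot v v.
  by rewrite mulmxBl mul_scalar_mx dotDr dotNr dotZr.
have normalize v : dot v v != 0 -> exists2 u, dot u u = 1 &
    dot v (B *m v) = dot v v * dot u (B *m u).
  move=> v0; have vp : 0 < dot v v by rewrite lt0r v0 dot_ge0.
  have s2 : (Num.sqrt (dot v v))^-1 ^+ 2 = (dot v v)^-1 by rewrite exprVn sqr_sqrtr// ltW.
  exists ((Num.sqrt (dot v v))^-1 *: v).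
    by rewrite dotZl dotZr mulrA -expr2 s2 mulVf.
  by rewrite -scalemxAr dotZl dotZr [X in _ * X]mulrA -expr2 s2 mulrA divff// mul1r.
have B0 v : 0 <= dot v (B *m v).
  have [v0|v0] := eqVneq (dot v v) 0.
    by rewrite (dot_eq0 v0) mulmx0 /dot big1// => a _; rewrite mxE mul0r.
  have [u u1 ->] := normalize v v0; rewrite mulr_ge0 ?dot_ge0// BE u1 mulr1 subr_ge0.
  by apply: ge_inf; [exact: hV.2|exists u].
exists mu; have [Bu|[v v0 vB]] := unitmxPn B; last first.
  by apply/eigenvalueP; exists v => //; move: vB; rewrite mulmxBr mul_mx_scalar => /subr0_eq.
exfalso.
have [c1 c10 H1] := mulmx_bounded (invmx B).
have [c2 c20 H2] := mulmx_bounded B.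
have key v : dot v v <= c1 * ((c2 + 1) * dot v (B *m v)).
  apply: (@le_trans _ _ (c1 * dot (B *m v) (B *m v))).
    by have := H1 (B *m v); rewrite mulmxA mulVmx// mul1mx.
  rewrite ler_pM2l//; set g := B *m v.
  have c30 : 0 < c2 + 1 by rewrite addr_gt0.
  have gBg : dot g (B *m g) <= (c2 + 1) * dot g g.
    have := dot_amgm g (B *m g) ltr01; have := H2 g; have := dot_ge0 g.
    rewrite mulr1 => p1 p2 p3; have : 0 <= c2 * dot g g by rewrite mulr_ge0// ltW.
    lra.
  pose s := (c2 + 1)^-1; have s0 : 0 < s by rewrite invr_gt0.
  have := B0 (v - s *: g); rewrite mulmxBr -scalemxAr -/g.
  rewrite dotDl !dotDr !dotNl !dotNr !dotZl !dotZr.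
  rewrite -(dot_mulmx_sym v g Bsym) -/g => h.
  have h3 : s * dot g (B *m g) <= dot g g.
    by rewrite /s ler_pdivrMl.
  have h4 : s * (s * dot g (B *m g)) <= s * dot g g by rewrite ler_pM2l.
  have : s * dot g g <= dot v g by lra.
  by rewrite /s ler_pdivrMl.
pose del := (c1 * (c2 + 1))^-1.
have del0 : 0 < del by rewrite invr_gt0 mulr_gt0// addr_gt0.
have [_ [u u1 <-] ulow] := inf_adherent del0 hV.
have := key u; rewrite u1 mulrA -ler_pdivrMl ?mulr_gt0 ?addr_gt0//.
rewrite mulr1 BE u1 mulr1 -/del -/mu leNgt => /negP; apply.
by rewrite ltrBlDl.
Qed.

(** The infimum over the spectrum would be 0 if the spectrum were empty, hence
    the need for an eigenvalue. *)
Lemma smallest_eigenvalue_ge M m : (0 < n)%N -> M^T = M ->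
  (forall v, m * dot v v <= dot v (M *m v)) -> m <= smallest_eigenvalue M.
Proof.
move=> n0 Msym Mm; apply: lb_le_inf.
  by have [a Ma] := symmetric_eigenvalue_exists n0 Msym Mm; exists a.
move=> a /eigenvalueP[v vM v0].
have := Mm v^T; rewrite -(dot_mulmx_sym _ _ Msym).
rewrite (_ : M *m v^T = a *: v^T); last first.
  by rewrite -[in LHS]Msym -trmx_mul vM linearZ.
rewrite dotZl ler_pM2r// lt0r dot_ge0 andbT; apply/eqP => /dot_eq0 vT0.
by move/eqP: v0; apply; rewrite -[v]trmxK vT0 trmx0.
Qed.

End SmallestEigenvalue.

(** * Bias and variance in terms of residuals *)

Section RandomSigns.
Context d (T : measurableType d) (R : realType) (P : probability T R).

(** The square of a sign is 1, and exp (1 / 4) <= 2. *)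
Lemma random_sign_std_subgaussian p (flip : {RV P >-> p.-tuple bool}) (j : 'I_p) :
  P [set w | tnth (flip w) j] = (2^-1)%:E ->
  std_subgaussian P 2 (fun w => (-1) ^+ tnth (flip w) j : R).
Proof.
move=> Phalf; set A := [set w | tnth (flip w) j] in Phalf.
have mflip : measurable_fun setT (fun w => tnth (flip w) j).
  apply: (measurableT_comp (measurable_tnth j)) => //.
have mA : measurable A.
  rewrite (_ : A = (fun w => tnth (flip w) j) @^-1` [set true]); last first.
    by apply/seteqP; split => w.
  by rewrite -[X in measurable X]setTI; exact: mflip.
have sE w : (-1) ^+ tnth (flip w) j = 1 + (- 2) * \1_A w :> R.
  rewrite indicE /A; case E : (tnth (flip w) j).
    by rewrite mem_set//= expr1 mulr1; ring.
  by rewrite memNset/= ?E// mulr0 addr0.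
have s2 w : ((-1) ^+ tnth (flip w) j : R) ^+ 2 = 1.
  by rewrite -exprM mulnC exprM sqrrN !expr1n.
have m1 : measurable_fun setT (\1_A : T -> R) by exact: measurable_indic.
have i1 : P.-integrable setT (fun w => (\1_A w : R)%:E).
  exact: integrable_indic.
split.
- rewrite (_ : (fun w => _) = (fun w => 1 + (- 2) * \1_A w)); last exact/funext.
  by measurability.
- under eq_integral do rewrite sE EFinD EFinM.
  rewrite integralD//; last 2 first.
  + exact: finite_measure_integrable_cst.
  + exact: integrableZl.
  rewrite integralZl// integral_indic// setIT integral_cst//= probability_setT mule1.
  by rewrite Phalf -EFinM -EFinD; congr EFin; rewrite mulNr divff// subrr.
- by under eq_integral do rewrite s2; rewrite integral_cst//= probability_setT mule1.
- under eq_integral do rewrite s2.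
  rewrite integral_cst//= probability_setT mule1 lee_fin.
  apply: le_trans (expR_half_le2 R); rewrite ler_expR; lra.
Qed.

Lemma random_signs_independent p (flip : {RV P >-> p.-tuple bool}) :
  mutually_independent P (fun (j : 'I_p) w => tnth (flip w) j) ->
  mutually_independent P (fun (j : 'I_p) w => (-1) ^+ tnth (flip w) j : R).
Proof.
move=> ind B mB; exact: (ind (fun j => (fun b : bool => (-1) ^+ b : R) @^-1` B j)).
Qed.

End RandomSigns.

Section Formulas.
Context (R : realType).

Lemma wnorm_diag m (D : 'rV[R]_m) (v : 'cV[R]_m) : (forall i, 0 <= D 0 i) ->
  wnorm (diag_mx D) v ^+ 2 = \sum_i D 0 i * v i 0 ^+ 2.
Proof.
move=> D0.
have E : (v^T *m diag_mx D *m v) 0 0 = \sum_i D 0 i * v i 0 ^+ 2.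
  rewrite mxE; apply: eq_bigr => i _; rewrite mul_mx_diag !mxE; ring.
rewrite /wnorm sqr_sqrtr E//; apply: sumr_ge0 => i _.
by rewrite mulr_ge0// sqr_ge0.
Qed.

Lemma sum_head_tail p (k : 'I_p) (F : 'I_p -> R) :
  \sum_(i : 'I_k) F (head_ord i) = \sum_(i < p | (i < k)%N) F i /\
  \sum_(i : 'I_(p - k)) F (tail_ord i) = \sum_(i < p | (k <= i)%N) F i.
Proof.
have E := subnKC (ltnW (ltn_ord k)).
have splitG (G : 'I_p -> R) : \sum_i G i =
    \sum_(i < k) G (head_ord i) + \sum_(i < p - k) G (tail_ord i).
  rewrite (reindex (cast_ord E))/=; last first.
    by exists (cast_ord (esym E)) => i _; rewrite ?cast_ordK ?cast_ordKV.
  rewrite big_split_ord/=; congr (_ + _); apply: eq_bigr => i _; congr G; exact: val_inj.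
split; rewrite [RHS]big_mkcond splitG/=.
  rewrite [X in _ + X]big1 ?addr0; first by apply: eq_bigr => i _; rewrite ltn_ord.
  by move=> i _; rewrite ltnNge leq_addr.
rewrite [X in X + _]big1 ?add0r; first by apply: eq_bigr => i _; rewrite leq_addr.
by move=> i _; rewrite leqNgt ltn_ord.
Qed.

Lemma head_wnorm p (lam : 'rV[R]_p) (k : 'I_p) (th : 'cV[R]_p) :
  (forall i, 0 < lam 0 i) ->
  wnorm (invmx (head_mx k (Sigma lam))) (head_vec k th) ^+ 2 =
  \sum_(i < p | (i < k)%N) th i 0 ^+ 2 / lam 0 i.
Proof.
move=> lam0; pose D : 'rV[R]_k := \row_i lam 0 (head_ord i).
pose D' : 'rV[R]_k := \row_i (lam 0 (head_ord i))^-1.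
have head_inj : injective (@head_ord p k).
  by move=> i j /(congr1 val) /= ij; exact: val_inj.
have HD : head_mx k (Sigma lam) = diag_mx D.
  by apply/matrixP => i j; rewrite !mxE (inj_eq head_inj).
have DD' : diag_mx D *m diag_mx D' = 1%:M.
  rewrite mulmx_diag; apply/matrixP => i j; rewrite !mxE divff//.
  by rewrite gt_eqF.
have -> : invmx (head_mx k (Sigma lam)) = diag_mx D'.
  rewrite HD; have [Du _] := mulmx1_unit DD'.
  by rewrite -[LHS]mulmx1 -DD' mulmxA mulVmx// mul1mx.
rewrite wnorm_diag; last by move=> i; rewrite mxE invr_ge0 ltW.
rewrite -(sum_head_tail k _).1; apply: eq_bigr => i _; rewrite !mxE mulrC //.
Qed.

Lemma tail_wnorm p (lam : 'rV[R]_p) (k : 'I_p) (th : 'cV[R]_p) :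
  (forall i, 0 < lam 0 i) ->
  wnorm (tail_mx k (Sigma lam)) (tail_vec k th) ^+ 2 =
  \sum_(i < p | (k <= i)%N) lam 0 i * th i 0 ^+ 2.
Proof.
move=> lam0; pose D : 'rV[R]_(p - k) := \row_i lam 0 (tail_ord i).
have tail_inj : injective (@tail_ord p k).
  by move=> i j /(congr1 val) /= /addnI ij; exact: val_inj.
have -> : tail_mx k (Sigma lam) = diag_mx D.
  by apply/matrixP => i j; rewrite !mxE (inj_eq tail_inj).
rewrite wnorm_diag; last by move=> i; rewrite mxE ltW.
by rewrite -(sum_head_tail k _).2; apply: eq_bigr => i _; rewrite !mxE.
Qed.

Section Ridge.
Context (n p : nat) (X : 'M[R]_(n, p)) (lam : 'rV[R]_p).
Hypothesis lam0 : forall i, 0 < lam 0 i.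

Definition ridge_sol (l : R) (j : 'I_p) : 'cV[R]_n := invmx (ridge_mx X l) *m col j X.

Notation cols := (fun i => col i X).

Definition coord_bias (l : R) (j : 'I_p) : R :=
  \sum_i lam 0 i * residual cols j (ridge_sol l j) i ^+ 2.

Lemma mulmx_colE m (A : 'M[R]_(m, n)) a j : (A *m col j X) a 0 = (A *m X) a j.
Proof. by rewrite !mxE; apply: eq_bigr => b _; rewrite mxE. Qed.

Lemma ridge_mx_form l u v :
  dot (ridge_mx X l *m u) v = form cols l xpredT u v.
Proof.
rewrite /ridge_mx mulmxDl mul_scalar_mx dotDl dotZl /form; congr (_ + _).
have colE i w : dot (col i X) w = (X^T *m w) i 0.
  by rewrite mxE; apply: eq_bigr => a _; rewrite !mxE.
rewrite -mulmxA dotE trmx_mul -mulmxA mxE.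
by apply: eq_bigr => i _; rewrite !colE mxE.
Qed.

Lemma ridge_mx_sym l : (ridge_mx X l)^T = ridge_mx X l.
Proof. by rewrite /ridge_mx linearD/= tr_scalar_mx trmx_mul trmxK. Qed.

Lemma ridge_sol_form l (a : R) j : 0 < a ->
  (forall v, a * dot v v <= form cols l xpredT v v) ->
  forall u, form cols l xpredT (ridge_sol l j) u = dot (col j X) u.
Proof.
move=> a0 aP u; have [Au|[v v0 vA]] := unitmxPn (ridge_mx X l).
  by rewrite -ridge_mx_form /ridge_sol mulmxA mulmxV// mul1mx.
have Av : ridge_mx X l *m v^T = 0.
  by rewrite -[LHS]trmxK trmx_mul trmxK ridge_mx_sym vA trmx0.
have := aP v^T; rewrite -ridge_mx_form Av.
rewrite (_ : dot 0 v^T = 0); last by rewrite /dot big1// => b _; rewrite mxE mul0r.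
rewrite pmulr_rle0// => vv; have /dot_eq0 vT0 : dot v^T v^T = 0.
  by apply/eqP; rewrite eq_le vv dot_ge0.
by move/eqP: v0; case; rewrite -[v]trmxK vT0 trmx0.
Qed.

Lemma bias_formula l (th : 'cV[R]_p) :
  bias lam X th l =
  \sum_i lam 0 i * (\sum_j residual cols j (ridge_sol l j) i * th j 0) ^+ 2.
Proof.
rewrite /bias wnorm_diag; last by move=> i; exact: ltW.
apply: eq_bigr => i _; congr (_ * _ ^+ 2).
rewrite mxE; apply: eq_bigr => j _; congr (_ * _).
have XAX : (X^T *m invmx (ridge_mx X l) *m X) i j = dot (col i X) (ridge_sol l j).
  rewrite -mulmxA mxE /dot; apply: eq_bigr => a _.
  by rewrite /ridge_sol mulmx_colE; congr (_ * _); rewrite !mxE.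
by rewrite mxE [X in _ + X]mxE XAX mxE.
Qed.

Lemma var_formula l :
  var lam X l = \sum_i lam 0 i * dot (ridge_sol l i) (ridge_sol l i).
Proof.
rewrite /var; set Ai := invmx (ridge_mx X l).
have Aisym : Ai^T = Ai by rewrite /Ai trmx_inv ridge_mx_sym.
have -> : Ai *m X *m Sigma lam *m X^T *m Ai = (Ai *m X *m Sigma lam) *m (Ai *m X)^T.
  by rewrite trmx_mul Aisym !mulmxA.
rewrite /mxtrace; under eq_bigr do rewrite mxE.
rewrite exchange_big/=; apply: eq_bigr => i _.
rewrite /dot mulr_sumr; apply: eq_bigr => a _.
by rewrite mul_mx_diag !mulmx_colE [X in X * _]mxE [X in _ * X]mxE; ring.
Qed.

End Ridge.
End Formulas.

(** * The risk averaged over signs and its minimizers *)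

Section MeanRisk.
Context (R : realType).

(** The value of [mean_risk] (see [mean_risk_formula]): each column enters with
    the square of its own signal only. *)
Definition averaged_risk n p (X : 'M[R]_(n, p)) (lam : 'rV[R]_p) (veps : R)
    (thb : 'cV[R]_p) (l : R) : R :=
  \sum_j thb j 0 ^+ 2 * coord_bias X lam l j +
  veps ^+ 2 * \sum_i lam 0 i * dot (ridge_sol X l i) (ridge_sol X l i).

(** Distinct random signs are uncorrelated, so the cross terms between columns
    vanish; this is [linear_form_var] for the family of signs. *)
Lemma mean_risk_formula d (T : measurableType d) (P : probability T R) n p
    (X : {RV P >-> n.-tuple (p.-tuple R)}) (lam : 'rV[R]_p) (veps : R)
    (thb : 'cV[R]_p) (theta : {RV P >-> p.-tuple R}) w l :
  (forall i, 0 < lam 0 i) -> random_sign_flip theta thb ->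
  mean_risk X lam veps theta w l = averaged_risk (mx_of_rows (X w)) lam veps thb l.
Proof.
move=> lam0 [flip [ind half thE]].
set Xm := mx_of_rows (X w); rewrite /mean_risk /averaged_risk -/Xm var_formula.
congr (_ + _).
pose s (j : 'I_p) w' : R := (-1) ^+ tnth (flip w') j.
have ss j : std_subgaussian P 2 (s j) by exact: random_sign_std_subgaussian (half j).
have sind : mutually_independent P s by exact: random_signs_independent.
have ms j : measurable_fun setT (s j) by exact: sg_measurable (ss j).
pose v i j := residual (fun i => col i Xm) j (ridge_sol Xm l j) i * thb j 0.
have E w' : bias lam Xm (col_of_tuple (theta w')) l =
    \sum_i lam 0 i * linear_form s (v i) w' ^+ 2.
  rewrite bias_formula//; apply: eq_bigr => i _; congr (_ * _ ^+ 2).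
  by apply: eq_bigr => j _; rewrite mxE thE /v /s; ring.
have mlin i : measurable_fun setT (linear_form s (v i)) by exact: measurable_linear_form.
have -> : ('E_P[fun w' => bias lam Xm (col_of_tuple (theta w')) l] =
    (\sum_i lam 0 i * \sum_j v i j ^+ 2)%:E)%E.
  rewrite unlock; under eq_integral do rewrite E -sumEFin.
  rewrite ge0_integral_sum//; last 2 first.
  - by move=> i; measurability.
  - by move=> i w' _; rewrite lee_fin mulr_ge0 ?sqr_ge0// ltW.
  rewrite -sumEFin; apply: eq_bigr => i _.
  rewrite ge0_integralZlr//; last 3 first.
  - exact: ltW.
  - by move=> w'; exact: sqr_ge0.
  - by measurability.
  by rewrite (linear_form_var ss sind).
rewrite /= /coord_bias.
under [RHS]eq_bigr do rewrite mulr_sumr.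
rewrite exchange_big/=; apply: eq_bigr => i _.
by rewrite mulr_sumr; apply: eq_bigr => j _; rewrite /v exprMn; ring.
Qed.

(** The near-minimizers of level e form a bounded set that shrinks with e; the
    infimum over e of their suprema is a limit of near-minimizers of every
    level. *)
Lemma minimizer_exists (D : set R) (F : R -> R) (l0 a b m : R) :
  D l0 -> (forall l, D l -> m <= F l) -> (forall l, D l -> a <= l) ->
  (exists2 e, 0 < e & forall l, D l -> F l < F l0 + e -> l <= b) ->
  exists2 l, minimizer D F l & l <= b.
Proof.
move=> Dl0 mF aD [e0 e00 He0].
pose I := inf [set F l | l in D].
have hI : has_inf [set F l | l in D].
  by split; [exists (F l0), l0|exists m => _ [l Dl <-]; exact: mF].
pose K e := [set l | D l /\ F l < I + e].
have K0 e : 0 < e -> K e !=set0.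
  by move=> e1; have [_ [l Dl <-] Fl] := inf_adherent e1 hI; exists l.
have IF l : D l -> I <= F l by move=> Dl; apply: ge_inf; [exact: hI.2|exists l].
have Kb e l : e <= e0 -> K e l -> l <= b.
  move=> ee [Dl Fl]; apply: He0 => //; apply: (lt_le_trans Fl).
  by apply: lerD => //; exact: IF.
have Kmono e e' : e <= e' -> K e `<=` K e'.
  by move=> ee l [Dl Fl]; split => //; apply: lt_le_trans Fl _; rewrite lerD2l.
pose g e := sup (K e).
have hK e : 0 < e -> e <= e0 -> has_sup (K e).
  by move=> e1 e2; split; [exact: K0|exists b => l; exact: Kb].
pose G := [set g e | e in [set e | 0 < e <= e0]].
have hG : has_inf G.
  split; first by exists (g e0), e0 => //=; rewrite e00 lexx.
  exists a => _ [e /= /andP[e1 e2] <-].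
  have [l Kl] := K0 e e1; apply: (@le_trans _ _ l); first by case: Kl => /aD.
  by apply: ub_le_sup => //; case: (hK e e1 e2).
pose l := inf G.
have close e del : 0 < e -> 0 < del -> exists2 l', K e l' & `|l' - l| < del.
  move=> e1 del0.
  have [_ [e2 /= /andP[e20 e2e] <-] ge2] := inf_adherent del0 hG.
  pose e3 := Num.min e e2.
  have e30 : 0 < e3 by rewrite lt_min e1.
  have e3e2 : e3 <= e2 by rewrite ge_min lexx orbT.
  have e3e : e3 <= e0 by apply: le_trans e2e.
  have [l' Kl' l'g] := sup_adherent del0 (hK e3 e30 e3e).
  exists l'; first by apply: (Kmono e3) Kl'; rewrite ge_min lexx.
  have lg : l <= g e3 by apply: ge_inf; [exact: hG.2|exists e3 => //=; rewrite e30].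
  have l'2 : l' <= g e2.
    by apply: ub_le_sup; [case: (hK e2 e20 e2e)|exact: (Kmono e3)].
  rewrite ltr_norml; apply/andP; split.
    by rewrite ltrBrDl; apply: le_lt_trans l'g; rewrite lerD2r.
  by rewrite ltrBlDl; apply: le_lt_trans ge2.
exists l; last first.
  apply/ler_addgt0Pr => del del0; have [l' Kl' ll'] := close e0 del e00 del0.
  have := Kb e0 l' (lexx _) Kl'; move: ll'; rewrite ltr_norml => /andP[h1 h2] h3; lra.
move=> m' e Dm e1 B /nbhs_ballP[del /= del0 HB].
have [l' Kl' ll'] := close e del e1 del0.
exists l'; split.
  case: Kl' => Dl' Fl'; split => //; apply: lt_le_trans Fl' _.
  by rewrite lerD2r; exact: IF.
by apply: HB; rewrite -ball_normE /= distrC.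
Qed.

Lemma minimizer_le (D : set R) (F : R -> R) (l0 b e l : R) :
  D l0 -> 0 < e -> (forall l, D l -> F l < F l0 + e -> l <= b) ->
  minimizer D F l -> l <= b.
Proof.
move=> Dl0 e0 H lmin; have := lmin l0 e Dl0 e0.
have : [set l' | D l' /\ F l' < F l0 + e] `<=` [set l' | l' <= b].
  by move=> l' [Dl' Fl'] /=; exact: H.
move/closure_subset; move/(_ l).
rewrite -((closure_id [set l' | l' <= b]).1 (@closed_le _ b)).
by move=> h /h.
Qed.

End MeanRisk.

(** * Bounds on the averaged risk *)

(** The hypotheses describe a typical X: on the tail X X^T is close to S times
    the identity, where S is the sum of the tail eigenvalues, the columns of the
    head are well conditioned, and column norms have their expected size. *)
Section RiskBounds.
Context (R : realType) (n p : nat) (X : 'M[R]_(n, p)) (lam : 'rV[R]_p) (k : 'I_p).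
Context (thb : 'cV[R]_p) (veps : R) (eps C c lmax : R).
Notation x := (fun i => col i X).
Notation head := (fun i : 'I_p => (i < k)%N).
Notation tail := (fun i : 'I_p => ~~ (i < k)%N).
Notation S := (tail_sum lam k).
Let H := \sum_(i < p | head i) thb i 0 ^+ 2 / lam 0 i.
Let Th := \sum_(i < p | tail i) lam 0 i * thb i 0 ^+ 2.

Hypothesis n0 : (0 < n)%N.
Hypothesis lam0 : forall i, 0 < lam 0 i.
Hypothesis eps0 : 0 < eps.
Hypothesis eps1 : eps <= 2^-1.
Hypothesis C0 : 0 <= C.
Hypothesis c0 : 0 < c.
Hypothesis tail_form : forall v,
  `|\sum_(i | tail i) dot (x i) v ^+ 2 - S * dot v v| <= eps / 2 * S * dot v v.
Hypothesis head_form : forall a : 'I_p -> R,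
  n%:R / 2 * \sum_(i | head i) lam 0 i * a i ^+ 2 <=
  dot (\sum_(i | head i) a i *: x i) (\sum_(i | head i) a i *: x i).
Hypothesis head_norm : forall j, head j -> dot (x j) (x j) <= lam 0 j * (C * n%:R).
Hypothesis head_large : forall j, head j -> S <= n%:R * lam 0 j.
Hypothesis tail_signal_norm :
  \sum_(j | tail j) thb j 0 ^+ 2 * dot (x j) (x j) <=
  C * n%:R * \sum_(j | tail j) thb j 0 ^+ 2 * lam 0 j.
Hypothesis tail_lam_norm :
  \sum_(j | tail j) lam 0 j * dot (x j) (x j) <=
  C * n%:R * \sum_(j | tail j) lam 0 j ^+ 2.
Hypothesis tail_le : forall i, tail i -> lam 0 i <= lmax.
Hypothesis lmax_small : c * n%:R * lmax <= S.

Let nR : 0 < n%:R :> R. Proof. by rewrite ltr0n. Qed.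

Let tailE : (fun i : 'I_p => (k <= i)%N) =1 tail.
Proof. by move=> i; rewrite -leqNgt. Qed.

Let S0 : 0 < S.
Proof.
rewrite /tail_sum (bigD1 k)//=; apply: (lt_le_trans (lam0 k)).
by rewrite lerDl; apply: sumr_ge0 => i _; exact: ltW.
Qed.

Let formE l v : form x l tail v v = l * dot v v + \sum_(i | tail i) dot (x i) v ^+ 2.
Proof. by rewrite /form; congr (_ + _); apply: eq_bigr => i _; rewrite expr2. Qed.

Let form_le l v : form x l tail v v <= form x l xpredT v v.
Proof.
rewrite /form lerD2l [leRHS](bigID (fun i : 'I_p => (i < k)%N))/= lerDr.
by apply: sumr_ge0 => i _; rewrite -expr2 sqr_ge0.
Qed.

Lemma coord_bias_ge0 l j : 0 <= coord_bias X lam l j.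
Proof.
by apply: sumr_ge0 => i _; apply: mulr_ge0; [exact: ltW|exact: sqr_ge0].
Qed.

Lemma averaged_risk_ge0 l : 0 <= averaged_risk X lam veps thb l.
Proof.
apply: addr_ge0.
  by apply: sumr_ge0 => j _; rewrite mulr_ge0 ?sqr_ge0// coord_bias_ge0.
apply: mulr_ge0; first exact: sqr_ge0.
by apply: sumr_ge0 => i _; rewrite mulr_ge0 ?dot_ge0// ltW.
Qed.

(** Above - S / 2 the tail and the ridge together still act as a ridge of size
    at least S / 4, which biases each head coordinate ([residual_lower_bound]); since
    S <= n lam_j there, this bias has the order of (S / n)^2 / lam_j. *)
Lemma averaged_risk_lower l : - (S / 2) <= l ->
  H * (S / n%:R) ^+ 2 / (1 + 4 * C) ^+ 2 <= averaged_risk X lam veps thb l.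
Proof.
move=> lS; have a0 : 0 < S / 4 by rewrite divr_gt0.
have aP v : S / 4 * dot v v <= form x l tail v v.
  rewrite formE; have := tail_form v; rewrite ler_norml => /andP[h _].
  have v0 := dot_ge0 v.
  have Sv : 0 <= S * dot v v by rewrite mulr_ge0// ltW.
  have h1 : eps * (S * dot v v) <= 2^-1 * (S * dot v v) by rewrite ler_wpM2r.
  have h2 : - (S / 2) * dot v v <= l * dot v v by rewrite ler_wpM2r.
  lra.
have sol j := ridge_sol_form j a0 (fun v => le_trans (aP v) (form_le l v)).
have coord j : head j -> (S / n%:R) ^+ 2 / (1 + 4 * C) ^+ 2 / lam 0 j <= coord_bias X lam l j.
  move=> hj; have r := residual_lower_bound hj a0 aP (sol j).
  have lj := lam0 j.
  have xj0 := dot_ge0 (col j X).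
  have D0 : 0 < 1 + 4 * C by rewrite ltr_pwDl// mulr_ge0.
  have r2 : S / n%:R / (1 + 4 * C) / lam 0 j <= residual x j (ridge_sol X l j) j.
    apply: le_trans r; rewrite ler_pdivlMr; last by lra.
    have hx := head_norm hj; have hS := head_large hj.
    have : S / 4 + dot (col j X) (col j X) <= n%:R * lam 0 j * (1 + 4 * C) / 4 by lra.
    move=> hh; apply: (@le_trans _ _ (S / n%:R / (1 + 4 * C) / lam 0 j *
      (n%:R * lam 0 j * (1 + 4 * C) / 4))).
      by apply: ler_wpM2l => //; rewrite !divr_ge0// ltW.
    by rewrite le_eqVlt; apply/orP; left; apply/eqP; field; rewrite !gt_eqF.
  apply: (@le_trans _ _ (lam 0 j * residual x j (ridge_sol X l j) j ^+ 2)); last first.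
    rewrite /coord_bias (bigD1 j)//= lerDl; apply: sumr_ge0 => i _.
    by rewrite mulr_ge0 ?sqr_ge0// ltW.
  have -> : (S / n%:R) ^+ 2 / (1 + 4 * C) ^+ 2 / lam 0 j =
     lam 0 j * (S / n%:R / (1 + 4 * C) / lam 0 j) ^+ 2 by field; rewrite !gt_eqF.
  rewrite ler_pM2l//; apply: lerXn2r => //; rewrite nnegrE.
    by rewrite !divr_ge0// ltW.
  by apply: le_trans r2; rewrite !divr_ge0// ltW.
apply: (@le_trans _ _ (\sum_j thb j 0 ^+ 2 * coord_bias X lam l j)); last first.
  rewrite /averaged_risk lerDl; apply: mulr_ge0; first exact: sqr_ge0.
  by apply: sumr_ge0 => i _; rewrite mulr_ge0 ?dot_ge0// ltW.
rewrite [leRHS](bigID (fun i : 'I_p => (i < k)%N))/= -[leLHS]addr0; apply: lerD; last first.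
  by apply: sumr_ge0 => j _; rewrite mulr_ge0 ?sqr_ge0// coord_bias_ge0.
rewrite /H -mulrA mulr_suml; apply: ler_sum => j hj.
rewrite -mulrA; apply: ler_wpM2l; first exact: sqr_ge0.
by rewrite mulrC; exact: coord.
Qed.

(* The ridge l0 cancels the tail up to eps S: l0 plus the tail of X X^T lies
   between am and ap. *)
Let l0 : R := - (1 - eps) * S.
Let am := eps / 2 * S.
Let ap := 3 * eps / 2 * S.
Let am0 : 0 < am. Proof. by rewrite /am mulr_gt0// divr_gt0. Qed.
Let ap0 : 0 < ap. Proof. by rewrite /ap !mulr_gt0. Qed.

Let tailP v : am * dot v v <= form x l0 tail v v <= ap * dot v v.
Proof.
rewrite formE; have := tail_form v; rewrite ler_norml => /andP[h1 h2].
by rewrite /am /ap /l0; apply/andP; split; lra.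
Qed.

Let sol j := ridge_sol_form j am0 (fun v => le_trans (andP (tailP v)).1 (form_le l0 v)).

Let tail_energy v : \sum_(i | tail i) lam 0 i * dot (x i) v ^+ 2 <= 2 * lmax * S * dot v v.
Proof.
have v0 := dot_ge0 v; have := tail_form v; rewrite ler_norml => /andP[_ h2].
have Sv : 0 <= S * dot v v by rewrite mulr_ge0// ltW.
have h1 : eps * (S * dot v v) <= 2^-1 * (S * dot v v) by rewrite ler_wpM2r.
apply: (@le_trans _ _ (lmax * \sum_(i | tail i) dot (x i) v ^+ 2)).
  rewrite mulr_sumr; apply: ler_sum => i hi.
  by apply: ler_wpM2r; [exact: sqr_ge0|exact: tail_le].
have lmax0 : 0 <= lmax by apply: le_trans (ltW (lam0 k)) (tail_le _); rewrite ltnn.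
rewrite (_ : 2 * lmax * S * dot v v = lmax * (2 * (S * dot v v))); last by ring.
by apply: ler_wpM2l => //; lra.
Qed.

Let N00 : 0 < n%:R / 2 :> R. Proof. by rewrite divr_gt0. Qed.

Let coord_split l j : coord_bias X lam l j =
  \sum_(i | head i) lam 0 i * residual x j (ridge_sol X l j) i ^+ 2 +
  \sum_(i | tail i) lam 0 i * residual x j (ridge_sol X l j) i ^+ 2.
Proof. by rewrite /coord_bias (bigID (fun i : 'I_p => (i < k)%N)). Qed.

Let sol_head j : head j ->
  coord_bias X lam l0 j <= (S / n%:R) ^+ 2 * (9 * eps ^+ 2 + 12 / c) / lam 0 j /\
  lam 0 j * dot (ridge_sol X l0 j) (ridge_sol X l0 j) <= 6 / n%:R.
Proof.
move=> hj; have lj := lam0 j.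
have [h1 h2] := head_solution lam0 (sol j) am0 tailP ap0 N00 head_form hj.
have h2' : dot (ridge_sol X l0 j) (ridge_sol X l0 j) <= 6 / (n%:R * lam 0 j).
  apply: le_trans h2 _; rewrite /ap /am le_eqVlt; apply/orP; left; apply/eqP.
  by field; rewrite !gt_eqF.
split; last first.
  rewrite mulrC -ler_pdivlMr//; apply: le_trans h2' _.
  by rewrite le_eqVlt; apply/orP; left; apply/eqP; field; rewrite !gt_eqF.
rewrite coord_split.
have -> : (S / n%:R) ^+ 2 * (9 * eps ^+ 2 + 12 / c) / lam 0 j =
   (ap / (n%:R / 2)) ^+ 2 / lam 0 j + 12 * S / (n%:R * lam 0 j) * (S / (c * n%:R)).
  by rewrite /ap; field; rewrite !gt_eqF.
apply: lerD => //.
rewrite (eq_bigr (fun i => lam 0 i * dot (x i) (ridge_sol X l0 j) ^+ 2)); last first.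
  move=> i hi; rewrite /residual; case: eqP hi hj => [-> /negbTE ->//|_ _ _].
  by rewrite sub0r sqrrN.
apply: le_trans (tail_energy _) _.
have lm : lmax <= S / (c * n%:R) by rewrite ler_pdivlMr ?mulr_gt0// mulrC.
have lmax0 : 0 <= lmax by apply: le_trans (ltW (lam0 k)) (tail_le _); rewrite ltnn.
apply: (@le_trans _ _ (2 * lmax * S * (6 / (n%:R * lam 0 j)))).
  by apply: ler_wpM2l => //; rewrite !mulr_ge0// ltW.
rewrite (_ : 2 * lmax * S * (6 / (n%:R * lam 0 j)) = 12 * S / (n%:R * lam 0 j) * lmax); last first.
  by field; rewrite !gt_eqF.
by apply: ler_wpM2l => //; rewrite divr_ge0 ?mulr_ge0// ltW.
Qed.

Let sol_tail j : tail j ->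
  coord_bias X lam l0 j <=
    2 * lam 0 j + 16 * (1 + (eps ^+ 2 * c)^-1) / n%:R * dot (x j) (x j) /\
  lam 0 j * dot (ridge_sol X l0 j) (ridge_sol X l0 j) <=
    4 / (eps ^+ 2 * S ^+ 2) * (lam 0 j * dot (x j) (x j)).
Proof.
move=> hj; have lj := lam0 j.
have [h1 h2] := tail_solution (sol j) am0 tailP ap0 head_form hj.
set y := ridge_sol X l0 j in h1 h2 *; set xx := dot (x j) (x j) in h1 h2 *.
have xx0 : 0 <= xx by exact: dot_ge0.
have h2' : dot y y <= 4 / (eps ^+ 2 * S ^+ 2) * xx.
  apply: le_trans h2 _; rewrite /am le_eqVlt; apply/orP; left; apply/eqP.
  by field; rewrite !gt_eqF.
split; last by rewrite mulrCA; apply: ler_wpM2l => //; exact: ltW.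
rewrite coord_split -/y.
have h1' : \sum_(i < p | (i < k)%N) lam 0 i * residual x j y i ^+ 2 <= 16 / n%:R * xx.
  rewrite -(ler_pM2l N00); apply: le_trans h1 _.
  by rewrite le_eqVlt; apply/orP; left; apply/eqP; rewrite /ap /am; field; rewrite !gt_eqF.
have lm : lmax <= S / (c * n%:R) by rewrite ler_pdivlMr ?mulr_gt0// mulrC.
have lmax0 : 0 <= lmax by apply: le_trans (ltW (lam0 k)) (tail_le _); rewrite ltnn.
have h3 : 4 * lmax * S * dot y y <= 16 / (eps ^+ 2 * c * n%:R) * xx.
  apply: (@le_trans _ _ (4 * lmax * S * (4 / (eps ^+ 2 * S ^+ 2) * xx))).
    by apply: ler_wpM2l => //; rewrite !mulr_ge0// ltW.
  rewrite (_ : 4 * lmax * S * _ = 16 / (eps ^+ 2 * S) * xx * lmax); last first.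
    by field; rewrite !gt_eqF.
  rewrite (_ : 16 / (eps ^+ 2 * c * n%:R) * xx =
    16 / (eps ^+ 2 * S) * xx * (S / (c * n%:R))); last by field; rewrite !gt_eqF.
  apply: ler_wpM2l => //; apply: mulr_ge0 => //; apply: divr_ge0 => //.
  by apply: mulr_ge0; [exact: sqr_ge0|exact: ltW].
have h4 : \sum_(i < p | ~~ (i < k)%N) lam 0 i * residual x j y i ^+ 2 <=
    2 * lam 0 j + 4 * lmax * S * dot y y.
  apply: (@le_trans _ _ (\sum_(i < p | ~~ (i < k)%N)
      (2 * (lam 0 i * (i == j)%:R) + 2 * (lam 0 i * dot (x i) y ^+ 2)))).
    apply: ler_sum => i _; have li := lam0 i.
    rewrite [leRHS](_ : _ = lam 0 i * (2 * (i == j)%:R + 2 * dot (x i) y ^+ 2)); last by ring.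
    rewrite ler_pM2l// /residual; move: (dot (col i X) y) => t.
    have t1 := sqr_ge0 (1 + t); have t2 := sqr_ge0 t.
    by case: (i == j) => /=; lra.
  rewrite big_split/= -!mulr_sumr.
  rewrite (_ : \sum_(i < p | ~~ (i < k)%N) lam 0 i * (i == j)%:R = lam 0 j); last first.
    rewrite (bigD1 j)//= eqxx mulr1 big1 ?addr0// => i /andP[_ /negbTE ->].
    by rewrite mulr0.
  by have := tail_energy y; lra.
apply: le_trans (lerD h1' (le_trans h4 (lerD (lexx _) h3))) _.
by rewrite le_eqVlt; apply/orP; left; apply/eqP; field; rewrite !gt_eqF.
Qed.

(** At l0 the effective ridge is of order eps S, so the head bias has the order
    of eps^2 (S / n)^2 / lam_j.  The other contributions are either controlled
    by lmax, which is at most S / (c n), or multiplied by the tail signal or by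
    the noise. *)
Lemma averaged_risk_upper :
  averaged_risk X lam veps thb l0 <=
  H * (S / n%:R) ^+ 2 * (9 * eps ^+ 2 + 12 / c) +
  Th * (2 + 16 * C * (1 + (eps ^+ 2 * c)^-1)) +
  veps ^+ 2 * (6 * k%:R / n%:R +
    4 * C * n%:R * tail_sum_sq lam k / (eps ^+ 2 * S ^+ 2)).
Proof.
rewrite /averaged_risk; apply: lerD.
  rewrite (bigID (fun i : 'I_p => (i < k)%N))/=; apply: lerD.
    rewrite -mulrA /H mulr_suml; apply: ler_sum => j hj.
    rewrite -mulrA; apply: ler_wpM2l; first exact: sqr_ge0.
    by apply: le_trans (sol_head hj).1 _; rewrite mulrC.
  apply: (@le_trans _ _ (\sum_(i < p | tail i)
    (2 * (lam 0 i * thb i 0 ^+ 2) + 16 * (1 + (eps ^+ 2 * c)^-1) / n%:R *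
      (thb i 0 ^+ 2 * dot (x i) (x i))))).
    apply: ler_sum => j hj; rewrite [leRHS](_ : _ = thb j 0 ^+ 2 *
      (2 * lam 0 j + 16 * (1 + (eps ^+ 2 * c)^-1) / n%:R * dot (x j) (x j))); last by ring.
    by apply: ler_wpM2l; [exact: sqr_ge0|exact: (sol_tail hj).1].
  rewrite big_split/= -!mulr_sumr -/Th.
  have e1 : 0 <= 16 * (1 + (eps ^+ 2 * c)^-1) / n%:R.
    rewrite divr_ge0 ?mulr_ge0// ?addr_ge0// ?invr_ge0 ?mulr_ge0 ?sqr_ge0// ltW//.
  have := ler_wpM2l e1 tail_signal_norm.
  have -> : \sum_(j < p | tail j) thb j 0 ^+ 2 * lam 0 j = Th.
    by apply: eq_bigr => i _; rewrite mulrC.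
  rewrite (_ : _ / n%:R * (C * n%:R * Th) = Th * (16 * C * (1 + (eps ^+ 2 * c)^-1))); last first.
    by field; rewrite !gt_eqF.
  lra.
apply: ler_wpM2l; first exact: sqr_ge0.
rewrite (bigID (fun i : 'I_p => (i < k)%N))/=; apply: lerD.
  apply: (@le_trans _ _ (\sum_(i < p | (i < k)%N) 6 / n%:R)).
    by apply: ler_sum => j hj; exact: (sol_head hj).2.
  rewrite -(sum_head_tail k (fun=> 6 / n%:R)).1 sumr_const card_ord.
  by rewrite -[leLHS]mulr_natr [leLHS]mulrAC.
apply: (@le_trans _ _ (\sum_(i < p | tail i) 4 / (eps ^+ 2 * S ^+ 2) * (lam 0 i * dot (x i) (x i)))).
  by apply: ler_sum => j hj; exact: (sol_tail hj).2.
rewrite -mulr_sumr.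
have e1 : 0 <= 4 / (eps ^+ 2 * S ^+ 2).
  by apply: divr_ge0 => //; apply: mulr_ge0; exact: sqr_ge0.
apply: le_trans (ler_wpM2l e1 tail_lam_norm) _.
rewrite /tail_sum_sq (eq_bigl _ _ tailE).
by rewrite le_eqVlt; apply/orP; left; apply/eqP; ring.
Qed.

Lemma start_in_range : ridge_range X l0.
Proof.
rewrite /ridge_range /=.
have h : (1 - eps / 2) * S <= smallest_eigenvalue (X *m X^T).
  apply: smallest_eigenvalue_ge => //; first by rewrite trmx_mul trmxK.
  move=> v; rewrite -(dot_mulmx_sym) ?trmx_mul ?trmxK//.
  have -> : X *m X^T = ridge_mx X 0 by rewrite /ridge_mx raddf0 add0r.
  rewrite ridge_mx_form; apply: le_trans (form_le _ _); rewrite formE mul0r add0r.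
  have := tail_form v; rewrite ler_norml => /andP[h1 h2]; lra.
have : eps / 2 * S < eps * S by rewrite ltr_pM2r// ltr_pdivrMr// ltr_pMr// ltr1n.
rewrite /l0; lra.
Qed.

End RiskBounds.

(** * The whitened entries *)

Section Entries.
Context (R : realType) (n p : nat).
Context d0 (T0 : measurableType d0) (P0 : probability T0 R) (x : {RV P0 >-> p.-tuple R}).
Context d (T : measurableType d) (P : probability T R).
Context (X : {RV P >-> n.-tuple (p.-tuple R)}) (lam : 'rV[R]_p).
Hypothesis lam0 : forall i, 0 < lam 0 i.

Definition entry (ij : 'I_n * 'I_p) (w : T) : R := tnth (tnth (X w) ij.1) ij.2.

Definition std_entry (ij : 'I_n * 'I_p) (w : T) : R :=
  (Num.sqrt (lam 0 ij.2))^-1 * entry ij w.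

Lemma measurable_row i : measurable_fun setT (row_rv X i).
Proof. by apply: (measurableT_comp (measurable_tnth i)). Qed.

Lemma measurable_entry ij : measurable_fun setT (entry ij).
Proof. exact: (measurableT_comp (measurable_tnth ij.2) (measurable_row ij.1)). Qed.

Lemma measurable_std_entry ij : measurable_fun setT (std_entry ij).
Proof. by apply: measurable_funM; [exact: measurable_cst|exact: measurable_entry]. Qed.

Lemma entryE ij w : entry ij w = Num.sqrt (lam 0 ij.2) * std_entry ij w.
Proof.
by rewrite /std_entry mulrA divff ?mul1r// gt_eqF// sqrtr_gt0.
Qed.

Lemma same_law_ge0_integral i (f : p.-tuple R -> R) :
  same_law P P0 (row_rv X i) x -> measurable_fun setT f -> (forall t, 0 <= f t) ->
  (\int[P]_w (f (row_rv X i w))%:E = \int[P0]_w (f (x w))%:E)%E.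
Proof.
move=> law mf f0.
pose Y : {RV P >-> p.-tuple R} :=
  HB.pack (row_rv X i) (isMeasurableFun.Build _ _ _ _ _ (measurable_row i)).
have mf' : measurable_fun setT (EFin \o f) by exact/measurable_EFinP.
have f0' t : (0 <= (EFin \o f) t)%E by rewrite /= lee_fin.
have := ge0_integral_distribution Y mf' f0'; rewrite /= => <-.
have := ge0_integral_distribution x mf' f0'; rewrite /= => <-.
by apply: eq_measure_integral => A mA _; exact: law.
Qed.

Lemma same_law_integral i (f : p.-tuple R -> R) :
  same_law P P0 (row_rv X i) x -> measurable_fun setT f ->
  P0.-integrable setT (fun w => (f (x w))%:E) ->
  (\int[P]_w (f (row_rv X i w))%:E = \int[P0]_w (f (x w))%:E)%E.
Proof.
move=> law mf intx.
pose Y : {RV P >-> p.-tuple R} :=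
  HB.pack (row_rv X i) (isMeasurableFun.Build _ _ _ _ _ (measurable_row i)).
have mf' : measurable_fun setT (EFin \o f) by exact/measurable_EFinP.
have intY : P.-integrable setT (EFin \o f \o Y).
  apply/integrableP; split; first exact: measurableT_comp.
  have mn : measurable_fun setT (fun t => `|f t|) by exact: measurableT_comp.
  have := same_law_ge0_integral law mn (fun t => normr_ge0 (f t)).
  by move=> /= ->; case/integrableP: intx.
have := integral_distribution mf' intY; rewrite /= => <-.
have := integral_distribution mf' intx; rewrite /= => <-.
by apply: eq_measure_integral => A mA _; exact: law.
Qed.

Lemma psi2_norm_lt (z : T -> R) (s : R) : 0 < s -> measurable_fun setT z ->
  (psi2_norm P z < s%:E)%E -> (\int[P]_w (expR (z w ^+ 2 / s ^+ 2))%:E <= 2%:E)%E.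
Proof.
move=> s0 mz /ereal_inf_lt[_ [t [t0 Et] <-]]; rewrite lte_fin => ts.
rewrite unlock in Et; apply: le_trans Et.
apply: ge0_le_integralr; try by measurability.
move=> w; rewrite ler_expR; apply: ler_wpM2l; first exact: sqr_ge0.
by rewrite lef_pV2 ?posrE ?exprn_gt0//; apply: lerXn2r; rewrite ?nnegrE ltW.
Qed.

(** The psi_2 bound is that of the whitened row in the direction of the j-th
    basis vector; doubling sigma leaves room for the infimum in the definition
    of the psi_2 norm. *)
Lemma std_entry_subgaussian (sigma : R) ij : 0 < sigma ->
  mean_zero x -> has_covariance x (Sigma lam) ->
  same_law P P0 (row_rv X ij.1) x ->
  (psi2_norm_vec P (fun w => row ij.1 (whitened X lam w)) <= sigma%:E)%E ->
  std_subgaussian P (2 * sigma) (std_entry ij).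
Proof.
case: ij => i j /= s0 mean cov law psi.
have mj : measurable_fun setT (fun t : p.-tuple R => tnth t j) by exact: measurable_tnth.
have mx : measurable_fun setT (fun w => tnth (x w) j).
  by apply: (measurableT_comp mj).
have mX := measurable_entry (i, j).
have var0 : (\int[P0]_w (tnth (x w) j ^+ 2)%:E = (lam 0 j)%:E)%E.
  have := cov j j; rewrite unlock mxE eqxx mulr1n => <-.
  by apply: eq_integral => w _; rewrite expr2.
have mean0 : (\int[P0]_w (tnth (x w) j)%:E = 0)%E by have := mean j; rewrite unlock.
have intx : P0.-integrable setT (fun w => (tnth (x w) j)%:E).
  by apply: (sqr_integrable1 mx); rewrite var0 ltry.
have varX : (\int[P]_w (entry (i, j) w ^+ 2)%:E = (lam 0 j)%:E)%E.
  rewrite -var0; apply: (same_law_ge0_integral (f := fun t => tnth t j ^+ 2) law).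
    by measurability.
  by move=> t; exact: sqr_ge0.
have meanX : (\int[P]_w (entry (i, j) w)%:E = 0)%E.
  by rewrite -mean0; exact: (same_law_integral (f := fun t => tnth t j) law).
have intX : P.-integrable setT (EFin \o entry (i, j)).
  by apply: sqr_integrable1 => //; rewrite varX ltry.
have sq2 : (Num.sqrt (lam 0 j))^-1 ^+ 2 = (lam 0 j)^-1.
  by rewrite exprVn sqr_sqrtr// ltW.
split.
- exact: measurable_std_entry.
- under eq_integral do rewrite EFinM.
  by rewrite (integralZl measurableT intX) meanX mule0.
- under eq_integral do rewrite /std_entry exprMn sq2.
  rewrite ge0_integralZlr//; last 3 first.
  + by rewrite invr_ge0 ltW.
  + by move=> w; exact: sqr_ge0.
  + by measurability.
  by rewrite varX -EFinM mulVf// gt_eqF.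
- apply: psi2_norm_lt; [by rewrite mulr_gt0|exact: measurable_std_entry|].
  apply: (@le_lt_trans _ _ sigma%:E); last by rewrite lte_fin; lra.
  apply: le_trans psi; apply: ereal_sup_ubound.
  exists (delta_mx j 0) => /=.
    apply/eqP => /matrixP/(_ j 0); rewrite !mxE !eqxx/= => /eqP; by rewrite oner_eq0.
  congr psi2_norm; apply/funext => w.
  have -> : l2norm (delta_mx j 0) = 1 :> R.
    rewrite /l2norm (bigD1 j)//= mxE !eqxx/= expr1n big1 ?addr0 ?sqrtr1//.
    by move=> a /negbTE aj; rewrite mxE aj expr0n.
  rewrite divr1 -colE !mxE (bigD1 j)//= big1 ?addr0.
    by rewrite !mxE eqxx mulr1n mulrC.
  by move=> a /negbTE aj; rewrite !mxE aj mulr0n mulr0.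
Qed.

Lemma std_entry_independent : independent_entries X ->
  mutually_independent P std_entry.
Proof.
move=> ind B mB.
apply: (ind (fun ij => (fun r => (Num.sqrt (lam 0 ij.2))^-1 * r) @^-1` B ij)) => ij.
rewrite -[X in measurable X]setTI.
by apply: measurable_funM => //; measurability.
Qed.

End Entries.

(** * Typical events *)

Section GoodEvent.
Context (R : realType) d (T : measurableType d) (P : probability T R).
Context (n p : nat) (lam : 'rV[R]_p) (k : 'I_p) (K : R).
Context (W : 'I_n * 'I_p -> T -> R) (X : T -> 'M[R]_(n, p)).
Hypothesis lam0 : forall i, 0 < lam 0 i.
Hypothesis lam_mono : forall i j : 'I_p, (i <= j)%N -> lam 0 j <= lam 0 i.
Hypothesis K0 : 0 < K.
Hypothesis sgW : forall ij, std_subgaussian P K (W ij).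
Hypothesis indW : mutually_independent P W.
Hypothesis XW : forall w i j, X w i j = Num.sqrt (lam 0 j) * W (i, j) w.
Notation head := (fun i : 'I_p => (i < k)%N).
Notation tail := (fun i : 'I_p => ~~ (i < k)%N).
Notation S := (tail_sum lam k).
Notation C := (2 * K ^+ 2).
Notation rate := (chernoff_rate K / 2).

Let mW ij : measurable_fun setT (W ij). Proof. exact: sg_measurable (sgW ij). Qed.

Let sqrt2 j : Num.sqrt (lam 0 j) ^+ 2 = lam 0 j.
Proof. by rewrite sqr_sqrtr// ltW. Qed.

Let dot_col w j (v : 'cV[R]_n) :
  dot (col j (X w)) v ^+ 2 = lam 0 j * linear_form (fun a => W (a, j)) (fun a => v a 0) w ^+ 2.
Proof.
rewrite -sqrt2 -exprMn /dot /linear_form; congr (_ ^+ 2).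
by rewrite mulr_sumr; apply: eq_bigr => a _; rewrite mxE XW; ring.
Qed.

Let norm_col w j :
  dot (col j (X w)) (col j (X w)) = lam 0 j * \sum_a W (a, j) w ^+ 2.
Proof.
by rewrite mulr_sumr; apply: eq_bigr => a _; rewrite !mxE XW -[in RHS](sqrt2 j); ring.
Qed.

Let sqnorm_dot (v : 'cV[R]_n) : sqnorm (fun a => v a 0) = dot v v.
Proof. by apply: eq_bigr => a _; rewrite expr2. Qed.

(** The groups are the columns, with weight lam_j on the tail and 0 on the head;
    the net lives in dimension n. *)
Lemma likely_tail_form (eps : R) : 0 < eps <= 1 ->
  likely P (fun w => forall v,
      `|\sum_(i | tail i) dot (col i (X w)) v ^+ 2 - S * dot v v| <= eps / 2 * S * dot v v)
    (2 ^+ (18 * n) * (2 * expR (- (rate * (eps / 6) ^+ 2 * (S / lam 0 k))))).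
Proof.
move=> /andP[eps0 eps1].
pose W' (ja : 'I_p * 'I_n) := W (ja.2, ja.1).
pose mu (j : 'I_p) := if (k <= j)%N then lam 0 j else 0.
have muS : \sum_j mu j = S by rewrite /tail_sum [RHS]big_mkcond.
have ind' : mutually_independent P W'.
  by apply: (mutually_independent_inj indW (f := fun ja => (ja.2, ja.1))) => -[a j] [b i] [-> ->].
have H := @uniform_deviation R d T P 'I_p n W' K mu (lam 0 k) (eps / 6) K0
  (fun ga => sgW _) ind'.
apply: (likely_sub (H _ _ _)) => //.
- move=> j; rewrite /mu; case: ifPn => [kj|_]; last by rewrite lexx ltW.
  by rewrite ltW//= lam_mono.
- by rewrite divr_gt0//=; lra.
- move=> w Hw v; have := Hw (fun a => v a 0); rewrite muS sqnorm_dot.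
  have -> : group_deviation W' (fun a => v a 0) mu w =
      \sum_(i | tail i) dot (col i (X w)) v ^+ 2 - S * dot v v.
    rewrite /tail_sum mulr_suml big_mkcond/= [X in _ - X]big_mkcond/= -sumrB.
    apply: eq_bigr => j _; rewrite /mu -leqNgt; case: ifPn => _; last first.
      by rewrite mul0r subr0.
    by rewrite dot_col -sqnorm_dot /sqnorm mulrBr.
  by move/le_trans; apply; rewrite le_eqVlt; apply/orP; left; apply/eqP; field.
- by rewrite muS.
Qed.

(** The groups are the rows, with weight 1; the net lives in dimension k, which
    is small compared with n. *)
Lemma likely_head_form :
  likely P (fun w => forall a : 'I_p -> R,
      n%:R / 2 * \sum_(i | head i) lam 0 i * a i ^+ 2 <=
      dot (\sum_(i | head i) a i *: col i (X w)) (\sum_(i | head i) a i *: col i (X w)))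
    (2 ^+ (18 * k) * (2 * expR (- (rate * 6^-1 ^+ 2 * n%:R)))).
Proof.
pose W' (ai : 'I_n * 'I_k) := W (ai.1, head_ord ai.2).
have ind' : mutually_independent P W'.
  apply: (mutually_independent_inj indW (f := fun ai : 'I_n * 'I_k => (ai.1, head_ord ai.2))).
  move=> [a i] [b j] [-> ij]; congr (_, _); exact: val_inj.
have H := @uniform_deviation R d T P 'I_n k W' K (fun=> 1) 1 (6^-1) K0
  (fun ga => sgW _) ind'.
have sum1n : \sum_(a < n) (1 : R) = n%:R by rewrite sumr_const card_ord.
apply: (likely_sub (H _ _ _)) => //.
- by move=> _; rewrite ler01 lexx.
- by rewrite invr_gt0 ltr0n/= invf_le1 ?ltr0n// ler1n.
- move=> w Hw a; pose v (i : 'I_k) := a (head_ord i) * Num.sqrt (lam 0 (head_ord i)).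
  have := Hw v; rewrite sum1n.
  have sv : sqnorm v = \sum_(i < p | head i) lam 0 i * a i ^+ 2.
    rewrite -(sum_head_tail k _).1; apply: eq_bigr => i _.
    by rewrite /v exprMn sqrt2 mulrC.
  have -> : group_deviation W' v (fun=> 1) w =
    dot (\sum_(i | head i) a i *: col i (X w)) (\sum_(i | head i) a i *: col i (X w)) -
    n%:R * sqnorm v.
    have L b : linear_form (fun i => W' (b, i)) v w = (\sum_(i | head i) a i *: col i (X w)) b 0.
      rewrite summxE /linear_form -(sum_head_tail k _).1.
      by apply: eq_bigr => i _; rewrite !mxE XW /v /W'/=; ring.
    rewrite /group_deviation /dot -sum1n mulr_suml -sumrB.
    by apply: eq_bigr => b _; rewrite !mul1r expr2 L.
  by rewrite -sv ler_norml => /andP[h _]; clear H; lra.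
- by rewrite sum1n divr1.
Qed.

Lemma likely_weighted_norm (al : 'I_p -> R) : (forall j, 0 <= al j) ->
  likely P (fun w => \sum_j al j * \sum_a W (a, j) w ^+ 2 <= C * n%:R * \sum_j al j)
    (expR (- n%:R)).
Proof.
move=> al0; apply: likely_ler; first by measurability.
by have := weighted_norm_tail K0 sgW indW al0; rewrite card_ord.
Qed.

Lemma likely_head_norm :
  likely P (fun w => forall j, head j ->
      dot (col j (X w)) (col j (X w)) <= lam 0 j * (C * n%:R))
    (k%:R * expR (- n%:R)).
Proof.
have H (i : 'I_k) : likely P (fun w => dot (col (head_ord i) (X w)) (col (head_ord i) (X w)) <=
    lam 0 (head_ord i) * (C * n%:R)) (expR (- n%:R)).
  apply: (likely_sub (likely_weighted_norm (al := fun j => (j == head_ord i)%:R) _)) => //.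
  have pick1 (F : 'I_p -> R) : \sum_j (j == head_ord i)%:R * F j = F (head_ord i).
    rewrite (bigD1 (head_ord i))//= eqxx mul1r big1 ?addr0// => j /negbTE ->.
    by rewrite mul0r.
  move=> w; rewrite norm_col pick1.
  have -> : \sum_j (j == head_ord i)%:R = 1 :> R.
    by rewrite -[RHS](pick1 (fun=> 1)); apply: eq_bigr => j _; rewrite mulr1.
  by rewrite mulr1 => h; rewrite ler_pM2l.
have := likely_forall H; rewrite card_ord => {}H.
apply: (likely_sub H) => // w Hw j hj.
have -> : j = head_ord (Ordinal hj) by exact: val_inj.
exact: Hw.
Qed.

Lemma likely_tail_norm (f : 'I_p -> R) : (forall j, 0 <= f j) ->
  likely P (fun w => \sum_(j | tail j) f j * dot (col j (X w)) (col j (X w)) <=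
      C * n%:R * \sum_(j | tail j) f j * lam 0 j)
    (expR (- n%:R)).
Proof.
move=> f0; pose al j := if tail j then f j * lam 0 j else 0.
apply: (likely_sub (likely_weighted_norm (al := al) _)) => //.
  by move=> j; rewrite /al; case: ifPn => // _; rewrite mulr_ge0// ltW.
move=> w; rewrite (_ : \sum_j al j = \sum_(j < p | tail j) f j * lam 0 j); last first.
  by rewrite [RHS]big_mkcond.
move=> h; apply: le_trans h; rewrite big_mkcond/=.
apply: ler_sum => j _; rewrite norm_col /al; case: ifPn => _; last by rewrite mul0r.
by rewrite mulrA.
Qed.

End GoodEvent.

Section Constants.
Context (R : realType).

Lemma pow2_le_expR (m : nat) : 2 ^+ m <= expR m%:R :> R.
Proof.
have -> : expR m%:R = expR 1 ^+ m :> R by rewrite -expRM_natl mulr1.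
by apply: lerXn2r; rewrite ?nnegrE ?expR_ge0//; exact: expR_ge2.
Qed.

(** The nets have at most 2^(18 n) <= exp (18 n) and exp (18 k) elements.  The
    constant 19 leaves exp (- n) for the first; as k < n / c, the condition
    1296 = 36 * 36 <= r c makes 18 k at most half of r n / 36, the exponent of the
    second. *)
Lemma failure_bound (n k : nat) (c r a s : R) :
  (0 < n)%N -> 8 <= c -> 0 < r -> 19 <= r * a * c -> 1296 / r <= c -> 0 <= r * a ->
  k%:R < n%:R / c -> c * n%:R <= s ->
  2 ^+ (18 * n) * (2 * expR (- (r * a * s))) +
  (2 ^+ (18 * k) * (2 * expR (- (r * 6^-1 ^+ 2 * n%:R))) +
  (k%:R * expR (- n%:R) + (expR (- n%:R) + expR (- n%:R)))) <= c * expR (- (n%:R / c)).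
Proof.
move=> n0 c8 r0 rac rc ra0 kn cs.
have c0 : 0 < c by lra.
have nR : 1 <= n%:R :> R by rewrite ler1n.
set y := n%:R / c in kn *; set E := expR (- y).
have yc : n%:R = c * y by rewrite /y mulrCA divff ?mulr1// gt_eqF.
have y0 : 0 < y by rewrite divr_gt0//; lra.
have yn : 8 * y <= n%:R by rewrite yc ler_pM2r.
have e1 : expR (- n%:R) <= E by rewrite ler_expR; lra.
have h1 : 2 ^+ (18 * n) * (2 * expR (- (r * a * s))) <= 2 * E.
  apply: (@le_trans _ _ (expR (18 * n)%:R * (2 * expR (- (r * a * s))))).
    by apply: ler_wpM2r; [rewrite mulr_ge0// expR_ge0|exact: pow2_le_expR].
  rewrite mulrCA ler_pM2l// -expRD ler_expR natrM.
  have : r * a * (c * n%:R) <= r * a * s by rewrite ler_wpM2l.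
  have : 19 * n%:R <= (r * a * c) * n%:R by rewrite ler_pM2r//; lra.
  lra.
have h2 : 2 ^+ (18 * k) * (2 * expR (- (r * 6^-1 ^+ 2 * n%:R))) <= 2 * E.
  apply: (@le_trans _ _ (expR (18 * k)%:R * (2 * expR (- (r * 6^-1 ^+ 2 * n%:R))))).
    by apply: ler_wpM2r; [rewrite mulr_ge0// expR_ge0|exact: pow2_le_expR].
  rewrite mulrCA ler_pM2l// -expRD ler_expR natrM.
  have : 1296 * y <= r * n%:R.
    by rewrite yc mulrA ler_pM2r// mulrC -ler_pdivrMr.
  lra.
have h3 : k%:R * expR (- n%:R) <= 2 * E.
  apply: (@le_trans _ _ (n%:R * expR (- n%:R))).
    apply: ler_wpM2r; first exact: expR_ge0.
    by lra.
  apply: (@le_trans _ _ (2 * expR (n%:R / 2) * expR (- n%:R))).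
    apply: ler_wpM2r; first exact: expR_ge0.
    by have := ler_expR_id (n%:R / 2 : R); lra.
  by rewrite -mulrA ler_pM2l// -expRD ler_expR; lra.
have E0 : 0 <= E by exact: expR_ge0.
have : 8 * E <= c * E by rewrite ler_wpM2r.
lra.
Qed.

End Constants.

(** * A negative ridge beats all larger ones *)

Section Comparison.
Context (R : realType).

(** The fraction of the tail that the negative ridge leaves; it is chosen so
    that the main term 9 eps^2 of [averaged_risk_upper] is a quarter of the
    constant 1 / (1 + 4 C)^2 of [averaged_risk_lower]. *)
Definition shrink (C : R) : R := (6 * (1 + 4 * C))^-1.

(** Lower bound on c that makes the sum of the remaining terms of
    [averaged_risk_upper] at most another quarter. *)
Definition risk_const (C : R) : R :=
  4 * (1 + 4 * C) ^+ 2 * (20 + 16 * C * (1 + (shrink C ^+ 2)^-1) + 4 * C / shrink C ^+ 2).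

Lemma shrink_bounds (C : R) : 0 <= C -> 0 < shrink C /\ shrink C <= 2^-1.
Proof.
move=> C0; have D : 2 <= 6 * (1 + 4 * C) by lra.
by split; [rewrite invr_gt0; lra|rewrite lef_pV2 ?posrE; lra].
Qed.

Lemma risk_const_ge0 (C : R) : 0 <= C -> 0 <= risk_const C.
Proof.
move=> C0; have [eps0 _] := shrink_bounds C0.
have e2 : 0 < shrink C ^+ 2 by rewrite exprn_gt0.
have i0 : 0 <= (shrink C ^+ 2)^-1 by rewrite invr_ge0 ltW.
apply: mulr_ge0; first by apply: mulr_ge0 => //; exact: sqr_ge0.
apply: addr_ge0; last by apply: divr_ge0; [exact: mulr_ge0|exact: ltW].
by apply: addr_ge0 => //; apply: mulr_ge0; [exact: mulr_ge0|exact: addr_ge0].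
Qed.

(** All contributions are measured in units of G = H (S / n)^2; [V1] and [V2]
    stand for the head and tail parts of the variance. *)
Lemma risk_budget (C c G Th V1 V2 v : R) (eps := shrink C) :
  0 <= C -> 1 <= c -> risk_const C <= c -> 0 <= G -> 0 <= v ->
  Th <= G / c -> v * V1 <= 6 * (G / c) -> v * V2 <= 4 * C / eps ^+ 2 * (G / c) ->
  G * (9 * eps ^+ 2 + 12 / c) + Th * (2 + 16 * C * (1 + (eps ^+ 2 * c)^-1)) +
    v * (V1 + V2) <= G / (1 + 4 * C) ^+ 2 / 2.
Proof.
move=> C0 c1 cc G0 v0 hTh hV1 hV2; have c0 : 0 < c by lra.
have [eps0 _] := shrink_bounds C0; rewrite -/eps in eps0.
have D0 : 0 < 1 + 4 * C by lra.
have e2 : 0 < eps ^+ 2 by rewrite exprn_gt0.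
pose g := G / c; have g0 : 0 <= g by rewrite divr_ge0// ltW.
rewrite -/g in hTh hV1 hV2.
have h9 : 9 * eps ^+ 2 = ((1 + 4 * C) ^+ 2)^-1 / 4.
  by rewrite /eps /shrink; field; rewrite gt_eqF.
have hinv : (eps ^+ 2 * c)^-1 <= (eps ^+ 2)^-1.
  by rewrite lef_pV2 ?posrE ?mulr_gt0// ler_peMr// ltW.
have ieps : 0 <= (eps ^+ 2)^-1 by rewrite invr_ge0 ltW.
have iec : 0 <= (eps ^+ 2 * c)^-1 by rewrite invr_ge0 mulr_ge0 ?ltW//.
pose f := 2 + 16 * C * (1 + (eps ^+ 2)^-1).
have hf : Th * (2 + 16 * C * (1 + (eps ^+ 2 * c)^-1)) <= g * f.
  apply: (@le_trans _ _ (g * (2 + 16 * C * (1 + (eps ^+ 2 * c)^-1)))).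
    by apply: ler_wpM2r => //; rewrite addr_ge0 ?mulr_ge0// addr_ge0.
  by apply: ler_wpM2l => //; rewrite lerD2l; apply: ler_wpM2l; [rewrite mulr_ge0|rewrite lerD2l].
have hc : g * (20 + 16 * C * (1 + (eps ^+ 2)^-1) + 4 * C / eps ^+ 2) <= G / (1 + 4 * C) ^+ 2 / 4.
  rewrite /g mulrAC ler_pdivrMr//.
  apply: (@le_trans _ _ (G / (1 + 4 * C) ^+ 2 / 4 * risk_const C)).
    rewrite /risk_const -/eps le_eqVlt; apply/orP; left; apply/eqP.
    by field; rewrite !gt_eqF.
  by apply: ler_wpM2l => //; rewrite !divr_ge0// exprn_ge0// ltW.
rewrite mulrDr (_ : G * (12 / c) = 12 * g); last by rewrite /g; ring.
rewrite h9 mulrDr /f in hf *.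
have -> : G * (((1 + 4 * C) ^+ 2)^-1 / 4) = G / (1 + 4 * C) ^+ 2 / 4 by ring.
lra.
Qed.

Lemma large_constant (r a q : R) : 0 < r -> 0 < a -> 0 <= q ->
  exists c, [/\ 8 <= c, q <= c, 1296 / r <= c & 19 <= r * a * c].
Proof.
move=> r0 a0 q0; have ra0 : 0 < r * a by rewrite mulr_gt0.
have t1 : 0 < 19 / (r * a) by apply: divr_gt0; rewrite // ltr0n.
have t2 : 0 < 1296 / r by apply: divr_gt0; [rewrite ltr0n|].
exists (8 + 19 / (r * a) + 1296 / r + q); move: t1 t2 => t1 t2; split.
- by move: t1 t2; move: (_ / (r * a)) (_ / r) => u v; lra.
- by move: t1 t2; move: (_ / (r * a)) (_ / r) => u v; lra.
- by move: t1 t2; move: (_ / (r * a)) (_ / r) => u v; lra.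
- rewrite mulrC -ler_pdivrMr//.
  by move: t1 t2; move: (_ / (r * a)) (_ / r) => u v; lra.
Qed.

Section NegativeOptimum.
Context (n p : nat) (X : 'M[R]_(n, p)) (lam : 'rV[R]_p) (k : 'I_p).
Context (thb : 'cV[R]_p) (veps : R) (C c lmax : R).
Notation x := (fun i => col i X).
Notation head := (fun i : 'I_p => (i < k)%N).
Notation tail := (fun i : 'I_p => ~~ (i < k)%N).
Notation S := (tail_sum lam k).
Notation eps := (shrink C).
Let H := \sum_(i < p | head i) thb i 0 ^+ 2 / lam 0 i.
Let Th := \sum_(i < p | tail i) lam 0 i * thb i 0 ^+ 2.
Let F := averaged_risk X lam veps thb.

Hypothesis n0 : (0 < n)%N.
Hypothesis lam0 : forall i, 0 < lam 0 i.
Hypothesis C0 : 0 <= C.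
Hypothesis c1 : 1 <= c.
Hypothesis cc : risk_const C <= c.
Hypothesis tail_form : forall v,
  `|\sum_(i | tail i) dot (x i) v ^+ 2 - S * dot v v| <= eps / 2 * S * dot v v.
Hypothesis head_form : forall a : 'I_p -> R,
  n%:R / 2 * \sum_(i | head i) lam 0 i * a i ^+ 2 <=
  dot (\sum_(i | head i) a i *: x i) (\sum_(i | head i) a i *: x i).
Hypothesis head_norm : forall j, head j -> dot (x j) (x j) <= lam 0 j * (C * n%:R).
Hypothesis head_large : forall j, head j -> S <= n%:R * lam 0 j.
Hypothesis tail_signal_norm :
  \sum_(j | tail j) thb j 0 ^+ 2 * dot (x j) (x j) <=
  C * n%:R * \sum_(j | tail j) thb j 0 ^+ 2 * lam 0 j.
Hypothesis tail_lam_norm :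
  \sum_(j | tail j) lam 0 j * dot (x j) (x j) <=
  C * n%:R * \sum_(j | tail j) lam 0 j ^+ 2.
Hypothesis tail_le : forall i, tail i -> lam 0 i <= lmax.
Hypothesis lmax_small : c * n%:R * lmax <= S.
Hypothesis noise : veps ^+ 2 <= H / c *
  Num.min (S ^+ 2 / (n * k)%:R) (S ^+ 4 / (n%:R ^+ 3 * tail_sum_sq lam k)).
Hypothesis signal : Th <= c^-1 * H * (S / n%:R) ^+ 2.

Let c0 : 0 < c. Proof. by apply: lt_le_trans c1. Qed.
Let nR : 0 < n%:R :> R. Proof. by rewrite ltr0n. Qed.
Let l0 : R := - (1 - eps) * S.
Let eps0 : 0 < eps. Proof. exact: (shrink_bounds C0).1. Qed.
Let eps1 : eps <= 2^-1. Proof. exact: (shrink_bounds C0).2. Qed.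

Let S0 : 0 < S.
Proof.
rewrite /tail_sum (bigD1 k)//=; apply: (lt_le_trans (lam0 k)).
by rewrite lerDl; apply: sumr_ge0 => i _; exact: ltW.
Qed.

Let S20 : 0 < tail_sum_sq lam k.
Proof.
rewrite /tail_sum_sq (bigD1 k)//=; apply: (@lt_le_trans _ _ (lam 0 k ^+ 2)).
  exact: exprn_gt0.
by rewrite lerDl; apply: sumr_ge0 => i _; exact: sqr_ge0.
Qed.

Let H0 : 0 <= H.
Proof. by apply: sumr_ge0 => i _; rewrite divr_ge0 ?sqr_ge0// ltW. Qed.

Let G := H * (S / n%:R) ^+ 2.
Let G0 : 0 <= G. Proof. by apply: mulr_ge0 => //; exact: sqr_ge0. Qed.

Let l0_range : ridge_range X l0.
Proof. exact: (start_in_range n0 lam0 eps0 tail_form). Qed.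

Let l0_neg : l0 < 0.
Proof. by rewrite /l0 mulNr oppr_lt0 mulr_gt0// subr_gt0; apply: le_lt_trans eps1 _; rewrite invf_lt1// ltr1n. Qed.

Lemma risk_at_start : F l0 <= G / (1 + 4 * C) ^+ 2 / 2.
Proof.
have := averaged_risk_upper veps n0 lam0 eps0 eps1 c0 tail_form head_form
  tail_signal_norm tail_lam_norm tail_le lmax_small.
move/le_trans; apply; apply: (risk_budget (G := G) (Th := Th)) => //.
- exact: sqr_ge0.
- by apply: le_trans signal _; rewrite /G le_eqVlt; apply/orP; left; apply/eqP; ring.
- have v1 : veps ^+ 2 <= H / c * (S ^+ 2 / (n * k)%:R).
    apply: le_trans noise _; apply: ler_wpM2l; first by rewrite divr_ge0// ltW.
    by rewrite ge_min lexx.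
  have k6 : 0 <= 6 * k%:R / n%:R :> R by rewrite divr_ge0 ?mulr_ge0// ltW.
  apply: le_trans (ler_wpM2r k6 v1) _.
  have [->|kn0] := posnP k.
    by rewrite mulr0 mul0r mulr0 mulr_ge0// divr_ge0// ltW.
  rewrite /G le_eqVlt; apply/orP; left; apply/eqP; rewrite natrM.
  by field; rewrite !gt_eqF// ltr0n.
- have v2 : veps ^+ 2 <= H / c * (S ^+ 4 / (n%:R ^+ 3 * tail_sum_sq lam k)).
    apply: le_trans noise _; apply: ler_wpM2l; first by rewrite divr_ge0// ltW.
    by rewrite ge_min lexx orbT.
  have k6 : 0 <= 4 * C * n%:R * tail_sum_sq lam k / (eps ^+ 2 * S ^+ 2).
    apply: divr_ge0; first by rewrite !mulr_ge0// ltW.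
    by apply: mulr_ge0; exact: sqr_ge0.
  apply: le_trans (ler_wpM2r k6 v2) _.
  rewrite /G le_eqVlt; apply/orP; left; apply/eqP.
  by field; rewrite !gt_eqF.
Qed.

(** If the head carries no signal, the condition on the tail leaves none there
    either. *)
Lemma signal_positive : thb != 0 -> 0 < G.
Proof.
move=> thb0; rewrite lt0r G0 andbT; apply: contra_neq thb0 => Gz.
have Hz : H = 0.
  move/eqP: Gz; rewrite /G mulf_eq0 sqrf_eq0 mulf_eq0 invr_eq0.
  by rewrite (gt_eqF S0) (gt_eqF nR) !orbF => /eqP.
have Thz : Th = 0.
  apply/eqP; rewrite eq_le; apply/andP; split.
    by apply: le_trans signal _; rewrite Hz mulr0 mul0r.
  by apply: sumr_ge0 => i _; rewrite mulr_ge0 ?sqr_ge0// ltW.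
apply/matrixP => i b; rewrite ord1 mxE; apply/eqP; rewrite -sqrf_eq0.
have [hi|hi] := boolP (i < k)%N.
  have /psumr_eq0P/(_ i hi)/eqP : H = 0 by [].
  by rewrite mulf_eq0 invr_eq0 (gt_eqF (lam0 i)) orbF; apply => j _; rewrite divr_ge0 ?sqr_ge0// ltW.
have /psumr_eq0P/(_ i hi)/eqP : Th = 0 by [].
by rewrite mulf_eq0 (gt_eqF (lam0 i)); apply => j _; rewrite mulr_ge0 ?sqr_ge0// ltW.
Qed.

Lemma risk_gap : 0 < G ->
  exists2 e, 0 < e & forall l, ridge_range X l -> F l < F l0 + e -> l <= - (S / 2).
Proof.
move=> Gp; have D0 : 0 < (1 + 4 * C) ^+ 2 by rewrite exprn_gt0// ltr_pwDl// mulr_ge0.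
exists (G / (1 + 4 * C) ^+ 2 / 2); first by rewrite !divr_gt0.
move=> l _ Fl; rewrite leNgt; apply/negP => /ltW lS.
have := averaged_risk_lower thb veps n0 lam0 eps1 C0 tail_form head_norm head_large lS.
rewrite -/H -/G -/F leNgt => /negP; apply; apply: (lt_le_trans Fl).
by have := risk_at_start; lra.
Qed.

Lemma all_minimizers_negative :
  (exists2 l, minimizer (ridge_range X) F l & l < 0) /\
  (thb != 0 -> forall l, minimizer (ridge_range X) F l -> l < 0).
Proof.
have S2 : - (S / 2) < 0 by rewrite oppr_lt0 divr_gt0.
split; last first.
  move=> /signal_positive/risk_gap[e e0 He] l lmin.
  by apply: le_lt_trans S2; exact: (minimizer_le l0_range e0 He).
have [Gp|Gn] := boolP (0 < G).
  have [l lmin lS] := minimizer_exists l0_range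
    (fun l _ => averaged_risk_ge0 X thb veps lam0 l) (fun l lX => ltW lX) (risk_gap Gp).
  by exists l => //; exact: le_lt_trans lS S2.
(* Without signal there is no noise: the risk at l0 is 0, its minimum. *)
have Gz : G = 0 by apply/eqP; rewrite eq_le G0 andbT leNgt.
exists l0 => // m e mX e0; apply: subset_closure; split => //.
have := risk_at_start; rewrite Gz !mul0r => F0.
by apply: (le_lt_trans F0); rewrite ltr_wpDl// averaged_risk_ge0.
Qed.

End NegativeOptimum.
End Comparison.

(** * Negativity of the optimal ridge *)

Theorem theorem19 (R : realType) (sigmax : R) (hsigmax : 0 < sigmax) :
  exists b c : R, [/\ 0 < b, 0 < c &
  forall (n p : nat) (lam : 'rV[R]_p)
    (d0 : measure_display) (T0 : measurableType d0) (P0 : probability T0 R)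
    (x : {RV P0 >-> p.-tuple R})
    (d : measure_display) (T : measurableType d) (P : probability T R)
    (X : {RV P >-> n.-tuple (p.-tuple R)})
    (thetabar : 'cV[R]_p) (theta : {RV P >-> p.-tuple R})
    (veps : R) (k : 'I_p),
  (0 < n < p)%N ->
  (forall i j : 'I_p, (i <= j)%N -> lam 0 j <= lam 0 i) ->
  (forall i : 'I_p, 0 < lam 0 i) ->
  mean_zero x ->
  has_covariance x (Sigma lam) ->
  iid_rows X x ->
  (forall i : 'I_n,
     (psi2_norm_vec P (fun w => row i (whitened X lam w)) <= sigmax%:E)%E) ->
  0 <= veps ->
  independent_entries X ->
  random_sign_flip theta thetabar ->
  independent2 P X theta ->
  (* k is the least index at which rho exceeds b *)
  b < rho n lam k ->
  (forall j : 'I_p, b < rho n lam j -> (k <= j)%N) ->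
  k%:R < n%:R / c ->
  (* small noise *)
  veps ^+ 2 <=
    wnorm (invmx (head_mx k (Sigma lam))) (head_vec k thetabar) ^+ 2 / c *
    Num.min (tail_sum lam k ^+ 2 / (n * k)%:R)
            (tail_sum lam k ^+ 4 / (n%:R ^+ 3 * tail_sum_sq lam k)) ->
  (* jump in effective rank *)
  c < rho n lam k ->
  (* small signal in the tail *)
  wnorm (tail_mx k (Sigma lam)) (tail_vec k thetabar) ^+ 2 <=
    c^-1 * wnorm (invmx (head_mx k (Sigma lam))) (head_vec k thetabar) ^+ 2 *
    (tail_sum lam k / n%:R) ^+ 2 ->
  exists E : set T,
    [/\ measurable E,
        forall w, E w -> negative_optimum X lam veps thetabar theta w
      & ((1 - c * expR (- (n%:R / c)))%:E <= P E)%E]].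
Proof.
pose K : R := 2 * sigmax; have K0 : 0 < K by rewrite mulr_gt0.
pose C := 2 * K ^+ 2; have C0 : 0 <= C by rewrite mulr_ge0// sqr_ge0.
have [eps0 eps1] := shrink_bounds C0; set eps := shrink C in eps0 eps1.
pose r := chernoff_rate K / 2.
have r0 : 0 < r by rewrite divr_gt0// chernoff_rate_gt0.
pose a := (eps / 6) ^+ 2; have a0 : 0 < a by rewrite exprn_gt0// divr_gt0.
have D0 : 0 < 1 + 4 * C by rewrite ltr_pwDl// mulr_ge0.
have rc0 := risk_const_ge0 C0.
have [c [c8 crisk crc crac]] := large_constant r0 a0 rc0.
have c0 : 0 < c by apply: lt_le_trans c8.
have c1 : 1 <= c by apply: le_trans c8; rewrite ler1n.
(* With b = 1, the minimality of k gives S <= n lam_j for every j < k. *)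
exists 1, c; split => //.
move=> n p lam d0 T0 P0 x d T P X thetabar theta veps k /andP[n0 np] lam_mono lam0
  mean cov [_ law] psi _ ind flips _ rho1 kmin kn noise rhoc signal.
have nR : 0 < n%:R :> R by rewrite ltr0n.
have sgW ij : std_subgaussian P K (std_entry X lam ij).
  exact: (std_entry_subgaussian lam0 hsigmax mean cov (law _) (psi _)).
have indW := std_entry_independent lam ind.
have XW w i j : mx_of_rows (X w) i j = Num.sqrt (lam 0 j) * std_entry X lam (i, j) w.
  by rewrite mxE -(entryE X lam0 (i, j)).
have cS : c * n%:R * lam 0 k <= tail_sum lam k.
  by move/ltW: rhoc; rewrite /rho ler_pdivlMr ?mulr_gt0// mulrA.
have cSn : c * n%:R <= tail_sum lam k / lam 0 k by rewrite ler_pdivlMr.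
have eps01 : 0 < eps <= 1 by rewrite eps0/=; apply: le_trans eps1 _; rewrite invf_le1// ler1n.
have := likely_and (likely_tail_form k lam0 lam_mono K0 sgW indW XW eps01)
  (likely_and (likely_head_form k lam0 K0 sgW indW XW)
  (likely_and (likely_head_norm k lam0 K0 sgW indW XW)
  (likely_and
    (likely_tail_norm k lam0 K0 sgW indW XW (f := fun j => thetabar j 0 ^+ 2) (fun j => sqr_ge0 _))
    (likely_tail_norm k lam0 K0 sgW indW XW (f := fun j => lam 0 j) (fun j => ltW (lam0 j)))))).
move=> [E [mE HE PE]]; exists E; split => //; last first.
  have -> : P E = (1 - P (~` E))%E by rewrite -probability_setC ?setCK//; exact: measurableC.
  rewrite EFinB leeB//; apply: le_trans PE _; rewrite lee_fin.
  exact: (failure_bound n0 c8 r0 crac crc (mulr_ge0 (ltW r0) (ltW a0)) kn cSn).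
move=> w /HE[tail_form [head_form [head_norm [signal_norm lam_norm]]]].
rewrite /negative_optimum.
rewrite (_ : mean_risk X lam veps theta w =
    averaged_risk (mx_of_rows (X w)) lam veps thetabar); last first.
  by apply/funext => l; exact: mean_risk_formula.
have tailE : (fun i : 'I_p => (k <= i)%N) =1 (fun i : 'I_p => ~~ (i < k)%N).
  by move=> i; rewrite leqNgt.
rewrite head_wnorm// in noise; rewrite head_wnorm// tail_wnorm// (eq_bigl _ _ tailE) in signal.
apply: (all_minimizers_negative (k := k) (C := C) (c := c) (lmax := lam 0 k)) => //.
- move=> j jk; have : ~ 1 < rho n lam j by move/kmin; rewrite leqNgt jk.
  move/negP; rewrite -leNgt /rho ler_pdivrMr ?mulr_gt0// mul1r; apply: le_trans.
  rewrite /tail_sum [leRHS](bigID (fun i : 'I_p => (k <= i)%N))/= -[leLHS]addr0; apply: lerD.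
    rewrite le_eqVlt; apply/orP; left; apply/eqP; apply: eq_bigl => i.
    by case: leqP => [ki|]; rewrite ?andbF// andbT (leq_trans (ltnW jk) ki).
  by apply: sumr_ge0 => i _; exact: ltW.
- by move=> i; rewrite -leqNgt; exact: lam_mono.
Qed.
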